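(* Let $d\ge 2$ and $q_1,\dots,q_d\ge 2$ be integers, and let $\mathrm{DL}=\mathrm{DL}(q_1,\dots,q_d)$. Let $\mathfrak S=\mathfrak S(q_1,\dots,q_d)$ and $\mathcal A=\mathcal A(q_1,\dots,q_d)$ be the groups defined in the context, both acting on $\mathrm{DL}$ by graph automorphisms. Then the full isometry group (graph automorphism group) of $\mathrm{DL}$ is the semidirect product of $\mathfrak S$ with $\mathcal A$ with respect to the action $(\sigma,g)\mapsto g^\sigma=\sigma g\sigma^{-1}$ of $\mathfrak S$ on $\mathcal A$: $$\mathrm{Aut}(\mathrm{DL})=\mathfrak S\ltimes\mathcal A .$$ Thus $\mathrm{Aut}(\mathrm{DL})$ (with the topology of pointwise convergence) is amenable, and it is unimodular if and only if all $q_i$ coincide.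
   Context: For an integer $q\ge 2$, $\mathbb T_q$ is the homogeneous tree in which every vertex has $q+1$ neighbours, with graph metric $d(\cdot,\cdot)$, a fixed origin $o$ and a fixed end $\omega$ (an end is a class of one-sided infinite geodesic rays, two rays being equivalent if their symmetric difference is finite). The predecessor $x^-$ of a vertex $x$ is the neighbour of $x$ on the unique geodesic ray from $x$ representing $\omega$; the other $q$ neighbours are the successors of $x$. Write $x\preccurlyeq y$ if $x$ lies on the geodesic ray from $y$ to $\omega$, and let $x\curlywedge y$ be the maximal common ancestor of $x,y$. The Busemann function is $\mathfrak h(x)=d(x,x\curlywedge o)-d(o,x\curlywedge o)$, so $\mathfrak h(x^-)=\mathfrak h(x)-1$. With $T_j=\mathbb T_{q_j}$, the Diestel-Leader graph $\mathrm{DL}(q_1,\dots,q_d)$ has vertex set $\{x_1\cdots x_d\in T_1\times\dots\times T_d:\ \mathfrak h(x_1)+\dots+\mathfrak h(x_d)=0\}$, and $x_1\cdots x_d$, $y_1\cdots y_d$ are neighbours iff there are $i\ne j$ such that $x_i\sim y_i$ in $T_i$, $x_j\sim y_j$ in $T_j$, and $x_k=y_k$ for all $k\ne i,j$. $\mathrm{Aff}(\mathbb T_q)$ is the group of all automorphisms of $\mathbb T_q$ that fix $\omega$; for $g\in \mathrm{Aff}(\mathbb T_q)$ the number $\mathfrak h(gx)-\mathfrak h(x)$ does not depend on $x$ and is denoted $\mathfrak h(g)$. Set $$\mathcal A(q_1,\dots,q_d)=\{g_1\cdots g_d\in \mathrm{Aff}(\mathbb T_{q_1})\times\dots\times\mathrm{Aff}(\mathbb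 T_{q_d}):\ \mathfrak h(g_1)+\dots+\mathfrak h(g_d)=0\},$$ acting on $\mathrm{DL}$ coordinatewise: $gx=(g_1x_1)\cdots(g_dx_d)$. $\mathfrak S(q_1,\dots,q_d)$ is the group of all permutations $\sigma$ of $\{1,\dots,d\}$ with $q_{\sigma(j)}=q_j$ for all $j$, acting on $\mathrm{DL}$ by $\sigma x=x_{\sigma^{-1}(1)}\cdots x_{\sigma^{-1}(d)}$ (trees with the same branching number are identified). A locally compact group is amenable if it carries a finitely additive left invariant probability measure (in the standard sense for locally compact groups), and unimodular if its left Haar measure is right invariant. *)

(* Defs.v *)
From HB Require Import structures.
From mathcomp Require Import all_boot all_order all_algebra.
From mathcomp Require Import perm.
From mathcomp Require Import all_classical all_reals all_analysis.

Set Implicit Arguments.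
Unset Strict Implicit.
Unset Printing Implicit Defensive.

Import GRing.Theory.

Local Open Scope classical_set_scope.
Local Open Scope ring_scope.

HB.mixin Record isTopologicalGroup G & PointedTopological G & Group G := {
  mulg_continuous : continuous (fun x : G * G => (x.1 * x.2)%g);
  invg_continuous : continuous (fun x : G => (x^-1)%g)
}.

#[short(type="topologicalGroupType")]
HB.structure Definition TopologicalGroup :=
  {G of PointedTopological G & Group G & isTopologicalGroup G}.

Section Haar.
Variables (R : realType) (G : topologicalGroupType).

Definition locally_compact_group : Prop :=
  hausdorff_space G /\ locally_compact [set: G].

Local Notation borelType := (g_sigma_algebraType (@open G)).

Implicit Types (m : set borelType -> \bar R) (mu : {measure set borelType -> \bar R}).

Definition left_invariant m : Prop :=
  forall (g : G) (A : set borelType), measurable A ->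
    m [set (g * x)%g | x in A] = m A.

Definition right_invariant m : Prop :=
  forall (g : G) (A : set borelType), measurable A ->
    m [set (x * g)%g | x in A] = m A.

Definition radon mu : Prop :=
  [/\ forall K : set G, compact K -> (mu K < +oo)%E,
      forall A : set borelType, measurable A ->
        mu A = ereal_inf [set mu U | U in [set U : set G | open U /\ A `<=` U]]
    & forall U : set G, open U ->
        mu U = ereal_sup [set mu K | K in [set K : set G | compact K /\ K `<=` U]]].

Definition left_haar mu : Prop :=
  [/\ mu setT != 0%E, radon mu & left_invariant mu].

Definition locally_null mu (A : set borelType) : Prop :=
  forall K : set G, compact K -> mu (A `&` K) = 0%E.

(* A finitely additive measure [m] as below is the same thing as a left
   invariant mean on the space of essentially bounded functions: as usual for
   nondiscrete groups, [m] has to ignore the locally null sets of the Haar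
   measure. *)
Definition amenable : Prop :=
  locally_compact_group /\
  exists2 mu : {measure set borelType -> \bar R}, left_haar mu &
  exists m : {content set borelType -> \bar R},
    [/\ m setT = 1%E, left_invariant m
      & forall A, measurable A -> locally_null mu A -> m A = 0%E].

Definition unimodular : Prop :=
  (exists mu : {measure set borelType -> \bar R}, left_haar mu) /\
  (forall mu : {measure set borelType -> \bar R},
     left_haar mu -> right_invariant mu).

End Haar.

(* Via the embeddings [iS] and [iA], [G] is the semidirect product of [S] with
   the normal subgroup [A], on which [S] acts by conjugation in [G]. *)
Definition semidirect_product (G S A : groupType) (iS : S -> G) (iA : A -> G) :
    Prop :=
  [/\ {morph iS : s t / (s * t)%g} /\ injective iS,
      {morph iA : a b / (a * b)%g} /\ injective iA,
      forall (s : S) (a : A), exists b : A, iA b = (iS s * iA a * (iS s)^-1)%g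
    & bijective (fun p : S * A => (iS p.1 * iA p.2)%g)].

Record graph := Graph {
  vertex :> choiceType;
  adj : rel vertex;
  adj_sym : symmetric adj;
  adj_irr : irreflexive adj
}.

(* The inverse is determined by [aut_fun]; storing it makes the group
   operations explicit. *)
Record graph_aut (X : graph) := GraphAut {
  aut_fun :> X -> X;
  aut_inv : X -> X;
  aut_funK : cancel aut_fun aut_inv;
  aut_invK : cancel aut_inv aut_fun;
  aut_adj : forall x y, adj (aut_fun x) (aut_fun y) = adj x y
}.

Section GraphAut.
Variable X : graph.
Implicit Types f g h : graph_aut X.

Lemma graph_autP f g : aut_fun f =1 aut_fun g -> f = g.
Proof.
case: f g => [f f' fK f'K fA] [g g' gK g'K gA] /= /funext fg.
subst g; have fg' : f' = g' by apply: funext => x; rewrite -{1}[x]g'K fK.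
by subst g'; congr GraphAut; exact: Prop_irrelevance.
Qed.

HB.instance Definition _ := gen_eqMixin (graph_aut X).
HB.instance Definition _ := gen_choiceMixin (graph_aut X).

Definition aut_one : graph_aut X :=
  @GraphAut X idfun idfun (fun=> erefl) (fun=> erefl) (fun _ _ => erefl).

Lemma aut_comp_adj f g x y : adj (f (g x)) (f (g y)) = adj x y.
Proof. by rewrite !aut_adj. Qed.

Definition aut_comp f g : graph_aut X :=
  GraphAut (can_comp (aut_funK f) (aut_funK g))
           (can_comp (aut_invK g) (aut_invK f)) (@aut_comp_adj f g).

Lemma aut_inverse_adj f x y : adj (aut_inv f x) (aut_inv f y) = adj x y.
Proof. by rewrite -(aut_adj f) !aut_invK. Qed.

Definition aut_inverse f : graph_aut X :=
  GraphAut (aut_invK f) (aut_funK f) (@aut_inverse_adj f).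

Lemma aut_compA : associative aut_comp.
Proof. by move=> f g h; exact: graph_autP. Qed.

Lemma aut_comp1f : left_id aut_one aut_comp.
Proof. by move=> f; exact: graph_autP. Qed.

Lemma aut_compf1 : right_id aut_one aut_comp.
Proof. by move=> f; exact: graph_autP. Qed.

Lemma aut_compVf : left_inverse aut_one aut_inverse aut_comp.
Proof. by move=> f; apply: graph_autP => x /=; rewrite aut_funK. Qed.

Lemma aut_compfV : right_inverse aut_one aut_inverse aut_comp.
Proof. by move=> f; apply: graph_autP => x /=; rewrite aut_invK. Qed.

HB.instance Definition _ := isGroup.Build (graph_aut X)
  aut_compA aut_comp1f aut_compf1 aut_compVf aut_compfV.

HB.instance Definition _ := isPointed.Build (graph_aut X) aut_one.

HB.instance Definition _ := Topological.copy (graph_aut X)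
  (initial_topology (@aut_fun X : graph_aut X -> {ptws X -> discrete_topology X})).

End GraphAut.

Section GraphAutTopology.
Variable X : graph.
Local Notation G := (graph_aut X).

Lemma nbhs_aut_eval (f : G) (x : X) : nbhs f [set g : G | g x = f x].
Proof.
have cf := @initial_continuous G {ptws X -> discrete_topology X} (@aut_fun X) f.
have cx := @proj_continuous X (fun=> discrete_topology X) x (aut_fun f).
have /= := continuous_comp cf cx.
move=> /(_ [set y | y = f x]); apply.
apply: open_nbhs_nbhs; split => //.
exact: (@discrete_open (discrete_topology X) [set y | y = f x]).
Qed.

Lemma aut_cvg (F : set_system G) (f : G) : Filter F ->
  (forall x, F [set g : G | g x = f x]) -> F --> f.
Proof.
move=> FF Ff.
suff : (@aut_fun X : G -> {ptws discrete_topology X -> discrete_topology X}) @ F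
    --> (aut_fun f : {ptws discrete_topology X -> discrete_topology X}).
  move=> cF A; rewrite nbhsE => -[B [[C oC <-] Cf] BA].
  by apply: filterS BA _; apply: cF; exact: open_nbhs_nbhs.
apply/pointwise_cvgP => x A /= Afx.
have {}Afx : A (f x) by exact: nbhs_singleton Afx.
change (F [set g : G | A (g x)]).
by apply: filterS (Ff x) => g /= ->.
Qed.

Lemma aut_mul_continuous : continuous (fun x : G * G => (x.1 * x.2)%g).
Proof.
move=> [f g]; apply: aut_cvg => x /=.
exists ([set f' : G | f' (g x) = f (g x)], [set g' : G | g' x = g x]).
  by split; exact: nbhs_aut_eval.
move=> [f' g'] /= [f'gx g'x].
by rewrite -f'gx -g'x.
Qed.

Lemma aut_inv_continuous : continuous (fun x : G => (x^-1)%g).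
Proof.
move=> f; have FF := fmap_filter (fun x : G => (x^-1)%g) (nbhs_filter f).
apply: (@aut_cvg _ (f^-1)%g FF) => x.
apply: filterS (nbhs_aut_eval f (aut_inv f x)) => g gx.
change (aut_inv g x = aut_inv f x).
by rewrite -[in LHS](aut_invK f x) -gx aut_funK.
Qed.

HB.instance Definition _ := isTopologicalGroup.Build (graph_aut X)
  aut_mul_continuous aut_inv_continuous.

End GraphAutTopology.

Section Walks.
Variable X : graph.
Implicit Types (x y : X) (r s : nat -> X).

Definition walk x y (p : seq X) : Prop := path (@adj X) x p /\ last x p = y.

Definition connected_graph : Prop := forall x y, exists p, walk x y p.

Definition acyclic_graph : Prop :=
  forall c : seq X, ucycle (@adj X) c -> (size c <= 2)%N.

(* The graph metric; the default value is irrelevant in connected graphs. *)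
Definition dist x y : nat :=
  xget 0%N [set n | (exists2 p, walk x y p & size p = n) /\
                    (forall p, walk x y p -> (n <= size p)%N)].

Definition geodesic_ray r : Prop := forall m n, dist (r m) (r (m + n)%N) = n.

Definition ray_equiv r s : Prop := finite_set (range r `+` range s).

Definition is_end (w : set (nat -> X)) : Prop :=
  exists2 r, geodesic_ray r & w = [set s | geodesic_ray s /\ ray_equiv r s].

End Walks.

Record ended_graph := EndedGraph {
  egraph :> graph;
  origin : egraph;
  omega : set (nat -> egraph)
}.

Arguments omega : clear implicits.

Definition homogeneous_tree (q : nat) (T : ended_graph) : Prop :=
  [/\ connected_graph T, acyclic_graph T,
      forall x : T, ([set y | adj x y] #= `I_q.+1)%card
    & is_end (omega T)].

Section Busemann.
Variable T : ended_graph.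
Implicit Types x y : T.

Definition ancestor x y : Prop :=
  exists r, [/\ omega T r, r 0%N = y & range r x].

(* The maximal [c] is unique in trees, so [xget] is only used to name it. *)
Definition confluent x y : T :=
  xget x [set c | [/\ ancestor c x, ancestor c y
                    & forall c', ancestor c' x -> ancestor c' y ->
                        ancestor c' c]].

Definition busemann x : int :=
  (dist x (confluent x (origin T)))%:Z
  - (dist (origin T) (confluent x (origin T)))%:Z.

Definition fixes_end (g : graph_aut T) : Prop :=
  [set g \o r | r in omega T] = omega T.

(* For [g] fixing the end of a homogeneous tree such a [k] always exists; it is
   the number h(g). *)
Definition has_height (g : graph_aut T) (k : int) : Prop :=
  forall x, busemann (g x) - busemann x = k.

End Busemann.

(* [T k] plays the role of the tree with branching number [k], so that trees
   with the same branching number are identified. *)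
Section DiestelLeader.
Variables (d : nat) (q : 'I_d -> nat) (T : nat -> ended_graph).

Record dl_vertex := DLVertex {
  dl_coord :> forall j, T (q j);
  dl_sum : \sum_j busemann (dl_coord j) = 0
}.

Lemma dl_vertexP (x y : dl_vertex) : (forall j, x j = y j) -> x = y.
Proof.
case: x y => [x xs] [y ys] /= xy.
have {}xy : x = y by exact: functional_extensionality_dep.
by subst y; congr DLVertex; exact: Prop_irrelevance.
Qed.

HB.instance Definition _ := gen_eqMixin dl_vertex.
HB.instance Definition _ := gen_choiceMixin dl_vertex.

Definition dl_adj (x y : dl_vertex) : bool :=
  [exists i, [exists j, [&& i != j, adj (x i) (y i), adj (x j) (y j)
    & [forall k, (k != i) && (k != j) ==> (x k == y k)]]]].

Lemma dl_adj_sym : symmetric dl_adj.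
Proof.
move=> x y; apply: eq_existsb => i; apply: eq_existsb => j.
rewrite ![adj (x _) _]adj_sym; congr [&& _, _, _ & _].
by apply: eq_forallb => k; rewrite [x k == _]eq_sym.
Qed.

Lemma dl_adj_irr : irreflexive dl_adj.
Proof.
move=> x; apply/existsP => -[i /existsP[j /and4P[_]]].
by rewrite adj_irr.
Qed.

Definition DL : graph := Graph dl_adj_sym dl_adj_irr.

Record affine_prod := AffineProd {
  affine_coord :> forall j, graph_aut (T (q j));
  affine_end : forall j, fixes_end (affine_coord j);
  affine_height : exists2 k : 'I_d -> int,
    forall j, has_height (affine_coord j) (k j) & \sum_j k j = 0
}.

Implicit Types a b c : affine_prod.

Lemma affine_prodP a b : (forall j, a j = b j) -> a = b.
Proof.
case: a b => [a a1 a2] [b b1 b2] /= ab.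
have {}ab : a = b by exact: functional_extensionality_dep.
by subst b; congr AffineProd; exact: Prop_irrelevance.
Qed.

HB.instance Definition _ := gen_eqMixin affine_prod.
HB.instance Definition _ := gen_choiceMixin affine_prod.

Lemma fixes_end1 (X : ended_graph) : fixes_end (1%g : graph_aut X).
Proof. by apply/seteqP; split => [_ [r Xr <-]|r Xr] //; exists r. Qed.

Lemma fixes_endM (X : ended_graph) (f g : graph_aut X) :
  fixes_end f -> fixes_end g -> fixes_end (f * g)%g.
Proof.
move=> Ff Fg; rewrite /fixes_end -[RHS]Ff -[X in _ = [set _ | _ in X]]Fg.
by rewrite image_comp.
Qed.

Lemma fixes_endV (X : ended_graph) (f : graph_aut X) :
  fixes_end f -> fixes_end (f^-1)%g.
Proof.
move=> Ff; rewrite /fixes_end -[X in [set _ | _ in X]]Ff image_comp.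
rewrite -[RHS]image_id; apply: eq_imagel => r _.
by apply: funext => n /=; exact: aut_funK.
Qed.

Lemma affine_height1 : exists2 k : 'I_d -> int,
  forall j, has_height (1%g : graph_aut (T (q j))) (k j) & \sum_j k j = 0.
Proof.
exists (fun=> 0); last by rewrite big1.
by move=> j x; exact: subrr.
Qed.

Definition affine_one : affine_prod :=
  AffineProd (fun j => fixes_end1 (T (q j))) affine_height1.

Lemma affine_heightM a b : exists2 k : 'I_d -> int,
  forall j, has_height (a j * b j)%g (k j) & \sum_j k j = 0.
Proof.
have [k ak k0] := affine_height a; have [l bl l0] := affine_height b.
exists (fun j => k j + l j); last by rewrite big_split /= k0 l0 addr0.
move=> j x; rewrite -(ak j (b j x)) -(bl j x).
by rewrite [RHS]addrA [in RHS]subrK.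
Qed.

Definition affine_mul a b : affine_prod :=
  AffineProd (fun j => fixes_endM (affine_end a j) (affine_end b j))
             (affine_heightM a b).

Lemma affine_heightV a : exists2 k : 'I_d -> int,
  forall j, has_height (a j)^-1%g (k j) & \sum_j k j = 0.
Proof.
have [k ak k0] := affine_height a.
exists (fun j => - k j); last by rewrite sumrN k0 oppr0.
move=> j x; rewrite -(ak j (aut_inv (a j) x)) aut_invK.
exact/esym/opprB.
Qed.

Definition affine_inv a : affine_prod :=
  AffineProd (fun j => fixes_endV (affine_end a j)) (affine_heightV a).

Lemma affine_mulA : associative affine_mul.
Proof. by move=> a b c; apply: affine_prodP => j; exact: mulgA. Qed.

Lemma affine_mul1a : left_id affine_one affine_mul.
Proof. by move=> a; apply: affine_prodP => j; exact: mul1g. Qed.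

Lemma affine_mula1 : right_id affine_one affine_mul.
Proof. by move=> a; apply: affine_prodP => j; exact: mulg1. Qed.

Lemma affine_mulVa : left_inverse affine_one affine_inv affine_mul.
Proof. by move=> a; apply: affine_prodP => j; exact: mulVg. Qed.

Lemma affine_mulaV : right_inverse affine_one affine_inv affine_mul.
Proof. by move=> a; apply: affine_prodP => j; exact: mulgV. Qed.

HB.instance Definition _ := isGroup.Build affine_prod
  affine_mulA affine_mul1a affine_mula1 affine_mulVa affine_mulaV.

Lemma affine_act_sum a (x : DL) : \sum_j busemann (a j (x j)) = 0.
Proof.
have [k ak k0] := affine_height a.
have: \sum_j (k j + busemann (x j)) = 0 by rewrite big_split /= k0 dl_sum.
by under eq_bigr => j _ do rewrite -(ak j (x j)) subrK.
Qed.

Definition affine_act a (x : DL) : DL := DLVertex (affine_act_sum a x).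

Lemma affine_actK a : cancel (affine_act a) (affine_act (a^-1)%g).
Proof. by move=> x; apply: dl_vertexP => j /=; rewrite aut_funK. Qed.

Lemma affine_actVK a : cancel (affine_act (a^-1)%g) (affine_act a).
Proof. by move=> x; apply: dl_vertexP => j /=; rewrite aut_invK. Qed.

Lemma affine_act_adj a (x y : DL) :
  adj (affine_act a x) (affine_act a y) = adj x y.
Proof.
apply: eq_existsb => i; apply: eq_existsb => j /=; rewrite !aut_adj.
congr [&& _, _, _ & _]; apply: eq_forallb => k.
by rewrite (can_eq (aut_funK (a k))).
Qed.

Definition affine_aut a : graph_aut DL :=
  GraphAut (affine_actK a) (affine_actVK a) (affine_act_adj a).

Record branch_perm := BranchPerm {
  branch_fun :> 'S_d;
  branch_eq : forall j, q (branch_fun j) = q j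
}.

Implicit Types s t u : branch_perm.

Lemma branch_permP s t : branch_fun s = branch_fun t -> s = t.
Proof.
case: s t => [s ss] [t tt] /= st; subst t.
by congr BranchPerm; exact: Prop_irrelevance.
Qed.

HB.instance Definition _ := gen_eqMixin branch_perm.
HB.instance Definition _ := gen_choiceMixin branch_perm.

Lemma branch_eq1 j : q ((1%g : 'S_d) j) = q j.
Proof. by rewrite perm1. Qed.

Definition branch_one : branch_perm := BranchPerm branch_eq1.

Lemma branch_eqM s t j : q ((branch_fun t * branch_fun s)%g j) = q j.
Proof. by rewrite permM !branch_eq. Qed.

(* The product of permutations in the library is (s * t) j = t (s j); the group
   law here is composition of functions, i.e. j |-> s (t j). *)
Definition branch_mul s t : branch_perm := BranchPerm (branch_eqM s t).

Lemma branch_eqV s j : q ((branch_fun s)^-1%g j) = q j.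
Proof. by rewrite -(branch_eq s) permKV. Qed.

Definition branch_inv s : branch_perm := BranchPerm (branch_eqV s).

Lemma branch_mulA : associative branch_mul.
Proof. by move=> s t u; apply: branch_permP => /=; rewrite mulgA. Qed.

Lemma branch_mul1s : left_id branch_one branch_mul.
Proof. by move=> s; apply: branch_permP => /=; rewrite mulg1. Qed.

Lemma branch_muls1 : right_id branch_one branch_mul.
Proof. by move=> s; apply: branch_permP => /=; rewrite mul1g. Qed.

Lemma branch_mulVs : left_inverse branch_one branch_inv branch_mul.
Proof. by move=> s; apply: branch_permP => /=; rewrite mulgV. Qed.

Lemma branch_mulsV : right_inverse branch_one branch_inv branch_mul.
Proof. by move=> s; apply: branch_permP => /=; rewrite mulVg. Qed.

HB.instance Definition _ := isGroup.Build branch_perm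
  branch_mulA branch_mul1s branch_muls1 branch_mulVs branch_mulsV.

Definition transport k l (e : k = l) (x : T k) : T l :=
  ecast n (T n : Type) e x.

Lemma busemann_transport k l (e : k = l) (x : T k) :
  busemann (transport e x) = busemann x.
Proof. by case: l / e. Qed.

Lemma adj_transport k l (e : k = l) (x y : T k) :
  adj (transport e x) (transport e y) = adj x y.
Proof. by case: l / e. Qed.

Lemma eq_transport k l (e : k = l) (x y : T k) :
  (transport e x == transport e y) = (x == y).
Proof. by case: l / e. Qed.

Lemma transport_trans k l m (e : k = l) (f : l = m) (x : T k) :
  transport f (transport e x) = transport (etrans e f) x.
Proof. by case: m / f; case: l / e. Qed.

Lemma transport_coord (x : dl_vertex) i j (e : q i = q j) :
  i = j -> transport e (x i) = x j.
Proof. by move=> ij; subst j; rewrite (eq_irrelevance e erefl). Qed.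

Lemma branch_act_sum s (x : DL) :
  \sum_j busemann (transport (branch_eqV s j) (x ((branch_fun s)^-1%g j))) = 0.
Proof.
rewrite -[RHS](dl_sum x) [RHS](reindex_inj (@perm_inj _ (branch_fun s)^-1%g)).
by apply: eq_bigr => j _; exact: busemann_transport.
Qed.

Definition branch_act s (x : DL) : DL := DLVertex (branch_act_sum s x).

Lemma branch_actK s : cancel (branch_act s) (branch_act (s^-1)%g).
Proof.
move=> x; apply: dl_vertexP => j /=; rewrite transport_trans.
by apply: transport_coord; exact: (permKV (branch_fun s)^-1%g).
Qed.

Lemma branch_actVK s : cancel (branch_act (s^-1)%g) (branch_act s).
Proof.
move=> x; apply: dl_vertexP => j /=; rewrite transport_trans.
by apply: transport_coord; exact: (permK (branch_fun s)^-1%g).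
Qed.

Lemma branch_act_adj s (x y : DL) :
  adj (branch_act s x) (branch_act s y) = adj x y.
Proof.
suff adjV t (u v : DL) : adj u v -> adj (branch_act t u) (branch_act t v).
  by apply/idP/idP => [/(adjV (s^-1)%g)|/adjV//]; rewrite !branch_actK.
move=> /existsP[i /existsP[j /and4P[ij uvi uvj /forallP uvk]]].
apply/existsP; exists (t i); apply/existsP; exists (t j).
rewrite (inj_eq perm_inj) ij /= !adj_transport !permK uvi uvj /=.
apply/forallP => k; rewrite eq_transport -![k == _](can2_eq (permKV t) (permK t)).
exact: uvk.
Qed.

Definition branch_aut s : graph_aut DL :=
  GraphAut (branch_actK s) (branch_actVK s) (branch_act_adj s).

End DiestelLeader.

(* Main.v *)
Require Import Defs.
From HB Require Import structures.
From mathcomp Require Import all_boot all_order all_algebra.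
From mathcomp Require Import perm finmap zify lra.
From mathcomp Require Import all_classical all_reals all_analysis.

Set Implicit Arguments.
Unset Strict Implicit.
Unset Printing Implicit Defensive.

(* A homogeneous tree with a distinguished end is encoded by its predecessor map,
   and Aff(T_q) consists of the bijections that commute with that map.

   Call two vertices of DL siblings if they differ in one coordinate only, where
   they have the same predecessor. Being siblings is a property of the graph DL,
   so an automorphism f permutes, at every vertex y, the d families of siblings of
   y. This permutation is the same at both ends of an edge, hence constant, which
   gives sigma in S such that sigma^-1 f preserves the pair (coordinate going up,
   coordinate going down) of every edge. For such an f the coordinate f(x)_j
   depends only on x_j: if x_j = z_j, then x and z are joined by a path along which
   the j-th coordinate first descends and then climbs back; so does the j-th
   coordinate of its image, and climbing is deterministic. Hence f is in A.

   On Aut of a connected locally finite graph, counting cosets of stabilizers is a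
   left invariant content on the compact open sets. Caratheodory's extension of it
   is a Haar measure, and every left Haar measure is proportional to it on compact
   open sets. If an edge from x to y goes up in coordinate i and down in coordinate
   j, then the orbits A_x y and A_y x of the stabilizers in A have q_j and q_i
   elements, so q_i mu(A_x) = q_j mu(A_y); as mu(A_x g) = mu(A_(g^-1 x)), this
   determines the modular function.

   For amenability, a limit of the normalized restrictions of mu to an increasing
   sequence of compact open groups is invariant under the kernel of the heights
   A -> Z^d. Averaging it over the powers of an element, once for every coordinate,
   and finally over the finite group S, makes it invariant under the whole group. *)

Import Order.TTheory GRing.Theory Num.Theory.
Import numFieldNormedType.Exports.

Local Open Scope classical_set_scope.
Local Open Scope ring_scope.

(** * Trees with an end *)

Section GraphMetric.
Variables (X : graph) (connX : connected_graph X).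
Implicit Types x y z : X.

Lemma dist_spec x y :
  (exists2 p, walk x y p & size p = dist x y) /\
  (forall p, walk x y p -> (dist x y <= size p)%N).
Proof.
rewrite /dist; case: xgetP => [n -> []//|/(_ _)/= no]; exfalso.
have ex : exists n, `[< exists2 p, walk x y p & size p = n >].
  by have [p xyp] := connX x y; exists (size p); apply/asboolP; exists p.
case: (ex_minnP ex) => n /asboolP xyn min; apply: (no n); split => // p xyp.
by apply: min; apply/asboolP; exists p.
Qed.

Lemma dist_walk x y : exists2 p, walk x y p & size p = dist x y.
Proof. by case: (dist_spec x y). Qed.

Lemma dist_le x y p : walk x y p -> (dist x y <= size p)%N.
Proof. by case: (dist_spec x y) => _; exact. Qed.

Lemma dist_eq0 x y : dist x y = 0%N -> x = y.
Proof.
by have [p [_ xy] <-] := dist_walk x y; move/size0nil => p0; rewrite p0 in xy.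
Qed.

Lemma distxx x : dist x x = 0%N.
Proof. by apply/eqP; rewrite -leqn0; exact: (@dist_le x x [::]). Qed.

Lemma walk_rev x y p : walk x y p ->
  exists2 p', walk y x p' & [/\ size p' = size p & {subset p' <= x :: p}].
Proof.
move=> [xp <-]; exists (rev (belast x p)).
  split; last by case: p xp => //= z p _; rewrite rev_cons last_rcons.
  rewrite rev_path; apply: sub_path xp => u v; by rewrite adj_sym.
split; first by rewrite size_rev size_belast.
by move=> z; rewrite mem_rev => /mem_belast.
Qed.

Lemma walk_cat x y z p p' : walk x y p -> walk y z p' -> walk x z (p ++ p').
Proof. by move=> [xp <-] [yp <-]; split; rewrite ?cat_path ?last_cat ?xp. Qed.

Lemma dist_sym x y : dist x y = dist y x.
Proof.
suff le (u v : X) : (dist u v <= dist v u)%N by apply/eqP; rewrite eqn_leq !le.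
have [p vu <-] := dist_walk v u; have [p' uv [<- _]] := walk_rev vu.
exact: dist_le.
Qed.

Lemma dist_tri x y z : (dist x z <= dist x y + dist y z)%N.
Proof.
have [p xy <-] := dist_walk x y; have [p' yz <-] := dist_walk y z.
by rewrite -size_cat; apply: dist_le; apply: walk_cat xy yz.
Qed.

Lemma adj_dist x y : adj x y -> (dist x y <= 1)%N.
Proof. by move=> xy; apply: (@dist_le x y [:: y]); split; rewrite //= xy. Qed.

Lemma adj_distl x y z : adj x y -> (dist x z <= (dist y z).+1)%N.
Proof.
by move=> /adj_dist xy; apply: leq_trans (dist_tri x y z) _; rewrite -add1n leq_add2r.
Qed.

Lemma dist_step x z : (0 < dist x z)%N ->
  exists2 y, adj x y & dist x z = (dist y z).+1.
Proof.
have [[|y p] [/= xp lp] sp] := dist_walk x z; rewrite -sp // => _.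
case/andP: xp => xy yp; exists y => //; apply/eqP; rewrite eqn_leq.
by rewrite [X in X && _](_ : _ = true) ?sp ?adj_distl // -sp ltnS dist_le.
Qed.

Hypothesis acyX : acyclic_graph X.

(** If the walk avoided [x], its shortening to a simple path, closed up through [x], would be a
    cycle of length at least 3. *)
Lemma walk_through x y y' p :
  adj x y -> adj x y' -> y != y' -> walk y y' p -> x \in y :: p.
Proof.
move=> xy xy' yy' [yp lp]; apply/negPn/negP => xNp.
move: lp; case/shortenP: yp => p' yp' up' sp lp.
have := acyX (c := x :: y :: p'); rewrite /ucycle /= rcons_path xy yp' lp /=.
have -> : x \notin y :: p'.
  apply: contra xNp; rewrite !inE => /orP[->//|/sp ->]; by rewrite orbT.
rewrite adj_sym xy' /= in up' *; move/(_ up').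
by case: p' lp {yp' up' sp} => [|//] /= yy _; rewrite yy eqxx in yy'.
Qed.

(** Geodesics from [y] and [y'] to [z] cannot pass through [x], so going along one and back along
    the other joins [y] to [y'] outside [x], against [walk_through]. *)
Lemma closer_nbr_unique x y y' z : adj x y -> adj x y' ->
  (dist y z <= dist x z)%N -> (dist y' z <= dist x z)%N -> y = y'.
Proof.
move=> xy xy' dy dy'; apply/eqP/negPn/negP => yy'.
have avoid (u : X) : adj x u -> (dist u z <= dist x z)%N ->
    exists2 p, walk u z p & x \notin u :: p.
  move=> xu du; have [p uz sp] := dist_walk u z; exists p => //.
  rewrite inE negb_or; apply/andP; split.
    by apply: contraTneq xu => ->; rewrite adj_irr.
  apply/negP => xp; case/splitPr: xp uz sp => p1 p2 [].
  rewrite cat_path last_cat /= => /andP[_ /andP[_ xp2]] l2 sp.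
  have := @dist_le x z p2 (conj xp2 l2); move: sp; rewrite size_cat /=.
  by lia.
have [p yz xp] := avoid y xy dy; have [p' yz' xp'] := avoid y' xy' dy'.
have [p2 zy' [_ sp2]] := walk_rev yz'.
have := walk_through xy xy' yy' (walk_cat yz zy').
rewrite -cat_cons mem_cat (negPf xp) => /sp2; by rewrite (negPf xp').
Qed.

(** Trees are bipartite: with equal distances, the first vertex after [x] on a geodesic to [z] would
    have to be [y], which is not closer. *)
Lemma adj_dist_neq x y z : adj x y -> dist x z <> dist y z.
Proof.
move=> xy e; have [x0|] := posnP (dist x z).
  have [] : x = z /\ y = z by split; apply: dist_eq0; rewrite -?e.
  by move=> xz yz; move: xy; rewrite xz yz adj_irr.
move=> /dist_step[u xu du].
have uy : u = y by apply: (closer_nbr_unique (z := z) xu xy); rewrite -?e ?du.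
by move: du; rewrite uy e => /n_Sn.
Qed.

End GraphMetric.

(** * Heights and predecessors determined by a geodesic ray *)

Section RayHeight.
Variables (X : graph) (connX : connected_graph X) (acyX : acyclic_graph X).
Variables (r : nat -> X) (geor : geodesic_ray r).
Implicit Types x y z : X.

(** By the triangle inequality, [dist x (r n) - n] is nonincreasing in [n] and bounded below by
    [- dist x (r 0)], hence eventually constant. In [a], the summand [dist x (r 0)] keeps the
    subtraction on natural numbers exact. *)
Lemma ray_height_exists x : exists k : int, exists N : nat,
  forall n : nat, (N <= n)%N -> (dist x (r n))%:Z = n%:Z + k.
Proof.
pose a n := (dist x (r n) + dist x (r 0) - n)%N.
have ge n : (n <= dist x (r n) + dist x (r 0))%N.
  rewrite -{1}(geor 0 n) add0n addnC (dist_sym connX x (r 0)); exact: dist_tri.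
have noninc m n : (a (m + n) <= a m)%N.
  rewrite /a; have := dist_tri connX x (r m) (r (m + n)%N).
  by rewrite geor; have := ge m; have := ge (m + n)%N; lia.
have ex : exists k, `[< exists n, a n = k >] by exists (a 0%N); apply/asboolP; exists 0%N.
case: (ex_minnP ex) => k /asboolP[N aN] min.
exists (k%:Z - (dist x (r 0))%:Z), N => n Nn.
have an : a n = k.
  apply/eqP; rewrite eqn_leq min ?andbT; last by apply/asboolP; exists n.
  by rewrite -aN -(subnKC Nn) noninc.
by move: an (ge n); rewrite /a; lia.
Qed.

(* The height with respect to the end of [r]: the limit of [dist x (r n) - n]. *)
Definition ray_height x : int := xget 0 [set k : int | exists N : nat,
  forall n : nat, (N <= n)%N -> (dist x (r n))%:Z = n%:Z + k].
Local Notation h := ray_height.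

Lemma ray_heightP x :
  exists N : nat, forall n : nat, (N <= n)%N -> (dist x (r n))%:Z = n%:Z + h x.
Proof.
by have [k Hk] := ray_height_exists x; rewrite /h; case: xgetP => [y _|/(_ k)].
Qed.

Lemma ray_height_eq x k N :
  (forall n : nat, (N <= n)%N -> (dist x (r n))%:Z = n%:Z + k) -> h x = k.
Proof.
move=> H; have [M HM] := ray_heightP x.
have := HM (maxn N M) (leq_maxr _ _); rewrite H ?leq_maxl //.
by move/addrI.
Qed.

Lemma ray_height_adj x y : adj x y -> h y = h x - 1 \/ h x = h y - 1.
Proof.
move=> xy; have [M HM] := ray_heightP x; have [N HN] := ray_heightP y.
have Hx := HM (maxn N M) (leq_maxr _ _); have Hy := HN (maxn N M) (leq_maxl _ _).
have := adj_dist_neq connX acyX (z := r (maxn N M)) xy.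
have := adj_distl connX (r (maxn N M)) xy; rewrite adj_sym in xy.
have := adj_distl connX (r (maxn N M)) xy.
move: (dist x _) (dist y _) Hx Hy => *; lia.
Qed.

Lemma ray_height_dist x y : h x - h y <= (dist x y)%:Z.
Proof.
have [M HM] := ray_heightP x; have [N HN] := ray_heightP y.
have Hx := HM (maxn N M) (leq_maxr _ _); have Hy := HN (maxn N M) (leq_maxl _ _).
have := dist_tri connX x y (r (maxn N M)).
move: (dist x (r _)) (dist y (r _)) (dist x y) Hx Hy => *; lia.
Qed.

(** After [r N], each step of the ray adds exactly one to the distance from [x], so a first step
    towards [r N] is also a first step towards every later [r n]. *)
Lemma closer_nbr_height x y N : adj x y ->
  (forall n : nat, (N <= n)%N -> (dist x (r n))%:Z = n%:Z + h x) ->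
  dist x (r N) = (dist y (r N)).+1 ->
  (forall n : nat, (N <= n)%N -> (dist y (r n))%:Z = n%:Z + h y) /\ h y = h x - 1.
Proof.
move=> xy Hx Ny.
have Hy n : (N <= n)%N -> (dist y (r n))%:Z = n%:Z + (h x - 1).
  move=> Nn; have := Hx n Nn; have := Hx N (leqnn _).
  have := dist_tri connX y (r N) (r n); have := geor N (n - N)%N.
  rewrite subnKC // => ->; have := adj_distl connX (r n) xy; lia.
by rewrite (ray_height_eq Hy).
Qed.

Lemma lower_nbr_exists x : exists2 y, adj x y & h y = h x - 1.
Proof.
(* [M] exceeds [|h x|], so that [M + h x], the distance from [x] to [r M], is positive. *)
have [N HN] := ray_heightP x; pose M := (maxn N (`|h x|%N.+1))%N.
have HM n : (M <= n)%N -> (dist x (r n))%:Z = n%:Z + h x.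
  by move=> Mn; apply: HN; apply: leq_trans Mn; exact: leq_maxl.
have : (0 < dist x (r M))%N by have := HM M (leqnn _); rewrite /M; lia.
move=> /(dist_step connX)[y xy dy]; exists y => //.
by have [] := closer_nbr_height xy HM dy.
Qed.

Lemma lower_nbr_unique x y y' :
  adj x y -> adj x y' -> h y = h x - 1 -> h y' = h x - 1 -> y = y'.
Proof.
move=> xy xy' hy hy'.
have [N HN] := ray_heightP x; have [M HM] := ray_heightP y.
have [P HP] := ray_heightP y'; pose Q := (N + M + P)%N.
have /and3P[/HN Hx /HM Hy /HP Hy'] : [&& N <= Q, M <= Q & P <= Q]%N by rewrite /Q; lia.
apply: (closer_nbr_unique connX acyX (z := r Q) xy xy').
  by move: (dist x (r _)) (dist y (r _)) Hx Hy => *; lia.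
by move: (dist x (r _)) (dist y' (r _)) Hx Hy' => *; lia.
Qed.

Definition lower_nbr x : X := xget x [set y | adj x y /\ h y = h x - 1].
Local Notation pre := lower_nbr.

Lemma lower_nbrP x : adj x (pre x) /\ h (pre x) = h x - 1.
Proof.
rewrite /pre; case: xgetP => [y _|no] //.
by have [y xy hy] := lower_nbr_exists x; case: (no y).
Qed.

Lemma lower_nbr_eq x y : adj x y -> h y = h x - 1 -> pre x = y.
Proof. by move=> xy hy; have [xp hp] := lower_nbrP x; exact: lower_nbr_unique hp hy. Qed.

Lemma adj_lower_nbr x y : adj x y = (pre x == y) || (pre y == x).
Proof.
apply/idP/orP => [xy|[/eqP <-|/eqP <-]]; last 2 first.
- by case: (lower_nbrP x).
- by rewrite adj_sym; case: (lower_nbrP y).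
have yx : adj y x by rewrite adj_sym.
by have [hy|hx] := ray_height_adj xy; [left|right]; apply/eqP; apply: lower_nbr_eq.
Qed.

Lemma ray_height_iter n x : h (iter n pre x) = h x - n%:Z.
Proof.
elim: n => [|n IH]; first by rewrite subr0.
by rewrite iterS (lower_nbrP _).2 IH; lia.
Qed.

Lemma iter_lower_nbr_inj m n x : iter m pre x = iter n pre x -> m = n.
Proof. by move/(congr1 h); rewrite !ray_height_iter; lia. Qed.

Lemma dist_iter_lower_nbr n x : dist x (iter n pre x) = n.
Proof.
apply/eqP; rewrite eqn_leq; apply/andP; split; last first.
  by have := ray_height_dist x (iter n pre x); rewrite ray_height_iter; lia.
elim: n => [|n IH]; first by rewrite distxx.
apply: leq_trans (dist_tri connX x (iter n pre x) _) _; rewrite -[leqRHS]addn1 leq_add //.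
by apply: (adj_dist connX); case: (lower_nbrP (iter n pre x)).
Qed.

Lemma lower_nbr_ray n : pre (r n) = r n.+1.
Proof.
have hr m : h (r m) = - m%:Z.
  apply: (@ray_height_eq _ _ m) => k mk.
  by rewrite -{1}(subnKC mk) geor; lia.
apply: lower_nbr_eq; last by rewrite !hr; lia.
have dn : dist (r n) (r n.+1) = 1%N by rewrite -[n.+1]addn1 geor.
have [|y] := @dist_step _ connX (r n) (r n.+1); first by rewrite dn.
by rewrite dn => xy [/esym/(dist_eq0 connX)] <-.
Qed.

Lemma iter_lower_nbr_ray n : iter n pre (r 0) = r n.
Proof. by elim: n => //= n ->; exact: lower_nbr_ray. Qed.

(** A geodesic from [x] to a point far enough on the ray makes only steps to lower neighbours. *)
Lemma reaches_ray x : exists D N, iter D pre x = r N.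
Proof.
have [N HN] := ray_heightP x; exists (dist x (r N)), N.
move: {-2}(dist x (r N)) (erefl (dist x (r N))) => D.
elim: D x HN => [|D IH] x HN Dx; first exact: (dist_eq0 connX).
have [|y xy dy] := @dist_step _ connX x (r N); first by rewrite -Dx.
have [HN' hy] := closer_nbr_height xy HN dy.
rewrite iterSr (lower_nbr_eq xy hy); apply: IH => //.
by move: Dx; rewrite dy => -[].
Qed.

Lemma lower_nbr_merge x y : exists m n, iter m pre x = iter n pre y.
Proof.
have [D [N xN]] := reaches_ray x; have [E [M yM]] := reaches_ray y.
exists (M + D)%N, (N + E)%N.
by rewrite !iterD xN yM -[r N]iter_lower_nbr_ray -[r M]iter_lower_nbr_ray -!iterD addnC.
Qed.

End RayHeight.

(** Everything needed about a tree with an end, expressed by the predecessor map [pre] and a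
    labelling [ch x] of the successors of [x] by ['I_q]; [hc_end] translates fixing the end into
    commuting with [pre]. *)
Record horocyclic (q : nat) (T : ended_graph) (pre : T -> T) (ch : T -> 'I_q -> T) :
    Prop := Horocyclic {
  hc_adj : forall x y, adj x y = (pre x == y) || (pre y == x);
  hc_merge : forall x y, exists m n, iter m pre x = iter n pre y;
  hc_child : forall x i, pre (ch x i) = x;
  hc_child_inj : forall x, injective (ch x);
  hc_child_surj : forall x, exists i, ch (pre x) i = x;
  hc_height : forall x, busemann (pre x) = busemann x - 1;
  hc_end : forall g : graph_aut T, fixes_end g <-> forall x, g (pre x) = pre (g x)
}.

(** * From a homogeneous tree to its predecessor map *)

Section HomogeneousTree.
Variables (q : nat) (T : ended_graph).
Hypotheses (connT : connected_graph T) (acyT : acyclic_graph T).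
Hypothesis degT : forall x : T, ([set y | adj x y] #= `I_q.+1)%card.
Variables (r : nat -> T) (geor : geodesic_ray r).
Hypothesis omegaE : omega T = [set s | geodesic_ray s /\ ray_equiv r s].

Local Notation pre := (lower_nbr r).
Local Notation h := (ray_height r).

(** A ray that once steps away from the end does so forever, since turning back would retrace an
    edge; its heights then exceed all those of [r], and infinitely many of its vertices lie off [r].
    Conversely, every orbit of [pre] merges with [r]. *)
Lemma lower_nbr_orbit_end (s : nat -> T) : omega T s <-> forall n, s n.+1 = pre (s n).
Proof.
have hI := ray_height_iter connT geor.
rewrite omegaE; split => [[geos rs] n|sS].
  have sadj m : pre (s m) = s m.+1 \/ pre (s m.+1) = s m.
    have ds : dist (s m) (s m.+1) = 1%N by rewrite -[m.+1]addn1 geos.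
    have [|y] := @dist_step _ connT (s m) (s m.+1); first by rewrite ds.
    rewrite ds => xy [/esym/(dist_eq0 connT)] ys; move: xy; rewrite ys.
    by rewrite (adj_lower_nbr connT acyT geor) => /orP[]/eqP; [left|right].
  have [//|up] := sadj n; exfalso.
  have {}up m : pre (s (n + m).+1) = s (n + m)%N.
    elim: m => [|m IH]; first by rewrite addn0.
    rewrite addnS; have [down|//] := sadj (n + m).+1.
    by have := geos (n + m)%N 2%N; rewrite addn2 -down IH distxx.
  have hs m : h (s (n + m)%N) = h (s n) + m%:Z.
    elim: m => [|m IH]; first by rewrite addn0 addr0.
    have := hI 1%N (s (n + m).+1); rewrite /= up IH addnS; lia.
  have hr m : h (r m) <= h (r 0%N).
    by rewrite -(iter_lower_nbr_ray connT acyT geor) hI; lia.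
  (* The shift makes the height of every [f m] exceed that of [r 0], the greatest height on [r]. *)
  pose f m := s (n + (m + `|h (r 0%N)| + `|h (s n)|).+1)%N.
  have finj : {in [set: nat] &, injective f}.
    by move=> a b _ _ /(congr1 h); rewrite /f !hs; lia.
  apply: infinite_nat; rewrite -(eq_finite_set (inj_card_eq finj)).
  apply: sub_finite_set rs => _ [m _ <-]; right; split.
    by exists (n + (m + `|h (r 0%N)| + `|h (s n)|).+1)%N.
  by move=> [k _ rk]; have := hr k; rewrite rk /f hs; lia.
have sE n : s n = iter n pre (s 0%N) by elim: n => //= n <-.
split=> [m n|].
  by rewrite (sE (m + n)%N) (sE m) addnC iterD (dist_iter_lower_nbr connT geor).
have [m [n mn]] := lower_nbr_merge connT acyT geor (s 0%N) (r 0%N).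
rewrite (iter_lower_nbr_ray connT acyT geor) -sE in mn.
have tail k : s (m + k)%N = r (n + k)%N.
  elim: k => [|k IH]; first by rewrite !addn0.
  by rewrite !addnS sS IH (lower_nbr_ray connT acyT geor).
apply: (@sub_finite_set _ _ (r @` `I_n `|` s @` `I_m)).
  move=> _ [[[k _ <-] nk]|[[k _ <-] nk]].
    left; exists k => //=; rewrite ltnNge; apply/negP => ?; apply: nk.
    by exists (m + (k - n))%N; rewrite // tail subnKC.
  right; exists k => //=; rewrite ltnNge; apply/negP => ?; apply: nk.
  by exists (n + (k - m))%N; rewrite // -tail subnKC.
by rewrite finite_setU; split; apply: finite_image; exact: finite_II.
Qed.

Lemma ancestor_iter (x y : T) : ancestor x y <-> exists n, x = iter n pre y.
Proof.
split=> [[s [/lower_nbr_orbit_end sS <- sx]]|[n ->]].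
  by case: sx => n _ <-; exists n; elim: n => //= n <-.
exists (fun n => iter n pre y); split=> //.
by apply/lower_nbr_orbit_end.
Qed.

(** Both distances in the Busemann function count predecessor steps to the confluent, so their
    difference is a difference of heights. *)
Lemma busemann_ray_height x : busemann x = h x - h (origin T).
Proof.
have hI := ray_height_iter connT geor.
have mrg := lower_nbr_merge connT acyT geor.
have [m [n [cm cn]]] : exists m n, confluent x (origin T) = iter m pre x /\
    confluent x (origin T) = iter n pre (origin T).
  rewrite /confluent; case: xgetP => [c _ /= [cx co _]|no].
    have [m cm] := (ancestor_iter _ _).1 cx; have [n cn] := (ancestor_iter _ _).1 co.
    by exists m, n.
  exfalso.
  (* The first common ancestor met on the way from [x] is the maximal one. *)
  have ex : exists m, `[< exists n, iter m pre x = iter n pre (origin T) >].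
    by have [m [n mn]] := mrg x (origin T); exists m; apply/asboolP; exists n.
  case: (ex_minnP ex) => m /asboolP[n mn] min; apply: (no (iter m pre x)); split.
  - by apply/ancestor_iter; exists m.
  - by apply/ancestor_iter; exists n.
  move=> c /ancestor_iter[k ->] /ancestor_iter[l kl]; apply/ancestor_iter.
  have mk : (m <= k)%N by apply: min; apply/asboolP; exists l.
  by exists (k - m)%N; rewrite -iterD subnK.
rewrite /busemann {1}cm cn !(dist_iter_lower_nbr connT geor).
by have := hI m x; rewrite -cm cn hI; lia.
Qed.

Lemma fixes_end_lower_nbr (g : graph_aut T) :
  fixes_end g <-> forall x, g (pre x) = pre (g x).
Proof.
split=> [gT x|gpre].
  have : omega T (fun n => iter n pre x) by apply/lower_nbr_orbit_end.
  move=> ox; have : omega T (g \o (fun n => iter n pre x)).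
    by rewrite -gT; exists (fun n => iter n pre x).
  by move/lower_nbr_orbit_end/(_ 0%N).
apply/seteqP; split=> [_ [s /lower_nbr_orbit_end sS <-]|s /lower_nbr_orbit_end sS].
  by apply/lower_nbr_orbit_end => n /=; rewrite sS gpre.
exists (aut_inv g \o s); last by apply: funext => n /=; rewrite aut_invK.
apply/lower_nbr_orbit_end => n /=; apply: (can_inj (aut_funK g)).
by rewrite gpre !aut_invK.
Qed.

Lemma lower_nbr_fibre x : exists f : 'I_q -> T,
  [/\ forall i, pre (f i) = x, injective f & forall y, pre y = x -> exists i, f i = y].
Proof.
have padj := adj_lower_nbr connT acyT geor.
pose A := [set y | adj x y].
have fA : finite_set A by exists q.+1; exact: degT.
have cA : #|` fset_set A| = q.+1 by apply: card_fset_set; exact: degT.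
have pA : pre x \in fset_set A.
  by rewrite in_fset_set // inE /A /= padj eqxx.
pose B := (fset_set A `\ pre x)%fset.
have cB : #|` B| = q by have := cardfsD1 (pre x) (fset_set A); rewrite pA cA => -[].
have BP y : y \in B <-> pre y = x.
  have yA : (y \in A) = adj x y by apply/idP/idP; rewrite inE.
  rewrite in_fsetD1 in_fset_set // yA padj; split.
    by case/andP => yx /orP[/eqP xy|/eqP //]; rewrite -xy eqxx in yx.
  move=> yx; rewrite -yx eqxx orbT andbT; apply/eqP => ypp.
  by have := @iter_lower_nbr_inj _ connT r geor 0 2 y ypp.
exists (fun i => nth x (B : seq T) i); split.
- by move=> i; apply/BP; rewrite mem_nth // cB.
- move=> i j /eqP; rewrite nth_uniq ?cB //.
  by move=> ij; apply/eqP.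
move=> y /BP yB; have iq : (index y B < q)%N by rewrite -cB index_mem.
by exists (Ordinal iq); rewrite /= nth_index.
Qed.

End HomogeneousTree.

Lemma homogeneous_tree_horocyclic q (T : ended_graph) :
  homogeneous_tree q T -> exists pre ch, @horocyclic q T pre ch.
Proof.
move=> [connT acyT degT [r geor omegaE]].
have [ch chP] := boolp.choice (lower_nbr_fibre connT acyT degT geor).
exists (lower_nbr r), ch; split.
- exact: adj_lower_nbr.
- exact: lower_nbr_merge.
- by move=> x i; have [] := chP x.
- by move=> x; have [] := chP x.
- by move=> x; have [_ _] := chP (lower_nbr r x); exact.
- move=> x; rewrite !(busemann_ray_height connT acyT geor omegaE).
  by have [_ ->] := lower_nbrP connT geor x; lia.
exact: fixes_end_lower_nbr.
Qed.

(** * Automorphisms of a tree given by its predecessor map *)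

Section Horocyclic.
Variables (q : nat) (T : ended_graph) (pre : T -> T) (ch : T -> 'I_q -> T).
Hypothesis hc : horocyclic pre ch.
Implicit Types x y z : T.

Lemma busemann_iter n x : busemann (iter n pre x) = busemann x - n%:Z.
Proof.
elim: n => [|n IH]; first by rewrite subr0.
by rewrite iterS (hc_height hc) IH; lia.
Qed.

Lemma pre_neq x : pre x <> x.
Proof. by move/(congr1 (@busemann T)); rewrite (hc_height hc); lia. Qed.

Lemma pre_aut (f f' : T -> T) : cancel f f' -> cancel f' f ->
  (forall x, f (pre x) = pre (f x)) -> exists g : graph_aut T, aut_fun g = f.
Proof.
move=> fK f'K fpre.
have fadj x y : adj (f x) (f y) = adj x y.
  by rewrite !(hc_adj hc) -!fpre !(can_eq fK).
by exists (GraphAut fK f'K fadj).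
Qed.

Lemma pre_aut_height (g : graph_aut T) : (forall x, g (pre x) = pre (g x)) ->
  exists k : int, has_height g k.
Proof.
move=> gpre; exists (busemann (g (origin T)) - busemann (origin T)) => x.
have gi n y : g (iter n pre y) = iter n pre (g y) by elim: n => //= n <-.
have [m [n mn]] := hc_merge hc x (origin T).
have := congr1 (@busemann T) mn; rewrite !busemann_iter.
have := congr1 (@busemann T \o g) mn; rewrite /= !gi !busemann_iter; lia.
Qed.

Section Descend.
Variable c : T -> 'I_q -> T.
Hypothesis prec : forall x i, pre (c x i) = x.
Hypothesis cinj : forall x, injective (c x).
Hypothesis csurj : forall x, exists i, c (pre x) i = x.

Lemma iter_pre_foldl x (s : seq 'I_q) : iter (size s) pre (foldl c x s) = x.
Proof.
by elim/last_ind: s => //= s i IH; rewrite size_rcons foldl_rcons iterSr prec.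
Qed.

Lemma busemann_foldl x (s : seq 'I_q) :
  busemann (foldl c x s) = busemann x + (size s)%:Z.
Proof.
by have := congr1 (@busemann T) (iter_pre_foldl x s); rewrite busemann_iter; lia.
Qed.

Lemma foldl_surj m x : exists2 s, size s = m & foldl c (iter m pre x) s = x.
Proof.
elim: m x => [|m IH] x; first by exists [::].
have [s sm xs] := IH (pre x); have [i xi] := csurj x.
by exists (rcons s i); rewrite ?size_rcons ?sm // foldl_rcons iterSr xs.
Qed.

Lemma foldl_inj x (s t : seq 'I_q) : size s = size t ->
  foldl c x s = foldl c x t -> s = t.
Proof.
elim/last_ind: s t => [|s i IH] t; first by case: t.
case/lastP: t => [|t j]; rewrite !size_rcons // => -[st]; rewrite !foldl_rcons => e.
have e' : foldl c x s = foldl c x t by have := congr1 pre e; rewrite !prec.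
by rewrite (IH _ st e'); congr rcons; apply: (cinj (x := foldl c x s)); rewrite e e'.
Qed.

End Descend.

(** Two labels are swapped at each later vertex of the ray from [x] to the end, so that every vertex
    of this ray becomes the successor labelled [i0] of the next one. *)
Lemma relabel (i0 : 'I_q) x : exists c : T -> 'I_q -> T,
  [/\ forall y i, pre (c y i) = y, forall y, injective (c y),
      forall y, exists i, c (pre y) i = y
    & forall n, c (iter n.+1 pre x) i0 = iter n pre x].
Proof.
have : forall y, exists p : {perm 'I_q}, forall n, y = iter n.+1 pre x ->
    ch y (p i0) = iter n pre x.
  move=> y; have [[n yn]|no] := pselect (exists n, y = iter n.+1 pre x); last first.
    by exists 1%g => n yn; case: no; exists n.
  have [i xi] := hc_child_surj hc (iter n pre x).
  exists (tperm i0 i) => m ym; rewrite tpermL yn iterS xi.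
  have := congr1 (@busemann T) ym; rewrite yn !busemann_iter => mn.
  by congr (iter _ pre x); lia.
move=> /boolp.choice[p pP]; exists (fun y i => ch y (p y i)); split.
- by move=> y i; rewrite (hc_child hc).
- by move=> y i j /(hc_child_inj hc)/perm_inj.
- move=> y; have [i yi] := hc_child_surj hc y.
  by exists ((p (pre y))^-1%g i); rewrite permKV.
by move=> n; apply: pP.
Qed.

(** A vertex has addresses relative to [x]: take [n] predecessor steps from [x], then follow a word
    [s] of labels. Matching equal addresses relative to [x] and to [y] defines [g]. As both rays
    carry the constant label [i0], addresses of a vertex differ only by prefixes of [i0]s, and the
    choice is immaterial. *)
Lemma pre_aut_transitive x y :
  exists g : graph_aut T, (forall z, g (pre z) = pre (g z)) /\ g x = y.
Proof.
have [i0 _] := hc_child_surj hc x.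
have [c [prec cinj csurj cx]] := relabel i0 x.
have [e [pree einj esurj ey]] := relabel i0 y.
pose F (x : T) (c : T -> 'I_q -> T) (y : T) (e : T -> 'I_q -> T) (z w : T) := exists n s,
  z = foldl c (iter n pre x) s /\ w = foldl e (iter n pre y) s.
have Fun (x1 : T) (c1 : T -> 'I_q -> T) (y1 : T) (e1 : T -> 'I_q -> T) :
    (forall y i, pre (c1 y i) = y) ->
    (forall y, injective (c1 y)) ->
    (forall n, c1 (iter n.+1 pre x1) i0 = iter n pre x1) ->
    (forall n, e1 (iter n.+1 pre y1) i0 = iter n pre y1) ->
    forall z w w', F x1 c1 y1 e1 z w -> F x1 c1 y1 e1 z w' -> w = w'.
  move=> p1 i1 cx1 ey1 z w w' [n [s [zs ws]]] [n' [s' [zs' ws']]].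
  wlog nn' : n n' s s' w w' zs zs' ws ws' / (n <= n')%N => [hw|].
    have [nn'|/ltnW nn'] := leqP n n'; first exact: hw zs zs' ws ws' nn'.
    by apply/esym; exact: hw zs' zs ws' ws nn'.
  have fx (x2 : T) c2 : (forall n, c2 (iter n.+1 pre x2) i0 = iter n pre x2) ->
      forall k, iter n pre x2 = foldl c2 (iter (n + k) pre x2) (nseq k i0).
    move=> h; elim=> [|k IH]; first by rewrite addn0.
    by rewrite addnS; rewrite [foldl _ _ _]/= h.
  have e1' := fx _ _ cx1 (n' - n)%N; have e2' := fx _ _ ey1 (n' - n)%N.
  rewrite subnKC // in e1' e2'.
  (* The address with the larger number of steps is the other one preceded by [i0]s. *)
  have ss' : nseq (n' - n) i0 ++ s = s'.
    apply: (foldl_inj p1 i1 (x := iter n' pre x1)).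
      have := congr1 (@busemann T) zs; rewrite zs' !(busemann_foldl p1) !busemann_iter.
      by rewrite size_cat size_nseq; lia.
    by rewrite foldl_cat -e1' -zs zs'.
  by rewrite ws ws' -ss' foldl_cat -e2'.
have Tot (x1 : T) (c1 : T -> 'I_q -> T) (y1 : T) (e1 : T -> 'I_q -> T) :
    (forall y, exists i, c1 (pre y) i = y) ->
    forall z, exists w, F x1 c1 y1 e1 z w.
  move=> s1 z; have [m [n mn]] := hc_merge hc z x1.
  have [s _ zs] := foldl_surj s1 m z.
  by exists (foldl e1 (iter n pre y1) s), n, s; rewrite -mn zs.
have [f fP] := boolp.choice (Tot x c y e csurj).
have [f' f'P] := boolp.choice (Tot y e x c esurj).
have FC (x1 : T) (c1 : T -> 'I_q -> T) (y1 : T) (e1 : T -> 'I_q -> T) (z w : T) :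
    F x1 c1 y1 e1 z w -> F y1 e1 x1 c1 w z.
  by move=> [n [s [zs ws]]]; exists n, s.
have fK : cancel f f'.
  by move=> z; apply: (Fun _ _ _ _ pree einj ey cx _ _ _ (f'P _)); exact/FC/fP.
have f'K : cancel f' f.
  by move=> z; apply: (Fun _ _ _ _ prec cinj cx ey _ _ _ (fP _)); exact/FC/f'P.
have fpre z : f (pre z) = pre (f z).
  apply: (Fun _ _ _ _ prec cinj cx ey _ _ _ (fP _)).
  have [n [s [-> ->]]] := fP z; case/lastP: s => [|s i].
    by exists n.+1, [::].
  by exists n, s; rewrite !foldl_rcons prec pree.
have [g gf] := pre_aut fK f'K fpre; exists g; rewrite gf; split=> //.
apply: (Fun _ _ _ _ prec cinj cx ey _ _ _ (fP _)).
by exists 0%N, [::].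
Qed.

Hypothesis q_gt0 : (0 < q)%N.

Lemma descendant n x : exists y, iter n pre y = x.
Proof.
exists (foldl ch x (nseq n (Ordinal q_gt0))).
have := iter_pre_foldl (hc_child hc) x (nseq n (Ordinal q_gt0)).
by rewrite size_nseq.
Qed.

Lemma busemann_origin : busemann (origin T) = 0.
Proof.
by rewrite /busemann subrr.
Qed.

Lemma busemann_surj (k : int) : exists x : T, busemann x = k.
Proof.
case: k => k.
  have [x xk] := descendant k (origin T); exists x.
  by have := congr1 (@busemann T) xk; rewrite busemann_iter busemann_origin; lia.
by exists (iter k.+1 pre (origin T)); rewrite busemann_iter busemann_origin; lia.
Qed.

End Horocyclic.

(** * Haar measure on the automorphism group of a locally finite graph *)

Section CompactOpen.
Variables (X : graph).
Hypotheses (connX : connected_graph X) (lfX : forall x : X, finite_set [set y | adj x y]).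
Variable o : X.
Local Notation G := (graph_aut X).
Implicit Types (x y : X) (t u : seq X) (g h f : G) (C D : set G).

(* The sets that are [saturated] by some finite [t], i.e. unions of left cosets of
   the pointwise stabilizer of [t], and [bounded] are the compact open ones. *)
Definition saturated t C := forall g h, C g -> map h t = map g t -> C h.

Definition bounded C := finite_set [set g o | g in C].

Definition copen C := (exists t, saturated t C) /\ bounded C.

Lemma map_aut_sub t t' g h : {subset t <= t'} -> map g t' = map h t' -> map g t = map h t.
Proof. by move=> tt' /eq_in_map e; apply/eq_in_map => x /tt'/e. Qed.

Lemma saturated_sub t t' C : {subset t <= t'} -> saturated t C -> saturated t' C.
Proof. by move=> tt' sC g h Cg /(map_aut_sub tt'); exact: sC. Qed.

Lemma saturated_catl t u C : saturated t C -> saturated (t ++ u) C.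
Proof. by apply: saturated_sub => x; rewrite mem_cat => ->. Qed.

Lemma saturated_catr t u C : saturated u C -> saturated (t ++ u) C.
Proof. by apply: saturated_sub => x; rewrite mem_cat orbC => ->. Qed.

Lemma copen0 : copen set0.
Proof. by split; [exists [::] => ? ? []|rewrite /bounded image_set0]. Qed.

Lemma copenU C D : copen C -> copen D -> copen (C `|` D).
Proof.
move=> [[t sC] bC] [[u sD] bD]; split; last first.
  by rewrite /bounded image_setU finite_setU.
exists (t ++ u) => g h [Cg|Dg] e; [left|right].
  exact: (saturated_catl sC) Cg e.
exact: (saturated_catr sD) Dg e.
Qed.

Lemma bounded_sub C D : D `<=` C -> bounded C -> bounded D.
Proof. by move=> DC; apply: sub_finite_set; apply: image_subset. Qed.

Lemma copenD C D : copen C -> copen D -> copen (C `\` D).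
Proof.
move=> [[t sC] bC] [[u sD] bD]; split; last by apply: bounded_sub bC => g [].
exists (t ++ u) => g h [Cg nDg] e; split.
  exact: (saturated_catl sC) Cg e.
by move=> Dh; apply: nDg; apply: (saturated_catr sD) Dh (esym e).
Qed.

Lemma copenI C D : copen C -> copen D -> copen (C `&` D).
Proof. by move=> cC cD; rewrite -setDD; apply: copenD => //; exact: copenD. Qed.

Lemma saturated_lmul t g C : saturated t C -> saturated t [set (g * h)%g | h in C].
Proof.
move=> sC _ h [k Ck <-] e; exists (g^-1 * h)%g; last by rewrite mulgA mulgV mul1g.
apply: sC Ck _; rewrite (map_comp (g^-1)%g h) e -map_comp.
by apply: eq_map => x /=; rewrite aut_funK.
Qed.

Lemma copen_lmul g C : copen C -> copen [set (g * h)%g | h in C].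
Proof.
move=> [[t sC] bC]; split; first by exists t; exact: saturated_lmul.
rewrite /bounded image_comp; apply: (@sub_finite_set _ _ (g @` [set h o | h in C])).
  by move=> _ [h Ch <-]; exists (h o) => //; exists h.
exact: finite_image.
Qed.

Lemma copen_stab_finite C x : bounded C -> finite_set [set g x | g in C].
Proof.
move=> bC; have [p [+ <-]] := connX o x.
elim/last_ind: p => [|p y IH]; first by [].
rewrite rcons_path last_rcons => /andP[op ly].
apply: (@sub_finite_set _ _ (\bigcup_(z in [set g (last o p) | g in C]) [set y | adj z y])).
  by move=> _ [g Cg <-]; exists (g (last o p)); [exists g|rewrite /= aut_adj].
by apply: bigcup_finite => //; exact: IH.
Qed.

Lemma finite_images C t : bounded C -> finite_set [set map g t | g in C].
Proof.
move=> bC; elim: t => [|x t IH].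
  by apply: sub_finite_set (finite_set1 [::]) => _ [g _ <-].
apply: (@sub_finite_set _ _ ((fun p => p.1 :: p.2) @`
    ([set g x | g in C] `*` [set map g t | g in C]))).
  by move=> _ [g Cg <-]; exists (g x, map g t) => //; split; exists g.
by apply: finite_image; apply: finite_setX => //; exact: copen_stab_finite.
Qed.

Lemma copen_rmul g C : copen C -> copen [set (h * g)%g | h in C].
Proof.
move=> [[t sC] bC]; split.
  exists (map (g^-1)%g t) => _ h [k Ck <-] e.
  exists (h * g^-1)%g; last by rewrite -mulgA mulVg mulg1.
  apply: sC Ck _; rewrite (map_comp h (g^-1)%g) e -map_comp.
  by apply: eq_map => x /=; rewrite aut_invK.
rewrite /bounded image_comp; exact: copen_stab_finite.
Qed.

Lemma nbhs_map t g : nbhs g [set h : G | map h t = map g t].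
Proof.
elim: t => [|x t IH]; first by apply: filterS filterT => h.
by apply: filterS (filterI (nbhs_aut_eval g x) IH) => h /= [-> ->].
Qed.

Lemma nbhs_map_base g (U : set G) : nbhs g U ->
  exists t, [set h : G | map h t = map g t] `<=` U.
Proof.
pose F : set_system G := [set U | exists t, [set h : G | map h t = map g t] `<=` U].
have FF : Filter F.
  split.
  - by exists [::].
  - move=> A B [t tA] [u uB]; exists (t ++ u) => h /= e; split.
      by apply: tA => /=; apply: map_aut_sub e => x; rewrite mem_cat => ->.
    by apply: uB => /=; apply: map_aut_sub e => x; rewrite mem_cat orbC => ->.
  - by move=> A B AB [t tA]; exists t; exact: subset_trans AB.
suff Fg : F --> g by move=> /Fg.
by apply: aut_cvg => x; exists [:: x] => h /= [].
Qed.

Lemma saturated_open t C : saturated t C -> open C.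
Proof.
move=> sC; rewrite openE => g Cg; apply: filterS (nbhs_map t g) => h /=.
exact: sC.
Qed.

Lemma copen_open C : copen C -> open C.
Proof. by move=> [[t /saturated_open]]. Qed.

Lemma ultra_finite (I : Type) (J : eqType) (F : set_system I) (v : I -> J) (A : set J) :
  UltraFilter F -> finite_set A -> F [set i | A (v i)] -> exists j, F [set i | v i = j].
Proof.
move=> UF /finite_seqP[s ->]; elim: s => [|j s IH] Fs.
  have [i //] : ([set i | [set` [::]] (v i)] : set I) !=set0 by apply: filter_ex Fs.
have [?|Fj] := in_ultra_setVsetC [set i | v i = j] UF; first by exists j.
apply: IH; apply: filterS (filterI Fs Fj) => i /= [].
by rewrite inE => /orP[/eqP|//].
Qed.

Definition ball_walk n x : set X := [set y | exists2 p, walk x y p & size p = n].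

Lemma ball_walk_finite n x : finite_set (ball_walk n x).
Proof.
elim: n => [|n IH].
  by apply: sub_finite_set (finite_set1 x) => y [[|//] [_ <-]].
apply: (@sub_finite_set _ _ (\bigcup_(z in ball_walk n x) [set y | adj z y])).
  move=> y [p]; case/lastP: p => // p z [+ <-]; rewrite size_rcons last_rcons rcons_path.
  by move=> /andP[xp lz] [sp]; exists (last x p) => //; exists p.
by apply: bigcup_finite.
Qed.

Lemma aut_walk g x y p : walk x y p -> walk (g x) (g y) (map g p).
Proof.
move=> [xp <-]; split; last by rewrite last_map.
by rewrite path_map; apply: sub_path xp => u v; rewrite /= aut_adj.
Qed.

(** Applying [g^-1] to a walk from [g o] to [x] gives a walk of the same length from [o] to
    [g^-1 x], and [g o] takes finitely many values. *)
Lemma bounded_inv C x : bounded C -> finite_set [set (g^-1)%g x | g in C].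
Proof.
move=> bC.
have /boolp.choice[n nP] : forall y, exists n, ball_walk n y x.
  by move=> y; have [p yx] := connX y x; exists (size p), p.
apply: (@sub_finite_set _ _ (\bigcup_(y in [set g o | g in C]) ball_walk (n y) o)).
  move=> _ [g Cg <-]; exists (g o); first by exists g.
  have [p gx sp] := nP (g o); exists (map (g^-1)%g p); last by rewrite size_map.
  by have := aut_walk (g^-1)%g gx; rewrite /= aut_funK.
by apply: bigcup_finite => // y _; exact: ball_walk_finite.
Qed.

(** Along an ultrafilter containing [C], both [g x] and [g^-1 x] are eventually constant for each
    [x]; following the inverses too makes the limit map bijective. *)
Lemma copen_compact C : copen C -> compact C.
Proof.
move=> [[t sC] bC]; rewrite compact_ultra => F UF FC.
have : forall x, exists y, F [set g : G | g x = y].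
  move=> x; apply: (ultra_finite (A := [set g x | g in C])) => //.
    exact: copen_stab_finite.
  by apply: filterS FC => g Cg; exists g.
move=> /boolp.choice[f fP].
have : forall x, exists y, F [set g : G | (g^-1)%g x = y].
  move=> x; apply: (ultra_finite (A := [set (g^-1)%g x | g in C])) => //.
    exact: bounded_inv.
  by apply: filterS FC => g Cg; exists g.
move=> /boolp.choice[f' f'P].
have fK : cancel f f'.
  move=> x; have [g /= [<- <-]] := filter_ex (filterI (fP x) (f'P (f x))).
  by rewrite aut_funK.
have f'K : cancel f' f.
  move=> x; have [g /= [<- <-]] := filter_ex (filterI (f'P x) (fP (f' x))).
  by rewrite aut_invK.
have fadj x y : adj (f x) (f y) = adj x y.
  by have [g /= [<- <-]] := filter_ex (filterI (fP x) (fP y)); rewrite aut_adj.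
pose h := GraphAut fK f'K fadj.
have Fh u : F [set g : G | map g u = map h u].
  elim: u => [|x u IH]; first by apply: filterS filterT.
  by apply: filterS (filterI (fP x) IH) => g /= [-> ->].
exists h; split; last by apply: aut_cvg => x; exact: fP.
have [g [Cg e]] := filter_ex (filterI FC (Fh t)).
by apply: sC Cg (esym e).
Qed.

Lemma aut_hausdorff : hausdorff_space G.
Proof.
move=> f g fg; apply: graph_autP => x.
have [h [/= <- <-]] := fg _ _ (nbhs_aut_eval f x) (nbhs_aut_eval g x).
by [].
Qed.

Definition stab t : set G := [set g | map g t = t].

Lemma copen_agree t g : o \in t -> copen [set h : G | map h t = map g t].
Proof.
move=> ot; split; first by exists t => h k /= <-.
apply: sub_finite_set (finite_set1 (g o)) => _ [h /eq_in_map ht <-].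
exact: ht.
Qed.

Lemma copen_stab t : o \in t -> copen (stab t).
Proof. by move=> /(copen_agree 1%g); rewrite /= map_id. Qed.

Lemma aut_locally_compact : locally_compact_group G.
Proof.
split; first exact: aut_hausdorff.
move=> g _; have cg := copen_agree g (mem_head o [::]).
exists [set h : G | map h [:: o] = map g [:: o]].
  by apply: filterS (nbhs_map [:: o] g) => h hg _.
have := copen_compact cg; split=> //.
by apply: compact_closed => //; exact: aut_hausdorff.
Qed.

Lemma compact_copen (K : set G) : compact K -> exists2 C, copen C & K `<=` C.
Proof.
move=> cK; exists [set g : G | [set h o | h in K] (g o)]; last by move=> g Kg; exists g.
split; first by exists [:: o] => g h [k Kk kg] [hg]; exists k; rewrite ?hg.
apply: (@sub_finite_set _ _ [set h o | h in K]); first by move=> _ [g [h Kh <-] <-]; exists h.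
move: cK; rewrite compact_cover => /(_ _ setT (fun y => [set g : G | g o = y])) [||D _ KD].
- move=> y _; apply: (@saturated_open [:: o]) => g h /= gy [hg].
  by rewrite hg.
- by move=> g _; exists (g o).
apply: (@sub_finite_set _ _ [set` D]); last exact: finite_fset.
by move=> _ [g /KD [y Dy /= gy] <-]; rewrite /= gy.
Qed.

(** * Counting cosets of stabilizers *)

Definition images t C : set (seq X) := [set map g t | g in C].

(** For [C] saturated by [t], this is the number of left cosets of [stab t] in [C]. *)
Definition cnt t C : nat := #|` fset_set (images t C)|.

Lemma stab_coset t C g : saturated t C -> C g ->
  [set h | C h /\ map h t = map g t] = [set (g * h)%g | h in stab t].
Proof.
move=> sC Cg; apply/seteqP; split=> [h [Ch e]|_ [h /= ht <-]].
  exists (g^-1 * h)%g; last by rewrite mulgA mulgV mul1g.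
  rewrite /stab /= (map_comp (g^-1)%g h) e -map_comp -[RHS]map_id.
  by apply: eq_map => x /=; rewrite aut_funK.
have e : map (g * h)%g t = map g t by rewrite (map_comp g h) ht.
by split=> //; exact: sC Cg e.
Qed.

Lemma saturated_images t C (P : pred (seq X)) : saturated t C ->
  saturated t [set h | C h /\ P (map h t)].
Proof. by move=> sC g h [Cg Pg] e; split; [exact: sC Cg e|rewrite e]. Qed.

(** [C] is the disjoint union of [cnt t C] left translates of [stab t]. The values lie in an
    arbitrary [nmodType] because the lemma serves both for real contents and for the counts [cnt]
    themselves. *)
Lemma count_cosets (V : nmodType) (nu : set G -> V) t :
  o \in t -> nu set0 = 0 ->
  (forall C D, saturated t C -> saturated t D -> bounded C -> bounded D ->
    C `&` D = set0 -> nu (C `|` D) = nu C + nu D) ->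
  (forall g C, saturated t C -> bounded C -> nu [set (g * h)%g | h in C] = nu C) ->
  forall C, saturated t C -> bounded C -> nu C = nu (stab t) *+ cnt t C.
Proof.
move=> ot nu0 nuU nuM C sC bC.
have fI := finite_images t bC.
pose s : seq (seq X) := fset_set (images t C).
have us : uniq s by exact: fset_uniq.
have sI v : v \in s -> images t C v by rewrite in_fset_set // inE.
have : nu [set h | C h /\ map h t \in s] = nu (stab t) *+ size s.
  elim: s us sI => [_ _|v s IH /= /andP[vs us] sI].
    rewrite mulr0n -[RHS]nu0; congr nu; apply/seteqP; split=> h //= [].
    by rewrite in_nil.
  have [g Cg gv] := sI v (mem_head _ _).
  have {}sI w : w \in s -> images t C w by move=> ws; apply: sI; rewrite inE ws orbT.
  pose A := [set h | C h /\ map h t = map g t]; pose B := [set h | C h /\ map h t \in s].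
  have -> : [set h | C h /\ map h t \in v :: s] = A `|` B.
    apply/seteqP; split=> h /=.
      by rewrite inE => -[Ch /orP[/eqP e|hs]]; [left; rewrite /A /= gv|right].
    move=> [[Ch e]|[Ch hs]]; split=> //; first by rewrite e gv mem_head.
    by rewrite inE hs orbT.
  have sA : saturated t A by move=> h k [Ch hg] e; split; [exact: sC Ch e|rewrite e].
  have sB : saturated t B := saturated_images (P := fun v => v \in s) sC.
  have bA : bounded A by apply: bounded_sub bC => h [].
  have bB : bounded B by apply: bounded_sub bC => h [].
  have AB : A `&` B = set0.
    by rewrite -subset0 => h [[_ e] [_]]; rewrite e gv (negPf vs).
  rewrite mulrS nuU // /B IH //; congr (_ + _); rewrite /A (stab_coset sC Cg) nuM //.
    by move=> h k ht e; rewrite /stab /= e.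
  exact: (copen_stab ot).2.
move=> <-; congr nu; apply/seteqP; split=> [h Ch|h []//]; split=> //.
by rewrite in_fset_set // inE; exists h.
Qed.

Lemma images0 t : images t set0 = set0.
Proof. exact: image_set0. Qed.

Lemma cnt0 t : cnt t set0 = 0%N.
Proof. by rewrite /cnt images0 fset_set0. Qed.

Lemma cntU t C D : saturated t C -> bounded C -> bounded D ->
  C `&` D = set0 -> cnt t (C `|` D) = (cnt t C + cnt t D)%N.
Proof.
move=> sC bC bD CD; have fC := finite_images t bC; have fD := finite_images t bD.
rewrite /cnt /images image_setU fset_setU // -cardfsUI -[LHS]addn0; congr addn.
rewrite -fset_setI //; apply/esym/eqP; rewrite cardfs_eq0; apply/eqP.
suff -> : images t C `&` images t D = set0 by rewrite fset_set0.
rewrite -subset0 => _ [[g Cg <-] [h Dh e]].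
have : (C `&` D) h by split; [exact: sC Cg e|exact: Dh].
by rewrite CD.
Qed.

Lemma card_fset_set_inj (I J : choiceType) (A : set I) (f : I -> J) :
  finite_set A -> injective f -> #|` fset_set (f @` A)| = #|` fset_set A|.
Proof.
move=> fA fI; apply/fcard_eq => //; first exact: finite_image.
by apply: inj_card_eq => x y _ _ /fI.
Qed.

Lemma cntM t g C : bounded C -> cnt t [set (g * h)%g | h in C] = cnt t C.
Proof.
move=> bC; rewrite /cnt -(@card_fset_set_inj _ _ (images t C) (map g)).
- congr (#|` fset_set _|); rewrite /images !image_comp; apply: eq_imagel => h _ /=.
  by rewrite -map_comp.
- exact: finite_images.
- exact/inj_map/(can_inj (aut_funK g)).
Qed.

(** Multiplicativity of indices, obtained from [count_cosets] for the function [cnt (t ++ u)]. *)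
Lemma cnt_refine t u C : o \in t -> saturated t C -> bounded C ->
  cnt (t ++ u) C = (cnt (t ++ u) (stab t) * cnt t C)%N.
Proof.
move=> ot sC bC; rewrite (@count_cosets _ (cnt (t ++ u) : set G -> nat) t) //.
- by elim: (cnt t C) => [|n IH]; rewrite ?mulr0n ?muln0 // mulrS IH mulnS.
- exact: cnt0.
- by move=> ? ? ? ? ? ? ?; apply: cntU => //; exact: saturated_catl.
- by move=> g D _; exact: cntM.
Qed.

Lemma cnt_catC t u C : bounded C -> cnt (t ++ u) C = cnt (u ++ t) C.
Proof.
move=> bC; rewrite /cnt -(@card_fset_set_inj _ _ (images (t ++ u) C) (rot (size t))).
- congr (#|` fset_set _|); rewrite /images image_comp; apply: eq_imagel => h _ /=.
  by rewrite -map_rot rot_size_cat.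
- exact: finite_images.
- exact: rot_inj.
Qed.

Lemma cnt_gt0 t C g : bounded C -> C g -> (0 < cnt t C)%N.
Proof.
move=> bC Cg; rewrite cardfs_gt0; apply/fset0Pn; exists (map g t).
by rewrite in_fset_set ?inE; [exists g|exact: finite_images].
Qed.

Lemma saturated_stab t : saturated t (stab t).
Proof. by move=> h k ht e; rewrite /stab /= e. Qed.

Lemma stab1 t : stab t 1%g.
Proof. exact: map_id. Qed.

(** For [t] containing [o] and saturating [C], this is the Haar measure of [C], normalized to 1 on
    the stabilizer of [o]. *)
Definition ratio (R : realType) t C : R := (cnt t C)%:R / (cnt t (stab [:: o]))%:R.

Lemma bounded_stab t : o \in t -> bounded (stab t).
Proof. by move=> /copen_stab[]. Qed.

Lemma saturated_stabo t : o \in t -> saturated t (stab [:: o]).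
Proof.
by move=> ot; apply: saturated_sub (saturated_stab (t := [:: o])) => x /[!inE] /eqP->.
Qed.

Lemma ratio_refine (R : realType) t u C : o \in t -> saturated t C -> bounded C ->
  ratio R (t ++ u) C = ratio R t C.
Proof.
move=> ot sC bC; have bo := bounded_stab (mem_head o [::]).
rewrite /ratio (@cnt_refine t u C) // (@cnt_refine t u (stab [:: o])) //;
  last exact: saturated_stabo.
have e0 : (cnt (t ++ u) (stab t))%:R != 0 :> R.
  by rewrite pnatr_eq0 -lt0n; apply: (@cnt_gt0 _ _ 1%g); [exact: bounded_stab|exact: stab1].
by rewrite !natrM -mulf_div divff // mul1r.
Qed.

Lemma ratio_indep (R : realType) t u C : o \in t -> o \in u ->
  saturated t C -> saturated u C -> bounded C -> ratio R t C = ratio R u C.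
Proof.
move=> ot ou st su bC; rewrite -(ratio_refine R u ot st bC) -(ratio_refine R t ou su bC).
by rewrite /ratio !(cnt_catC t u) //; exact/bounded_stab/mem_head.
Qed.

(** Any [t] saturating [C] gives the same value, provided it contains [o], which is therefore put in
    front. *)
Definition haar_ratio (R : realType) C : R :=
  ratio R (o :: xget [::] [set t | saturated t C]) C.

Lemma haar_ratioE (R : realType) t C : o \in t -> saturated t C -> bounded C ->
  haar_ratio R C = ratio R t C.
Proof.
move=> ot st bC; apply: ratio_indep => //; first exact: mem_head.
case: xgetP => [u _ su|/(_ t)//]; apply: saturated_sub su => x xu.
by rewrite inE xu orbT.
Qed.

Lemma copen_sat C : copen C -> exists2 t, o \in t & saturated t C.
Proof.
move=> [[t st] _]; exists (o :: t); first exact: mem_head.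
by apply: saturated_sub st => x xt; rewrite inE xt orbT.
Qed.

Lemma haar_ratioU (R : realType) C D : copen C -> copen D -> C `&` D = set0 ->
  haar_ratio R (C `|` D) = haar_ratio R C + haar_ratio R D.
Proof.
move=> cC cD CD; have [t ot tC] := copen_sat cC; have [u ou uD] := copen_sat cD.
have otu : o \in t ++ u by rewrite mem_cat ot.
have sC := saturated_catl (u := u) tC; have sD := saturated_catr (t := t) uD.
have sCD : saturated (t ++ u) (C `|` D).
  by move=> g h [Cg|Dg] e; [left; exact: sC Cg e|right; exact: sD Dg e].
rewrite !(haar_ratioE R otu) //; [|exact: cD.2|exact: cC.2|exact: (copenU cC cD).2].
by rewrite /ratio (cntU sC cC.2 cD.2 CD) natrD mulrDl.
Qed.

Lemma haar_ratioM (R : realType) g C : copen C ->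
  haar_ratio R [set (g * h)%g | h in C] = haar_ratio R C.
Proof.
move=> cC; have [t ot tC] := copen_sat cC.
rewrite !(haar_ratioE R ot) //; first by rewrite /ratio cntM //; exact: cC.2.
- exact: cC.2.
- exact: saturated_lmul.
- exact: (copen_lmul g cC).2.
Qed.

Lemma haar_ratio_ge0 (R : realType) C : 0 <= haar_ratio R C.
Proof. by rewrite divr_ge0 // ler0n. Qed.

Lemma haar_ratio_gt0 (R : realType) C g : copen C -> C g -> 0 < haar_ratio R C.
Proof.
move=> cC Cg; have [t ot tC] := copen_sat cC; have bo := bounded_stab (mem_head o [::]).
rewrite (haar_ratioE R ot tC cC.2); apply: divr_gt0; rewrite ltr0n.
  by apply: cnt_gt0 Cg; exact: cC.2.
by apply: (@cnt_gt0 _ _ 1%g); [exact: bo|exact: stab1].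
Qed.

Lemma haar_ratio0 (R : realType) : haar_ratio R set0 = 0.
Proof.
rewrite (@haar_ratioE R [:: o] set0) ?mem_head //; last exact: copen0.2.
by rewrite /ratio cnt0 mul0r.
Qed.

End CompactOpen.

(** An alias of the automorphism group, on which the compact open sets are declared as a ring of
    sets, so that a measure on this ring can be extended through its outer measure. *)
Definition aut_ring (X : graph) (o : X) : Type := graph_aut X.

HB.instance Definition _ (X : graph) (o : X) := Pointed.on (aut_ring o).

HB.instance Definition _ (X : graph) (o : X) :=
  @isRingOfSets.Build default_measure_display (aut_ring o) (@copen X o)
    (copen0 o) (@copenU X o) (@copenD X o).

(** * Existence and uniqueness of Haar measure, and the modular function *)

Section HaarMeasure.
Variables (R : realType) (X : graph).
Hypotheses (connX : connected_graph X) (lfX : forall x : X, finite_set [set y | adj x y]).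
Variable o : X.
Local Notation G := (graph_aut X).
Local Notation H := (aut_ring o).

Let m0 (C : set H) : \bar R := (haar_ratio o R C)%:E.

(** Countable subadditivity reduces to finite subadditivity: a compact open set covered by countably
    many open sets is covered by finitely many of them. *)
Lemma haar_content_exists :
  exists m : {measure set H -> \bar R}, forall C, m C = (haar_ratio o R C)%:E.
Proof.
have ge0 C : (0 <= m0 C)%E by rewrite lee_fin haar_ratio_ge0.
have add : measure_function.semi_additive m0.
  apply/additive2P; first by rewrite /m0 haar_ratio0.
  by move=> A B mA mB AB; rewrite /m0 haar_ratioU.
pose c : {content set H -> \bar R} := HB.pack m0 (isContent.Build _ _ _ m0 ge0 add).
have sub : measurable_subset_sigma_subadditive m0.
  move=> A F mF mA AF.
  have cA := copen_compact connX lfX mA.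
  move: cA; rewrite compact_cover => /(_ _ setT F) [|//|D _ AD].
    by move=> i _; exact: (copen_open (mF i)).
  have [n Dn] : exists n, forall i, i \in D -> (i < n)%N.
    exists (\max_(i <- enum_fset D) i).+1 => i iD; rewrite ltnS.
    exact: (@leq_bigmax_seq _ (enum_fset D) xpredT id i iD isT).
  apply: (@le_trans _ _ (\sum_(k < n) c (F k))%E).
    apply: (@content_subadditive _ _ _ c A F n) => // g /AD [i /= iD Fg].
    by rewrite -bigcup_mkord; exists i => //; exact: Dn.
  have -> : (\sum_(k < n) c (F k) = \sum_(0 <= k < n) c (F k))%E by rewrite big_mkord.
  by apply: nneseries_lim_ge => k _ _; exact: ge0.
pose m : {measure set H -> \bar R} :=
  HB.pack (Content.sort c) (Content_SigmaSubAdditive_isMeasure.Build _ _ _ c sub).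
by exists m.
Qed.

Local Notation borelType := (g_sigma_algebraType (@open G)).

Definition ball_seq n : seq X :=
  fset_set (\bigcup_(m in `I_n.+1) ball_walk m o).

Lemma mem_ball_seq n (x : X) :
  x \in ball_seq n <-> exists2 m, (m <= n)%N & ball_walk m o x.
Proof.
rewrite /ball_seq in_fset_set; first by rewrite inE.
by apply: bigcup_finite => [|m _]; [exact: finite_II|exact: ball_walk_finite].
Qed.

Lemma ball_seq_o n : o \in ball_seq n.
Proof. by apply/mem_ball_seq; exists 0%N => //; exists [::]. Qed.

Lemma ball_seq_sub m n : (m <= n)%N -> {subset ball_seq m <= ball_seq n}.
Proof.
move=> mn x /mem_ball_seq[k km xk]; apply/mem_ball_seq.
by exists k => //; exact: leq_trans mn.
Qed.

Lemma ball_seq_exhausts (t : seq X) : exists n, {subset t <= ball_seq n}.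
Proof.
elim: t => [|x t [n tn]]; first by exists 0%N.
have [p xp] := connX o x; exists (maxn n (size p)) => y; rewrite inE => /orP[/eqP->|/tn].
  by apply/mem_ball_seq; exists (size p); [exact: leq_maxr|exists p].
by apply: ball_seq_sub; exact: leq_maxl.
Qed.

(** An exhaustion of an open [U] by compact open sets: the cosets of the stabilizer of the ball of
    radius [n] that lie in [U] and keep [o] in that ball. *)
Definition inner_copen (U : set G) n : set G :=
  [set g | g o \in ball_seq n /\
    [set h : G | map h (ball_seq n) = map g (ball_seq n)] `<=` U].

Lemma copen_inner_copen U n : copen o (inner_copen U n).
Proof.
split.
  exists (ball_seq n) => g h [go gU] e; split; last by rewrite e.
  by have /eq_in_map -> := e; [|exact: ball_seq_o].
by apply: (sub_finite_set _ (finite_seq (ball_seq n))) => _ [g [go _] <-].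
Qed.

Lemma inner_copen_sub U n : inner_copen U n `<=` U.
Proof. by move=> g [_]; apply. Qed.

Lemma inner_copen_nondecreasing U : nondecreasing_seq (inner_copen U).
Proof.
move=> m n mn; apply/subsetPset => g [go gU]; split; first exact: (ball_seq_sub mn).
move=> h /= e; apply: gU => /=; exact: map_aut_sub (ball_seq_sub mn) e.
Qed.

Lemma bigcup_inner_copen (U : set G) : open U -> \bigcup_n inner_copen U n = U.
Proof.
move=> oU; apply/seteqP; split=> [g [n _]|g Ug]; first exact: inner_copen_sub.
have [t tU] := nbhs_map_base (open_nbhs_nbhs (conj oU Ug)).
have [n tn] := ball_seq_exhausts (g o :: t).
exists n => //; split; first by apply: tn; exact: mem_head.
apply: subset_trans tU => h /= e; apply: map_aut_sub e => x xt.
by apply: tn; rewrite inE xt orbT.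
Qed.

Lemma borel_copenE : <<s (@open G) >> = <<s (copen o : set (set G)) >>.
Proof.
apply/seteqP; split; last first.
  by apply: sub_sigma_algebra2 => C; exact: copen_open.
apply: smallest_sub; first exact: smallest_sigma_algebra.
move=> U oU; rewrite -(bigcup_inner_copen oU); apply: sigma_algebra_bigcup => n.
by apply: sub_sigma_algebra; exact: copen_inner_copen.
Qed.

Lemma image_lmulK (g : G) (A : set G) :
  [set (g^-1 * h)%g | h in [set (g * h)%g | h in A]] = A.
Proof.
rewrite image_comp -[RHS]image_id; apply: eq_imagel => h _ /=.
by rewrite mulgA mulVg mul1g.
Qed.

Lemma borel_open (U : set G) : open U -> measurable (U : set borelType).
Proof. exact: sub_sigma_algebra. Qed.

Lemma borel_copen (C : set G) : copen o C -> measurable (C : set borelType).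
Proof. by move=> /copen_open/borel_open. Qed.

(** The measure is the restriction of an outer measure. Monotonicity and left invariance hold for
    arbitrary sets, since they come from the covers in its definition. *)
Lemma aut_haar_exists : exists mu : {measure set borelType -> \bar R},
  [/\ left_haar mu, {homo mu : A B / A `<=` B >-> (A <= B)%E},
    forall g (A : set borelType), mu [set (g * h)%g | h in A] = mu A
  & forall C : set borelType, copen o C -> mu C = (haar_ratio o R C)%:E].
Proof.
have [m mE] := haar_content_exists.
pose M : set borelType -> \bar R := mu_ext m.
have M0 : M set0 = 0%E by exact: mu_ext0.
have Mge0 A : (0 <= M A)%E by exact: mu_ext_ge0.
have Msa : semi_sigma_additive M.
  move=> F mF tF mUF.
  have mc (A : set G) : measurable (A : set borelType) ->
      measurable (A : set (g_sigma_algebraType (@measurable _ H))).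
    by rewrite /measurable /= borel_copenE.
  exact: (@measure_semi_sigma_additive _ _ _ (measure_extension m) F
    (fun i => mc _ (mF i)) tF (mc _ mUF)).
pose mu : {measure set borelType -> \bar R} :=
  HB.pack M (isMeasure.Build _ _ _ M M0 Mge0 Msa).
have muC C : copen o C -> mu C = (haar_ratio o R C)%:E.
  by move=> cC; rewrite /mu /= /M measurable_mu_extE.
have mono : {homo mu : A B / A `<=` B >-> (A <= B)%E}.
  by move=> A B AB; exact: (@le_mu_ext _ H R m A B AB).
have invle g (A : set G) : (mu [set (g * h)%g | h in A] <= mu A)%E.
  apply: le_ereal_inf_tmp => _ [F [mF AF] <-].
  apply: ereal_inf_lbound; exists (fun k => [set (g * h)%g | h in F k]).
    split=> [k|_ [h /AF[k _ Fh] <-]]; first exact: (copen_lmul g (mF k)).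
    by exists k => //; exists h.
  by apply: eq_eseriesr => k _; rewrite !mE haar_ratioM //; exact: mF.
have inv g (A : set G) : mu [set (g * h)%g | h in A] = mu A.
  apply/eqP; rewrite eq_le invle /= -{1}(image_lmulK g A); exact: invle.
exists mu; split=> //; split.
- rewrite gt_eqF //; apply: lt_le_trans (mono (stab [:: o]) setT _) => //.
  rewrite muC; last by apply: copen_stab; exact: mem_head.
  rewrite lte_fin; apply: (haar_ratio_gt0 connX lfX) (stab1 _).
  by apply: copen_stab; exact: mem_head.
- split.
  + move=> K /(compact_copen o)[C cC KC]; apply: le_lt_trans (mono _ _ KC) _.
    by rewrite muC ?ltry.
  (* Outer regularity: a cover by compact open sets has an open union. *)
  + move=> A mA; apply/eqP; rewrite eq_le; apply/andP; split.
      by apply: le_ereal_inf_tmp => _ [U [oU AU] <-]; exact: mono.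
    apply: le_ereal_inf_tmp => _ [F [mF AF] <-].
    apply: (@le_trans _ _ (mu (\bigcup_k F k))).
      apply: ereal_inf_lbound; exists (\bigcup_k F k) => //; split=> //.
      by apply: bigcup_open => k _; exact: copen_open (mF k).
    by apply: ereal_inf_lbound; exists F => //; split.
  (* Inner regularity on open sets, by exhaustion with [inner_copen]. *)
  + move=> U oU; apply/eqP; rewrite eq_le; apply/andP; split; last first.
      by apply: ge_ereal_sup => _ [K [cK KU] <-]; exact: mono.
    have cv : mu \o inner_copen U @ \oo --> mu (\bigcup_n inner_copen U n).
      apply: nondecreasing_cvg_mu.
      * by move=> n; apply: borel_copen; exact: copen_inner_copen.
      * by rewrite bigcup_inner_copen //; exact: borel_open.
      * exact: inner_copen_nondecreasing.
    rewrite bigcup_inner_copen // in cv; move/cvg_lim: cv => <- //.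
    apply: lime_le; first by apply: ereal_nondecreasing_is_cvgn => a b ab; apply: mono;
      exact/subsetPset/inner_copen_nondecreasing.
    apply: nearW => n; apply: ereal_sup_ubound; exists (inner_copen U n) => //.
    by split; [apply: copen_compact (copen_inner_copen U n)|exact: inner_copen_sub].
- by move=> g A _; exact: inv.
Qed.

(** Uniqueness of Haar measure on compact open sets: both sides are multiples of the number of
    cosets of one stabilizer [stab t]. *)
Lemma copen_invariant_proportional (nu : set G -> R) :
  nu set0 = 0 ->
  (forall C D, copen o C -> copen o D -> C `&` D = set0 -> nu (C `|` D) = nu C + nu D) ->
  (forall g C, copen o C -> nu [set (g * h)%g | h in C] = nu C) ->
  forall C, copen o C -> nu C = nu (stab [:: o]) * haar_ratio o R C.
Proof.
move=> nu0 nuU nuM C cC; have [t ot sC] := copen_sat cC.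
have cs D : saturated t D -> bounded o D -> nu D = nu (stab t) *+ cnt t D.
  apply: (count_cosets connX lfX ot nu0).
    by move=> ? ? ? ? ? ? ?; apply: nuU => //; split=> //; exists t.
  by move=> ? ? ? ?; apply: nuM; split=> //; exists t.
have bo := bounded_stab (mem_head o [::]).
rewrite (haar_ratioE connX lfX R ot sC cC.2) /ratio (cs C sC cC.2).
rewrite (cs (stab [:: o])) //; last exact: saturated_stabo.
rewrite -[LHS]mulr_natr -[X in _ = X * _]mulr_natr -mulrA; congr (_ * _).
rewrite mulrCA divff ?mulr1 // pnatr_eq0 -lt0n.
by apply: (@cnt_gt0 _ connX lfX _ _ _ 1%g); [exact: bo|exact: stab1].
Qed.

Lemma image_rmulE (g : G) (C : set G) :
  [set (h * g)%g | h in C] = (fun h => (h * g^-1)%g) @^-1` C.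
Proof.
apply/seteqP; split=> [_ [h Ch <-]|h /= Ch]; first by rewrite /= -mulgA mulgV mulg1.
by exists (h * g^-1)%g; rewrite // -mulgA mulVg mulg1.
Qed.

(** Right translation by [g] commutes with left translations, so it changes the content by a
    constant factor, the value of the modular function at [g]. *)
Lemma haar_ratio_rmul g (C : set G) : copen o C ->
  haar_ratio o R [set (h * g)%g | h in C] =
  haar_ratio o R [set (h * g)%g | h in stab [:: o]] * haar_ratio o R C.
Proof.
move=> cC; apply: (copen_invariant_proportional
  (nu := fun C => haar_ratio o R [set (h * g)%g | h in C])) => //.
- by rewrite image_set0 haar_ratio0.
- move=> A B cA cB AB; rewrite image_setU haar_ratioU //; try exact: copen_rmul.
  by rewrite !image_rmulE -preimage_setI AB preimage_set0.
- move=> k A cA; rewrite -[RHS](haar_ratioM connX lfX R k); last exact: copen_rmul.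
  congr (haar_ratio _ _ _); rewrite !image_comp; apply: eq_imagel => h _ /=.
  by rewrite mulgA.
Qed.

Lemma left_haar_copen (mu : {measure set borelType -> \bar R}) : left_haar mu ->
  exists2 c : R, 0 < c & forall C : set G, copen o C -> mu C = (c * haar_ratio o R C)%:E.
Proof.
move=> [muT [muK _ _] muM].
have fin C : copen o C -> mu C \is a fin_num.
  by move=> cC; rewrite ge0_fin_numE //; apply: muK; exact: copen_compact cC.
have muE C : copen o C -> mu C = (fine (mu (stab [:: o])) * haar_ratio o R C)%:E.
  move=> cC; rewrite -[LHS]fineK ?fin //; congr (_%:E).
  apply: (copen_invariant_proportional (nu := fun C => fine (mu C))) => //.
  - by rewrite measure0.
  - move=> A B cA cB AB; rewrite measureU //; try exact: borel_copen.
    by rewrite fineD // fin.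
  - by move=> g A cA; rewrite muM //; exact: borel_copen cA.
exists (fine (mu (stab [:: o]))) => //.
(* If the factor vanished, so would [mu] on all compact open sets, and on the group, an increasing
   union of countably many of them. *)
rewrite lt0r fine_ge0 // andbT; apply/eqP => c0.
have cv : mu \o inner_copen setT @ \oo --> mu (\bigcup_n inner_copen setT n).
  apply: nondecreasing_cvg_mu.
  - by move=> n; apply: borel_copen; exact: copen_inner_copen.
  - by rewrite bigcup_inner_copen //; exact: openT.
  - exact: inner_copen_nondecreasing.
rewrite bigcup_inner_copen in cv; last exact: openT.
have e : mu \o inner_copen setT = fun=> 0%E.
  by apply: funext => n /=; rewrite muE ?c0 ?mul0r //; exact: copen_inner_copen.
move: cv; rewrite e => /cvg_lim; rewrite lim_cst // => /(_ _) mu0.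
by move: muT; rewrite -mu0 // eqxx.
Qed.

Lemma rmul_open g (U : set G) : open U -> open [set (h * g)%g | h in U].
Proof.
move=> oU; rewrite -(bigcup_inner_copen oU) image_rmulE preimage_bigcup.
apply: bigcup_open => n _; rewrite -image_rmulE; apply: (@copen_open _ o).
apply: copen_rmul => //; exact: copen_inner_copen.
Qed.

Lemma rmul_measurable g (A : set borelType) :
  measurable A -> measurable ([set (h * g)%g | h in A] : set borelType).
Proof.
suff sub : <<s (@open G) >> `<=`
    [set A : set G | measurable ([set (h * g)%g | h in A] : set borelType)].
  exact: sub.
apply: smallest_sub; last by move=> U /(rmul_open g); exact: borel_open.
split => /=.
- by rewrite image_set0.
- move=> B; rewrite image_rmulE => mB; rewrite setTD image_rmulE -preimage_setC.
  exact: measurableC.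
- move=> F mF; rewrite image_rmulE preimage_bigcup; apply: bigcup_measurable => n _.
  by rewrite -image_rmulE.
Qed.

(** Invariance passes from compact open sets to open sets by exhaustion, and to Borel sets by outer
    regularity, which gives one inequality; the other follows by translating back with [g^-1]. *)
Lemma right_invariant_copen (mu : {measure set borelType -> \bar R}) : left_haar mu ->
  (forall g C, copen o C -> haar_ratio o R [set (h * g)%g | h in C] = haar_ratio o R C) ->
  right_invariant mu.
Proof.
move=> hmu inv; have [c _ muE] := left_haar_copen hmu.
have muU g (U : set G) : open U -> mu [set (h * g)%g | h in U] = mu U.
  move=> oU.
  have cv : mu \o inner_copen U @ \oo --> mu U.
    rewrite -[X in _ --> mu X](bigcup_inner_copen oU); apply: nondecreasing_cvg_mu.
    - by move=> n; apply: borel_copen; exact: copen_inner_copen.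
    - by rewrite bigcup_inner_copen //; exact: borel_open.
    - exact: inner_copen_nondecreasing.
  pose F n : set borelType := [set (h * g)%g | h in inner_copen U n].
  have FU : \bigcup_n F n = [set (h * g)%g | h in U].
    rewrite -[in RHS](bigcup_inner_copen oU) [RHS]image_rmulE preimage_bigcup.
    by apply: eq_bigcupr => n _; rewrite -image_rmulE.
  have cF n : copen o (F n) by apply: copen_rmul => //; exact: copen_inner_copen.
  have cv' : mu \o F @ \oo --> mu [set (h * g)%g | h in U].
    rewrite -FU; apply: nondecreasing_cvg_mu.
    - by move=> n; exact: borel_copen.
    - by apply: bigcup_measurable => n _; exact: borel_copen.
    - move=> m n mn; apply/subsetPset; apply: image_subset.
      exact/subsetPset/inner_copen_nondecreasing.
  have e : mu \o F = mu \o inner_copen U.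
    apply: funext => n /=; rewrite (muE _ (cF n)) (muE _ (copen_inner_copen U n)).
    by rewrite /F inv //; exact: copen_inner_copen.
  rewrite e in cv'; exact: (cvg_unique _ cv' cv).
have [_ [_ out _] _] := hmu.
have le g (A : set borelType) : measurable A ->
    (mu [set (h * g)%g | h in A] <= mu A)%E.
  move=> mA; rewrite (out A mA); apply: le_ereal_inf_tmp => _ [U [oU AU] <-].
  rewrite -(muU g U oU); apply: le_measure; rewrite ?inE.
  - exact: rmul_measurable.
  - by apply: borel_open; exact: rmul_open.
  - exact: image_subset.
move=> g A mA; apply/eqP; rewrite eq_le le //=.
have {1}-> : A = [set (h * g^-1)%g | h in [set (h * g)%g | h in A]].
  rewrite image_comp -[LHS]image_id; apply: eq_imagel => h _ /=.
  by rewrite -mulgA mulgV mulg1.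
by apply: le; exact: rmul_measurable.
Qed.

Lemma unimodularP : unimodular R G <->
  (forall g C, copen o C -> haar_ratio o R [set (h * g)%g | h in C] = haar_ratio o R C).
Proof.
have [mu [hmu _ _ muE]] := aut_haar_exists.
split=> [[_ /(_ _ hmu) ri] g C cC|inv].
  apply: EFin_inj; rewrite -!muE //; last exact: copen_rmul.
  by apply: ri; exact: borel_copen cC.
split=> [|nu hnu]; first by exists mu.
exact: right_invariant_copen.
Qed.

End HaarMeasure.

(** * Invariant means *)

Lemma fmap_ultra (I J : Type) (F : set_system I) (f : I -> J) :
  UltraFilter F -> UltraFilter (f @ F).
Proof.
move=> UF; split; first exact: fmap_proper_filter.
move=> G PG FG; apply/seteqP; split; last exact: FG.
move=> A GA; have [//|nA] := in_ultra_setVsetC (f @^-1` A) UF.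
have GnA : G (~` A) by apply: FG.
have : G (A `&` ~` A) by exact: filterI.
rewrite setICr => G0.
by have [] := filter_ex G0.
Qed.

Section Means.
Variables (R : realType) (G : topologicalGroupType).
Local Notation borelType := (g_sigma_algebraType (@open G)).
Variable null : set borelType -> Prop.
Local Notation "g <*> A" := [set (g * h)%g | h in A] (at level 40).
Hypothesis nullM : forall (g : G) (A : set borelType), null A -> null (g <*> A).

(** The values are real and bounded on all sets, so that limits along ultrafilters exist for every
    set; additivity is required of Borel sets only. *)
Record is_mean (p : set borelType -> R) : Prop := IsMean {
  mean_ge0 : forall A, 0 <= p A;
  mean_le1 : forall A, p A <= 1;
  meanT : p setT = 1;
  meanU : forall A B, measurable A -> measurable B -> A `&` B = set0 ->
    p (A `|` B) = p A + p B;
  mean_null : forall A, measurable A -> null A -> p A = 0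
}.

Definition mean_inv (p : set borelType -> R) (g : G) : Prop :=
  forall A : set borelType, measurable A -> p (g <*> A) = p A.

Lemma lmul_preimage (g : G) (A : set G) : g <*> A = (fun x => (g^-1 * x)%g) @^-1` A.
Proof.
apply/seteqP; split=> [_ [h Ah <-]|h /= Ah]; first by rewrite /= mulgA mulVg mul1g.
by exists (g^-1 * h)%g; rewrite // mulgA mulgV mul1g.
Qed.

Lemma lmulA (g k : G) (A : set G) : g <*> (k <*> A) = (g * k)%g <*> A.
Proof. by rewrite image_comp; apply: eq_imagel => h _ /=; rewrite mulgA. Qed.

Lemma lmul1 (A : set G) : 1%g <*> A = A.
Proof. by rewrite -[RHS]image_id; apply: eq_imagel => h _ /=; rewrite mul1g. Qed.

Lemma lmul_measurable (g : G) (A : set borelType) :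
  measurable A -> measurable (g <*> A : set borelType).
Proof.
suff sub : <<s (@open G) >> `<=`
    [set A : set G | measurable (g <*> A : set borelType)] by exact: sub.
apply: smallest_sub; last first.
  move=> U oU; apply: sub_sigma_algebra; rewrite lmul_preimage.
  apply: open_comp => // x _.
  apply: (@continuous_comp _ _ _ (fun x : G => ((g^-1)%g, x))
    (fun x : G * G => (x.1 * x.2)%g)).
    by apply: cvg_pair; [exact: cvg_cst|exact: cvg_id].
  exact: mulg_continuous.
split => /=.
- by rewrite image_set0.
- move=> B; rewrite lmul_preimage => mB; rewrite setTD lmul_preimage -preimage_setC.
  exact: measurableC.
- move=> F mF; rewrite lmul_preimage preimage_bigcup; apply: bigcup_measurable => n _.
  by rewrite -lmul_preimage.
Qed.

Lemma lmulT (g : G) : g <*> setT = setT.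
Proof. by rewrite lmul_preimage preimage_setT. Qed.

Lemma lmulI0 (g : G) (A B : set G) : A `&` B = set0 -> (g <*> A) `&` (g <*> B) = set0.
Proof.
move=> AB; rewrite (lmul_preimage g A) (lmul_preimage g B) -preimage_setI AB.
exact: preimage_set0.
Qed.

Lemma mean_invM p g k : mean_inv p g -> mean_inv p k -> mean_inv p (g * k)%g.
Proof.
by move=> pg pk A mA; rewrite -lmulA pg ?pk //; exact: lmul_measurable.
Qed.

Lemma mean_invV p g : mean_inv p g -> mean_inv p (g^-1)%g.
Proof.
move=> pg A mA; rewrite -(pg (g^-1 <*> A)%g) ?lmulA ?mulgV ?lmul1 //.
exact: lmul_measurable.
Qed.

Lemma mean_lmul p g : is_mean p -> is_mean (fun A => p (g <*> A)).
Proof.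
move=> mp; split.
- by move=> A; exact: mean_ge0 mp _.
- by move=> A; exact: mean_le1 mp _.
- by rewrite lmulT; exact: meanT mp.
- move=> A B mA mB AB; rewrite image_setU; apply: meanU mp _ _ _ _ _.
  + exact: lmul_measurable.
  + exact: lmul_measurable.
  + exact: lmulI0.
- move=> A mA nA; apply: mean_null mp _ _ _; first exact: lmul_measurable.
  exact: nullM.
Qed.

Lemma mean_avg (I : finType) (i0 : I) (p : I -> set borelType -> R) :
  (forall i, is_mean (p i)) -> is_mean (fun A => (\sum_i p i A) / #|I|%:R).
Proof.
move=> mp; have I0 : 0 < #|I|%:R :> R by rewrite ltr0n; apply/card_gt0P; exists i0.
have sum1 : \sum_(i : I) (1 : R) = #|I|%:R by rewrite sumr_const.
split.
- move=> A; apply: divr_ge0; last exact: ltW.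
  by apply: sumr_ge0 => i _; exact: mean_ge0.
- move=> A; rewrite ler_pdivrMr // mul1r -sum1; apply: ler_sum => i _.
  exact: mean_le1.
- rewrite (eq_bigr (fun=> 1)) ?sum1 ?divff ?gt_eqF // => i _; exact: meanT.
- move=> A B mA mB AB; rewrite -mulrDl -big_split /=; congr (_ / _).
  by apply: eq_bigr => i _; exact: meanU.
- move=> A mA nA; rewrite big1 ?mul0r // => i _; exact: mean_null.
Qed.

(** The limit along an ultrafilter finer than [\oo] exists for each set by compactness of the unit
    interval, and agrees with every ordinary limit. *)
Lemma mean_limit (p : nat -> set borelType -> R) : (forall n, is_mean (p n)) ->
  exists2 l, is_mean l & forall A B : set borelType,
    (fun n => p n A - p n B) @ \oo --> 0 -> l A = l B.
Proof.
move=> mp; have [U [UF ooU]] := ultraFilterLemma (eventually_filter : ProperFilter \oo).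
have cv A : exists l : R, [/\ 0 <= l, l <= 1 & (fun n => p n A) @ U --> l].
  have := @segment_compact R 0 1; rewrite compact_ultra.
  move=> /(_ _ (fmap_ultra (fun n => p n A) UF))[|l []].
    change (U [set n | `[0, 1]%classic (p n A)]).
    apply: filterS filterT => n _ /=; rewrite in_itv /=.
    by rewrite (mean_ge0 (mp n)) (mean_le1 (mp n)).
  by rewrite /= in_itv /= => /andP[l0 l1] pl; exists l.
have [l lP] := boolp.choice cv.
have uniq A (a : R) : (fun n => p n A) @ U --> a -> l A = a.
  by have [_ _ pl] := lP A; move=> pa; exact: (cvg_unique _ pl pa).
exists l; first split.
- by move=> A; have [] := lP A.
- by move=> A; have [] := lP A.
- apply: uniq; rewrite (_ : (fun n => p n setT) = cst 1); first exact: cvg_cst.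
  by apply: funext => n; exact: meanT.
- move=> A B mA mB AB; apply: uniq.
  rewrite (_ : (fun n => p n (A `|` B)) = (fun n => p n A) \+ (fun n => p n B)).
    by apply: cvgD; [have [] := lP A|have [] := lP B].
  by apply: funext => n; exact: meanU.
- move=> A mA nA; apply: uniq; rewrite (_ : (fun n => p n A) = cst 0); first exact: cvg_cst.
  by apply: funext => n; exact: mean_null.
move=> A B pAB; apply: uniq.
have pAB' : (fun n => p n A - p n B) @ U --> 0.
  by apply: cvg_trans pAB => S /= oS; exact: ooU.
have -> : (fun n => p n A) = (fun n => p n A - p n B) \+ (fun n => p n B).
  by apply: funext => n /=; rewrite subrK.
by rewrite -[X in _ --> X]add0r; apply: cvgD => //; have [] := lP B.
Qed.

(** A limit of the averages over [1, t, ..., t^n] is [t]-invariant, because the sums telescope to a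
    difference of size at most [1 / (n + 1)]; invariance under [N] survives since [t] conjugates [N]
    into itself. *)
Lemma mean_step p (N : set G) (t : G) : is_mean p -> (forall g, N g -> mean_inv p g) ->
  (forall g, N g -> N (t * g * t^-1)%g) ->
  exists2 p', is_mean p' & mean_inv p' t /\ forall g, N g -> mean_inv p' g.
Proof.
move=> mp pN tN.
pose a n A := (\sum_(k < n.+1) p ((t ^+ k)%g <*> A)) / #|'I_n.+1|%:R.
have ma n : is_mean (a n) by apply: (mean_avg ord0) => k; exact: mean_lmul.
have [l ml lP] := mean_limit ma; exists l => //; split.
  move=> A mA; apply: lP.
  have -> : (fun n => a n (t <*> A) - a n A) =
      (fun n => (p ((t ^+ n.+1)%g <*> A) - p A) * n.+1%:R^-1).
    apply: funext => n; rewrite /a -mulrBl card_ord; congr (_ * _).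
    rewrite -sumrB -(big_mkord xpredT
      (fun k => p ((t ^+ k)%g <*> (t <*> A)) - p ((t ^+ k)%g <*> A))).
    under eq_bigr do rewrite lmulA -expgSr.
    by rewrite (telescope_sumr (fun k => p ((t ^+ k)%g <*> A))) // expg0 lmul1.
  apply: (@squeeze_cvgr _ _ _ _ (fun n => - n.+1%:R^-1) (fun n => n.+1%:R^-1)).
  - apply: nearW => n; rewrite -mulN1r -[X in _ && (_ <= X)]mul1r !ler_pM2r ?invr_gt0 ?ltr0n //.
    have ge0 := mean_ge0 mp; have le1 := mean_le1 mp.
    move: (ge0 A) (le1 A) (ge0 ((t ^+ n.+1)%g <*> A)) (le1 ((t ^+ n.+1)%g <*> A)).
    by move=> *; apply/andP; split; lra.
  - rewrite -oppr0; apply: cvgN; exact: cvg_harmonic.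
  - exact: cvg_harmonic.
move=> g Ng A mA; apply: lP.
rewrite (_ : (fun n => a n (g <*> A) - a n A) = cst 0); first exact: cvg_cst.
apply: funext => n /=; apply/eqP; rewrite subr_eq0; apply/eqP; congr (_ / _).
(* [t^k g A] is the translate of [t^k A] by a conjugate of [g], which lies in [N]. *)
apply: eq_bigr => k _; have Nk : N ((t ^+ k) * g * (t ^+ k)^-1)%g.
  elim: (k : nat) => [|m IH]; first by rewrite expg0 mul1g invg1 mulg1.
  by have := tN _ IH; rewrite expgS invgM !mulgA.
rewrite -(pN _ Nk ((t ^+ k)%g <*> A)); last exact: lmul_measurable.
by rewrite !lmulA -!mulgA mulVg mulg1.
Qed.

(** Modulo [N] on the left, right multiplication by [g] sends [s i] to [s (f i)], so translating by
    [g] only permutes the summands of the average. *)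
Lemma mean_finite p (N : set G) (I : finType) (i0 : I) (s : I -> G) :
  is_mean p -> (forall g, N g -> mean_inv p g) ->
  (forall g, exists2 f : I -> I, injective f & forall i, N (s i * g * (s (f i))^-1)%g) ->
  exists2 p', is_mean p' & forall g, mean_inv p' g.
Proof.
move=> mp pN sN; exists (fun A => (\sum_i p (s i <*> A)) / #|I|%:R).
  by apply: (mean_avg i0) => i; exact: mean_lmul.
move=> g A mA /=; congr (_ / _); have [f fI fP] := sN g.
rewrite [RHS](reindex_inj fI); apply: eq_bigr => i _.
rewrite -(pN _ (fP i) (s (f i) <*> A)); last exact: lmul_measurable.
by rewrite !lmulA -!mulgA mulVg mulg1.
Qed.

End Means.

(** * Diestel-Leader graphs *)

Lemma sum_eq_off2 (d : nat) (f g : 'I_d -> int) (i j : 'I_d) : i != j ->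
  (forall k, k != i -> k != j -> f k = g k) ->
  \sum_k f k - \sum_k g k = (f i - g i) + (f j - g j).
Proof.
move=> ij fg.
rewrite -sumrB (bigD1 i) //= (bigD1 j) ?(eq_sym j) //= big1 ?addr0 // => k /andP[ki kj].
by rewrite fg // subrr.
Qed.

Section DLSteps.
Variables (d : nat) (q : 'I_d -> nat) (T : nat -> ended_graph).
Variables (pre : forall n, T n -> T n) (ch : forall n, T n -> 'I_n -> T n).
Hypothesis hc : forall j, horocyclic (@pre (q j)) (@ch (q j)).
Hypotheses (d_ge2 : (2 <= d)%N) (q_ge2 : forall j, (2 <= q j)%N).
Local Notation X := (DL q T).
Implicit Types (x y z u v w : X) (i j k : 'I_d).

(** The pair [(i, j)] will be called the type of the edge, traversed from [x] to [y]. *)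
Definition step i j x y : Prop :=
  [/\ i != j, y i = pre (x i), pre (y j) = x j
    & forall k, k != i -> k != j -> x k = y k].

Lemma step_at i j x y : step i j x y -> forall k,
  [\/ k = i /\ y k = pre (x k), k = j /\ pre (y k) = x k
    | [/\ k <> i, k <> j & x k = y k]].
Proof.
move=> [ij yi yj yk] k; have [->|ki] := eqVneq k i; first by constructor 1.
have [->|kj] := eqVneq k j; first by constructor 2.
by constructor 3; split; [exact/eqP|exact/eqP|exact: yk].
Qed.

Lemma step_neq i j x y : step i j x y -> i <> j.
Proof. by case=> /eqP. Qed.

Lemma step_sym i j x y : step i j x y -> step j i y x.
Proof.
move=> [ij yi yj yk]; split=> //; first by rewrite eq_sym.
by move=> k kj ki; rewrite yk.
Qed.

Lemma preN k (a : T (q k)) : pre a <> a.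
Proof. exact: (pre_neq (hc k)). Qed.

Lemma other_index j : exists k : 'I_d, k != j.
Proof.
pose a := Ordinal (ltnW d_ge2); pose b := Ordinal d_ge2.
have [ja|ja] := eqVneq j a; last by exists a; rewrite eq_sym.
by exists b; rewrite ja.
Qed.

Lemma step_make i j x (f : forall k, T (q k)) : i != j ->
  f i = pre (x i) -> pre (f j) = x j ->
  (forall k, k != i -> k != j -> x k = f k) ->
  exists2 y : X, step i j x y & forall k, y k = f k.
Proof.
move=> ij fi fj fk.
have f0 : \sum_k busemann (f k) = 0.
  rewrite -[RHS](dl_sum x); apply/eqP; rewrite -subr_eq0; apply/eqP.
  rewrite (sum_eq_off2 ij) => [|k ki kj]; last by rewrite fk.
  have := hc_height (hc j) (f j); have := hc_height (hc i) (x i); rewrite -fi fj; lia.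
by exists (DLVertex f0).
Qed.

Lemma step_exists i j x (c : T (q j)) : i != j -> pre c = x j ->
  exists2 y : X, step i j x y & y j = c.
Proof.
move=> ij cj; pose f := dfwith (dfwith (dl_coord x) i (pre (x i))) j c.
have fj : f j = c by rewrite /f dfwithin.
have fi : f i = pre (x i) by rewrite /f dfwithout 1?eq_sym // dfwithin.
have pfj : pre (f j) = x j by rewrite fj.
have fk k : k != i -> k != j -> x k = f k.
  by move=> ki kj; rewrite /f !dfwithout // eq_sym.
by have [y xy yf] := step_make ij fi pfj fk; exists y; rewrite // yf.
Qed.

Lemma child_exists j (a : T (q j)) : exists b, pre b = a.
Proof.
by exists (ch a (Ordinal (ltnW (q_ge2 j)))); rewrite (hc_child (hc j)).
Qed.

Lemma children2 j (a : T (q j)) : exists b c, [/\ pre b = a, pre c = a & b <> c].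
Proof.
exists (ch a (Ordinal (ltnW (q_ge2 j)))), (ch a (Ordinal (q_ge2 j))).
by rewrite !(hc_child (hc j)); split=> // /(hc_child_inj (hc j)).
Qed.

(** The heights sum to zero at both ends, so the two moving coordinates cannot both move to
    predecessors or both to successors. *)
Lemma adjP x y : adj x y <-> exists i j, step i j x y.
Proof.
split=> [/existsP[i /existsP[j /and4P[ij xyi xyj /forallP xyk]]]|]; last first.
  move=> [i [j [ij yi yj yk]]]; apply/existsP; exists i; apply/existsP; exists j.
  rewrite ij !(hc_adj (hc _)) yi yj !eqxx orbT /=; apply/forallP => k.
  by apply/implyP => /andP[ki kj]; rewrite yk.
have xyk' k : k != i -> k != j -> x k = y k.
  by move=> ki kj; apply/eqP; have := xyk k; rewrite ki kj.
have := sum_eq_off2 (f := fun k => busemann (x k)) (g := fun k => busemann (y k)) ij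
  (fun k ki kj => congr1 (@busemann _) (xyk' k ki kj)).
rewrite !dl_sum.
have := hc_height (hc i) (x i); have := hc_height (hc i) (y i).
have := hc_height (hc j) (x j); have := hc_height (hc j) (y j).
move: xyi xyj; rewrite !(hc_adj (hc _)) => /orP[]/eqP ei /orP[]/eqP ej; rewrite ei ej.
- lia.
- by exists i, j.
- by exists j, i; split=> //; rewrite ?(eq_sym j) // => k kj ki; exact: xyk'.
- lia.
Qed.

Lemma step_adj i j x y : step i j x y -> adj x y.
Proof. by move=> xy; apply/adjP; exists i, j. Qed.

Lemma step_height i j x y : step i j x y -> forall k,
  busemann (y k) - busemann (x k) = (k == j)%:Z - (k == i)%:Z.
Proof.
move=> xy k; have /eqP := step_neq xy => ij.
have [[-> e]|[-> e]|[/eqP/negPf-> /eqP/negPf-> ->]] := step_at xy k.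
- by rewrite e (hc_height (hc i)) eqxx (negPf ij); lia.
- by rewrite -e (hc_height (hc j)) eqxx eq_sym (negPf ij); lia.
- by rewrite !subrr.
Qed.

(** The type can be read off from the changes of height. *)
Lemma step_uniq i j i' j' x y : step i j x y -> step i' j' x y -> i = i' /\ j = j'.
Proof.
move=> s s'; have ij := step_neq s; have ij' := step_neq s'.
have H k : (k == j)%:Z - (k == i)%:Z = (k == j')%:Z - (k == i')%:Z.
  by rewrite -(step_height s) -(step_height s').
split; apply/eqP.
  have := H i; rewrite eqxx; have [//|_] := eqVneq i i'.
  by case: (eqVneq i j) => // _; case: (i == j').
have := H j; rewrite eqxx; have [//|_] := eqVneq j j'.
by case: (eqVneq j i) => [/esym//|_]; case: (j == i').
Qed.

(** * Siblings and their characterization by the graph *)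

Definition sib j y z : Prop :=
  [/\ y j <> z j, pre (y j) = pre (z j) & forall k, k <> j -> y k = z k].

Lemma sib_make j y (a : T (q j)) : y j <> a -> pre a = pre (y j) ->
  exists2 z : X, sib j y z & z j = a.
Proof.
move=> ya pa; pose f := dfwith (dl_coord y) j a.
have fj : f j = a by rewrite /f dfwithin.
have fk k : k != j -> f k = y k by move=> kj; rewrite /f dfwithout // eq_sym.
have f0 : \sum_k busemann (f k) = 0.
  rewrite -[RHS](dl_sum y); apply: eq_bigr => k _.
  have [->|/fk->//] := eqVneq k j; rewrite fj.
  have := hc_height (hc j) a; rewrite pa (hc_height (hc j)); lia.
exists (DLVertex f0) => //; split=> /=; rewrite ?fj // => k /eqP/fk.
by move=> ->.
Qed.

Lemma sib_exists j y : exists z, sib j y z.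
Proof.
have [b [c [pb pc bc]]] := children2 (pre (y j)).
have [yb|yb] := pselect (y j = b).
  by have [|z yz _] := @sib_make j y c _ pc; [rewrite yb|exists z].
by have [z yz _] := sib_make yb pb; exists z.
Qed.

Lemma sib_trans j y z w : sib j y z -> sib j y w -> z = w \/ sib j z w.
Proof.
move=> [yz pyz k] [yw pyw l]; have [zw|zw] := pselect (z j = w j).
  left; apply: dl_vertexP => m; have [->//|/eqP mj] := eqVneq m j.
  by rewrite -k // l.
right; split=> //; first by rewrite -pyz.
by move=> m mj; rewrite -k // l.
Qed.

(* A graph-theoretic description of the pairs of siblings. Two vertices with a
   common neighbour that are not siblings have 1, 2 or 4 common neighbours; in
   the last case, which needs four distinct coordinates, the common neighbours
   form a 4-cycle, whence the clause on triangles. *)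
Definition sibling_graph (Y : graph) (y z : Y) : Prop :=
  [/\ y <> z, ~ adj y z & exists u v : Y,
    [/\ adj u y, adj u z, adj v y & adj v z] /\
    [/\ u <> v, ~ adj u v & (4 <= d)%N -> exists a b : Y,
      [/\ adj a y, adj a z, adj b y & adj b z] /\
      [/\ adj a u, adj b u & adj a b]]].

(** Replaces every [step] hypothesis by its three possibilities at coordinate [k]. *)
Local Ltac cases_at k :=
  repeat match goal with
  | H : step _ _ _ _ |- _ =>
     let H' := fresh "at" in have H' := step_at H k; move: H => _;
     case: H' => [[? ?]|[? ?]|[? ? ?]]
  end.

(* [congruence] fails on equations between dependently typed coordinates once
   an equation between the indices is in the context. *)
Local Ltac index_congr :=
  exfalso; repeat match goal with
  | H : @eq (Choice.sort _) _ _ |- _ => clear H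
  | H : ~ @eq (Choice.sort _) _ _ |- _ => clear H
  end; congruence.

Local Ltac coord_congr :=
  repeat match goal with
  | H : @eq (ordinal _) _ _ |- _ => clear H
  | H : ~ @eq (ordinal _) _ _ |- _ => clear H
  end; congruence.

Local Ltac at_congr := first [by [] | index_congr | coord_congr].

Lemma differ2 y z i j : adj y z -> i <> j -> y i <> z i -> y j <> z j ->
  forall k, k <> i -> k <> j -> y k = z k.
Proof.
move=> /adjP[a [b yz]] ij yi yj k ki kj.
have [[? ?]|[? ?]|[? ? ?]] := step_at yz k => //;
  have [[? ?]|[? ?]|[? ? ?]] := step_at yz i => //;
  have [[? ?]|[? ?]|[? ? ?]] := step_at yz j => //; at_congr.
Qed.

Lemma sib_not_adj j y z : sib j y z -> ~ adj y z.
Proof.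
move=> [yz pyz _] /adjP[a [b s]].
have [[_ e]|[_ e]|[_ _ e]] := step_at s j; last exact: yz.
  by apply: (@preN j (z j)); rewrite -pyz -e.
by apply: (@preN j (y j)); rewrite pyz e.
Qed.

(** The moves of [j] cancel: from [w1], coordinate [k1] returns to its value in [y] and [k2] moves
    to its value in [w2]. *)
Lemma step_same_up j k1 k2 y w1 w2 :
  step j k1 y w1 -> step j k2 y w2 -> k1 != k2 -> step k1 k2 w1 w2.
Proof.
move=> y1 y2 k12; have jk1 := step_neq y1; have jk2 := step_neq y2.
move/eqP: (k12) => k12'; split=> //; last first.
- move=> n /eqP n1 /eqP n2; cases_at n; at_congr.
- cases_at k2; at_congr.
- cases_at k1; at_congr.
Qed.

(** The common neighbours [u], [v] move [j] to its predecessor and a second coordinate [k] to two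
    different successors; for [d >= 4], [a] and [b] move [j] likewise and send a third and a fourth
    coordinate to a successor. *)
Lemma sib_sibling_graph j y z : sib j y z -> @sibling_graph X y z.
Proof.
move=> yz; have [yzj pyz yzk] := yz.
have [k /eqP kj] := other_index j.
have jk : j != k by apply/eqP => /esym.
have [c [c' [pc pc' cc]]] := children2 (y k).
have [u yu uk] := step_exists jk pc; have [v yv vk] := step_exists jk pc'.
have zw c0 w : step j k y w -> w k = c0 -> step j k z w.
  move=> [_ wj wk wl] _; split=> //; first by rewrite wj.
    by rewrite wk yzk.
  by move=> l lj lk; have /eqP lj' := lj; rewrite -yzk // wl.
have zu := zw _ _ yu uk; have zv := zw _ _ yv vk.
have nyz : y <> z by move=> e; apply: yzj; rewrite e.
split=> //; first exact: sib_not_adj yz.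
exists u, v; rewrite ![adj u _]adj_sym ![adj v _]adj_sym; split.
  by split; [exact: step_adj yu|exact: step_adj zu|exact: step_adj yv|exact: step_adj zv].
have uv : sib k u v.
  split; first by rewrite uk vk.
    by rewrite uk vk pc pc'.
  move=> l lk; cases_at l; at_congr.
split.
- by move=> e; case: uv => uvk _ _; apply: uvk; rewrite e.
- exact: sib_not_adj uv.
move=> d4.
have [l [m [jl jm kl km lm]]] : exists l m, [/\ j != l, j != m, k != l, k != m & l != m].
  have : (2 <= #|~: [set j; k]|)%N.
    by have := cardsC [set j; k]; rewrite cards2 jk card_ord; lia.
  move=> /card_gt1P[l [m []]]; rewrite !inE !negb_or ![_ == j]eq_sym ![_ == k]eq_sym.
  by move=> /andP[? ?] /andP[? ?] ?; exists l, m.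
have [cl pcl] := child_exists (y l); have [cm pcm] := child_exists (y m).
have [a ya al] := step_exists jl pcl; have [b yb bm] := step_exists jm pcm.
have zsib l' w : step j l' y w -> step j l' z w.
  move=> [jl' wj wk wl]; split=> //; first by rewrite wj.
    by rewrite wk yzk //; apply/eqP; rewrite eq_sym.
  by move=> n nj nl; have /eqP nj' := nj; rewrite -yzk // wl.
have za := zsib _ _ ya; have zb := zsib _ _ yb.
have adj2 k1 k2 w1 w2 s1 s2 e12 := step_adj (@step_same_up j k1 k2 y w1 w2 s1 s2 e12).
exists a, b; rewrite ![adj a _]adj_sym ![adj b _]adj_sym.
split; first by split;
  [exact: step_adj ya|exact: step_adj za|exact: step_adj yb|exact: step_adj zb].
by split;
  [apply: adj2 yu ya _|apply: adj2 yu yb _|apply: adj2 ya yb _].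
Qed.

(** The height difference of [y] and [z] at [k] is computed through [u] and through [v]. *)
Lemma common_nbr_diff i j i' j' a b a' b' u v y z :
  step i j u y -> step i' j' u z -> step a b v y -> step a' b' v z -> forall k,
  (k == j)%:Z - (k == i)%:Z - ((k == j')%:Z - (k == i')%:Z) =
  (k == b)%:Z - (k == a)%:Z - ((k == b')%:Z - (k == a')%:Z).
Proof.
move=> uy uz vy vz k.
by rewrite -(step_height uy) -(step_height uz) -(step_height vy) -(step_height vz); lia.
Qed.

(** The expression is the number of [b], [a'] equal to [k] minus the number of [a], [b'] equal to
    [k]. *)
Lemma diff_down a b a' b' k : a <> b -> a' <> b' ->
  (k == b)%:Z - (k == a)%:Z - ((k == b')%:Z - (k == a')%:Z) < 0 ->
  (k = a \/ k = b') /\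
  ((k == b)%:Z - (k == a)%:Z - ((k == b')%:Z - (k == a')%:Z) < -1 -> k = a /\ k = b').
Proof.
move=> ab ab'.
case: (k =P a) => [ka|_]; case: (k =P b) => [kb|_]; case: (k =P a') => [ka'|_];
  case: (k =P b') => [kb'|_]; try (by exfalso; congruence);
  by move=> /= lt0; split; [first [by left|by right|lia] | move=> lt1; first [by split|lia]].
Qed.

(** Seen from [u], the height difference is negative exactly at [i] and [j'], with value -2 if they
    coincide; seen from [v], it can be negative only at [a] and [b']. *)
Lemma corner_indices i j i' j' a b a' b' :
  i <> j -> i' <> j' -> a <> b -> a' <> b' -> i <> i' -> j <> j' ->
  (forall k, (k == j)%:Z - (k == i)%:Z - ((k == j')%:Z - (k == i')%:Z) =
  (k == b)%:Z - (k == a)%:Z - ((k == b')%:Z - (k == a')%:Z)) ->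
  (a = i /\ b' = j') \/ (a = j' /\ b' = i).
Proof.
move=> ij ij' ab ab' ii' jj' D.
have : [\/ i = a | i = b'] /\ (i = j' -> i = a /\ i = b').
  have := @diff_down a b a' b' i ab ab'; rewrite -D eqxx.
  rewrite (introF eqP ij) (introF eqP ii') /=.
  case: (i =P j') => [_ []//|_ []//]; first by move=> ? H; split=> // _; apply: H.
have : [\/ j' = a | j' = b'].
  have := @diff_down a b a' b' j' ab ab'; rewrite -D eqxx.
  rewrite (introF eqP (not_eq_sym jj')) (introF eqP (not_eq_sym ij')).
  by case: (j' =P i) => _ [].
by move=> [<-|<-] [[<-|<-]] H; [left; case: H|right|left|left; case: H].
Qed.

(* [u] and [v] are common neighbours of [y] and [z]. Comparing the heights of all
   coordinates leaves four possibilities for the types of the edges from [v]. *)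
Lemma corner i j i' j' a b a' b' u v y z :
  step i j u y -> step i' j' u z -> step a b v y -> step a' b' v z ->
  i <> i' -> j <> j' ->
  [\/ v = u, step i' j u v, step i j' u v
    | [/\ a = j' /\ b' = i, b = i' /\ a' = j, i <> j' & j <> i']].
Proof.
move=> uy uz vy vz ii' jj'.
have D := common_nbr_diff uy uz vy vz.
have [ij ij' ab ab'] := And4 (step_neq uy) (step_neq uz) (step_neq vy) (step_neq vz).
have I1 : (a = i /\ b' = j') \/ [/\ a = j', b' = i & i <> j'].
  have [|[aj' b'i]] := corner_indices ij ij' ab ab' ii' jj' D; first by left.
  by have [e|/eqP e] := eqVneq i j'; [left|right; split]; rewrite ?aj' ?b'i.
have I2 : (b = j /\ a' = i') \/ [/\ b = i', a' = j & j <> i'].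
  have D' k : (k == i)%:Z - (k == j)%:Z - ((k == i')%:Z - (k == j')%:Z) =
    (k == a)%:Z - (k == b)%:Z - ((k == a')%:Z - (k == b')%:Z).
    by have := D k; lia.
  have := corner_indices (not_eq_sym ij) (not_eq_sym ij') (not_eq_sym ab)
    (not_eq_sym ab') jj' ii' D'.
  case=> [|[bi' a'j]]; first by left.
  by have [e|/eqP e] := eqVneq j i'; [left|right; split]; rewrite ?bi' ?a'j.
case: I1 => [[ai bj']|[ai bj' ij'']]; case: I2 => [[bj ai']|[bj ai' ji'']]; subst.
- constructor 1; apply: dl_vertexP => k; cases_at k; at_congr.
- constructor 2; split; first exact/eqP/not_eq_sym.
  + cases_at i'; at_congr.
  + cases_at j; at_congr.
  + move=> k /eqP ki' /eqP kj; cases_at k; at_congr.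
- constructor 3; split; first exact/eqP.
  + cases_at i; at_congr.
  + cases_at j'; at_congr.
  + move=> k /eqP ki /eqP kj'; cases_at k; at_congr.
- by constructor 4; split.
Qed.

Lemma uniq4_le_d (i j k l : 'I_d) : uniq [:: i; j; k; l] -> (4 <= d)%N.
Proof. by move=> u4; have := max_card (mem [:: i; j; k; l]); rewrite (card_uniqP u4) card_ord. Qed.

(** By the heights, the edges from [v] share either the coordinate moving to a predecessor, which
    would give [y j = z j], or the one moving to a successor; this one must then be [j], whence
    [v = u]. *)
Lemma corner_same_down i i' j a b a' b' u v y z :
  step i j u y -> step i' j u z -> step a b v y -> step a' b' v z ->
  i <> i' -> y j <> z j -> v = u.
Proof.
move=> uy uz vy vz ii' yz.
have D := common_nbr_diff uy uz vy vz.
have [ij ij' ab ab'] := And4 (step_neq uy) (step_neq uz) (step_neq vy) (step_neq vz).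
have I1 : i = a \/ i = b'.
  apply: (diff_down (b := b) (a' := a') _ _ _).1 => //; rewrite -D eqxx.
  by rewrite (introF eqP ii'); case: (i == j).
have I2 : i' = b \/ i' = a'.
  apply: (diff_down (b := a) (a' := b') _ _ _).1 => //; try exact: not_eq_sym.
  have := D i'; rewrite eqxx (introF eqP (not_eq_sym ii')); case: (i' == j) => /=; lia.
case: I1 => ?; case: I2 => ?; subst.
- exfalso; have := D a'; rewrite eqxx (introF eqP ab') /=; lia.
- have bb' : b = b'.
    by apply/eqP; have := D b; rewrite eqxx; case: (b == b') => //=; lia.
  subst; have [jb|/eqP jb] := eqVneq j b'; last first.
    by exfalso; apply: yz; cases_at j; at_congr.
  by subst; apply: dl_vertexP => k; cases_at k; at_congr.
- have aa' : a = a'.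
    by apply/eqP; have := D a; rewrite eqxx; case: (a == a') => //=; lia.
  by subst; exfalso; apply: yz; cases_at j; at_congr.
- exfalso; have := D b; rewrite eqxx (introF eqP (not_eq_sym ab)) /=; lia.
Qed.

Lemma not_adj_differ4 y z (i j k l : 'I_d) : uniq [:: i; j; k; l] ->
  y i <> z i -> y j <> z j -> y k <> z k -> y l <> z l -> ~ adj y z.
Proof.
rewrite /= !inE !negb_or => /and4P[/and3P[/eqP ij /eqP ik /eqP il] /andP[/eqP jk _] _ _].
by move=> yi yj yk yl yz; apply: yk; apply: (differ2 yz ij yi yj); exact: not_eq_sym.
Qed.

(** Let [(i, j)] and [(i', j')] be the types of the edges from [u]. If [i = i'], then [y] and [z]
    are adjacent or siblings. If only [j = j'], they are adjacent or [u] is their only common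
    neighbour. Otherwise [corner] makes the four indices distinct, and the clause on triangles
    fails. *)
Lemma sibling_graph_sib y z : @sibling_graph X y z -> exists j, sib j y z.
Proof.
move=> [yz nyz [u [v [[/adjP[i [j uy]] /adjP[i' [j' uz]] vy vz] [uv nuv tri]]]]].
have ij := step_neq uy; have ij' := step_neq uz.
have [ii'|/eqP ii'] := eqVneq i i'.
  subst; have [jj'|jj'] := eqVneq j j'; last first.
    by exfalso; apply: nyz; exact: step_adj (step_same_up uy uz jj').
  subst; exists j'; split.
  - move=> e; apply: yz; apply: dl_vertexP => k; have [->//|/eqP kj] := eqVneq k j'.
    by cases_at k; at_congr.
  - by cases_at j'; at_congr.
  - by move=> k kj; cases_at k; at_congr.
exfalso; have [jj'|/eqP jj'] := eqVneq j j'.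
  subst; have [e|ne] := pselect (y j' = z j').
    apply: nyz; apply/adjP; exists i', i; split; first exact/eqP/not_eq_sym.
    - by cases_at i'; at_congr.
    - by cases_at i; at_congr.
    - move=> k /eqP ki' /eqP ki; have [->//|/eqP kj] := eqVneq k j'.
      by cases_at k; at_congr.
  move/adjP: vy => [a [b vy]]; move/adjP: vz => [a' [b' vz]].
  by apply: uv; apply/esym; exact: corner_same_down uy uz vy vz ii' ne.
have diff4 w w' : w i <> w' i -> w j <> w' j -> w i' <> w' i' -> w j' <> w' j' ->
    i <> j' -> j <> i' -> ~ adj w w'.
  move=> wi wj wi' wj' ij'' ji''; apply: (@not_adj_differ4 w w' i j i' j') => //.
  rewrite /= !inE !negb_or; repeat (apply/andP; split) => //; apply/eqP => //.
have preNE k (a b : T (q k)) : a = pre b -> a <> b by move=> -> /preN.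
have preNE' k (a b : T (q k)) : pre a = b -> a <> b by move=> <- /esym/preN.
have [ij'' ji''] : i <> j' /\ j <> i'.
  move/adjP: vy => [a [b vy]]; move/adjP: vz => [a' [b' vz]].
  by have [/esym//|/step_adj//|/step_adj//|[_ _ ? ?]] := corner uy uz vy vz ii' jj'.
have u4 : uniq [:: i; j; i'; j'].
  rewrite /= !inE !negb_or; repeat (apply/andP; split) => //; apply/eqP => //;
    exact: not_eq_sym.
have [a [b [[ay az yb' bz] [au bu ab]]]] := tri (uniq4_le_d u4).
(* A common neighbour adjacent to [u] differs from [u] in two coordinates only, which excludes the
   last case of [corner]. *)
have cor w : adj w y -> adj w z -> adj w u -> step i' j u w \/ step i j' u w.
  move=> /adjP[s [t wy]] /adjP[s' [t' wz]] wu.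
  have [e|uw|uw|[[? ?] [? ?] _ _]] := corner uy uz wy wz ii' jj'; [|by left|by right|].
    by move: wu; rewrite e adj_irr.
  exfalso; subst; move: wu; apply: diff4 => //.
  - cases_at i; try index_congr; apply: preNE; congruence.
  - cases_at j; try index_congr; apply: preNE'; congruence.
  - cases_at i'; try index_congr; apply: preNE; congruence.
  - cases_at j'; try index_congr; apply: preNE'; congruence.
(* Two vertices reached from [u] by edges of one type are equal or siblings, hence not adjacent. *)
have same s t : step s t u a -> step s t u b -> False.
  move=> ua ub; have [e|e] := pselect (a t = b t).
    suff e' : a = b by move: ab; rewrite e' adj_irr.
    apply: dl_vertexP => k; have [->//|/eqP kt] := eqVneq k t.
    by clear - ua ub kt; cases_at k; at_congr.
  apply: (@sib_not_adj t a b) => //; split=> //.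
    by clear - ua ub; have st := step_neq ua; cases_at t; at_congr.
  by move=> k kt; clear - ua ub kt; cases_at k; at_congr.
(* Edges of types with four distinct indices lead to vertices differing in four coordinates. *)
have opp s t s' t' : step s t u a -> step s' t' u b ->
    s <> s' -> t <> t' -> s <> t' -> t <> s' -> False.
  move=> ua ub ss' tt' st' ts'; have st := step_neq ua; have st'' := step_neq ub.
  apply: (@not_adj_differ4 a b s t s' t') => //.
  - rewrite /= !inE !negb_or; repeat (apply/andP; split) => //; apply/eqP => //.
  - clear - ua ub ss' tt' st' ts' st st'' preNE preNE'; cases_at s; try index_congr.
    apply: preNE; congruence.
  - clear - ua ub ss' tt' st' ts' st st'' preNE preNE'; cases_at t; try index_congr.
    apply: preNE'; congruence.
  - clear - ua ub ss' tt' st' ts' st st'' preNE preNE'; cases_at s'; try index_congr.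
    apply: not_eq_sym; apply: preNE; congruence.
  - clear - ua ub ss' tt' st' ts' st st'' preNE preNE'; cases_at t'; try index_congr.
    apply: not_eq_sym; apply: preNE'; congruence.
have [ua|ua] := cor a ay az au; have [ub|ub] := cor b yb' bz bu.
- exact: same ua ub.
- by apply: opp ua ub _ _ _ _ => //; exact: not_eq_sym.
- by apply: opp ua ub _ _ _ _ => //; exact: not_eq_sym.
- exact: same ua ub.
Qed.

(** * The permutation of coordinates induced by an automorphism *)

Lemma sibling_graph_aut (Y : graph) (f : graph_aut Y) (y z : Y) :
  sibling_graph y z -> sibling_graph (f y) (f z).
Proof.
have fI := can_inj (aut_funK f).
move=> [yz nyz [u [v [[uy uz vy vz] [uv nuv tri]]]]]; split; first by move/fI.
  by rewrite aut_adj.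
exists (f u), (f v); rewrite !aut_adj; split=> //; split=> //; first by move/fI.
move=> /tri[a [b [[ay az yb' bz] [au bu ab]]]]; exists (f a), (f b).
by rewrite !aut_adj.
Qed.

Lemma aut_sib (f : graph_aut X) j y z : sib j y z -> exists k, sib k (f y) (f z).
Proof. by move=> yz; apply/sibling_graph_sib/sibling_graph_aut/sib_sibling_graph/yz. Qed.

Lemma sib_sib j k y z w : sib j y z -> sib k y w -> j <> k ->
  z <> w /\ forall l, ~ sib l z w.
Proof.
move=> [yz pyz ez] [yw pyw ew] jk.
have zj : z j <> w j by rewrite -ew // => /esym.
have zk : z k <> w k by rewrite -ez //; exact: not_eq_sym.
split=> [e|l [zl _ el]]; first by rewrite e in zj.
have [e|/eqP e] := eqVneq j l; last by apply: zj; apply: el.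
by subst; apply: zk; apply: el; exact: not_eq_sym.
Qed.

(** Siblings of [y] in the same coordinate are equal or siblings of each other, those in different
    coordinates never are. So [f] maps families to families, injectively because [f^-1] also
    preserves siblings. *)
Lemma aut_sib_perm (f : graph_aut X) y :
  exists s : {perm 'I_d}, forall j z, sib j y z -> sib (s j) (f y) (f z).
Proof.
have fI := can_inj (aut_funK f).
have : forall j, exists k, forall z, sib j y z -> sib k (f y) (f z).
  move=> j; have [z yz] := sib_exists j y.
  have [k fyz] := aut_sib f yz; exists k => w yw.
  have [<-//|zw] := sib_trans yz yw.
  have [l fyw] := aut_sib f yw; have [m fzw] := aut_sib f zw.
  have [->//|/eqP kl] := eqVneq k l.
  by have [_ /(_ m)] := sib_sib fyz fyw kl.
move=> /boolp.choice[s sP].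
have sI : injective s.
  move=> j k sjk; apply/eqP/negPn/negP => /eqP jk.
  have [z yz] := sib_exists j y; have [w yw] := sib_exists k y.
  have [zw nzw] := sib_sib yz yw jk.
  have := sP _ _ yw; rewrite -sjk => fyw.
  have [/fI//|fzw] := sib_trans (sP _ _ yz) fyw.
  have [l] := aut_sib (f^-1)%g fzw.
  by rewrite /= !aut_funK; exact: nzw.
by exists (perm sI) => j z; rewrite permE; exact: sP.
Qed.

Lemma preN2 k (a : T (q k)) : pre (pre a) <> a.
Proof.
move/(congr1 (@busemann _)); rewrite !(hc_height (hc k)); lia.
Qed.

(** Siblings of [x] adjacent to [y] reveal the index [i] and, after reversing the edge, siblings of
    [y] adjacent to [x] reveal [j]. *)
Lemma sib_adj_step i j m x y z : step i j x y -> sib m x z -> adj z y -> m = i.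
Proof.
move=> xy [xz pxz _] /adjP[s [t zy]].
have [[//]|[_ e]|[_ _ e]] := step_at xy m;
  have [[_ e']|[_ e']|[_ _ e']] := step_at zy m; exfalso.
- by apply: (@preN2 m (x m)); rewrite pxz -e'.
- by apply: xz; rewrite -e.
- by apply: (@preN m (x m)); rewrite pxz e'.
- by apply: (@preN m (x m)); rewrite pxz -e' e.
- by apply: (@preN m (z m)); rewrite -pxz e.
- by apply: xz; rewrite e e'.
Qed.

Lemma sib_step i j x y z : step i j x y -> sib i x z -> step i j z y.
Proof.
move=> [ij yi yj yk] [_ pxz xzk]; split=> //; first by rewrite -pxz.
  by rewrite -xzk //; apply/eqP; rewrite eq_sym.
by move=> k ki kj; rewrite -xzk ?yk //; exact/eqP.
Qed.

Lemma aut_step (f : graph_aut X) (s t : {perm 'I_d}) i j x y :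
  (forall k z, sib k x z -> sib (s k) (f x) (f z)) ->
  (forall k z, sib k y z -> sib (t k) (f y) (f z)) ->
  step i j x y -> step (s i) (t j) (f x) (f y).
Proof.
move=> fs ft xy.
have [a [b fxy]] : exists a b, step a b (f x) (f y).
  by apply/adjP; rewrite aut_adj; exact: step_adj xy.
have [z xz] := sib_exists i x; have [w yw] := sib_exists j y.
have -> : s i = a.
  apply: sib_adj_step fxy (fs _ _ xz) _.
  by rewrite aut_adj; exact: step_adj (sib_step xy xz).
suff -> : t j = b by [].
apply: sib_adj_step (step_sym fxy) (ft _ _ yw) _.
by rewrite aut_adj; exact: step_adj (sib_step (step_sym xy) yw).
Qed.

(** For [k] other than [i] and [j], the edge can be moved to parallel siblings [x'], [y'] in
    coordinate [k], whose images stay adjacent; this forces [s k = t k]. As [s i] differs from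
    [t j], injectivity then settles the indices [i] and [j]. *)
Lemma aut_perm_step (f : graph_aut X) (s t : {perm 'I_d}) i j x y :
  (forall k z, sib k x z -> sib (s k) (f x) (f z)) ->
  (forall k z, sib k y z -> sib (t k) (f y) (f z)) ->
  step i j x y -> s = t.
Proof.
move=> fs ft xy; have fxy := aut_step fs ft xy.
have ij := step_neq xy; have sitj := step_neq fxy.
have off k : k <> i -> k <> j -> s k = t k.
  move=> ki kj; apply/eqP/negPn/negP => /eqP st.
  have [c [xc pc]] : exists c, x k <> c /\ pre c = pre (x k).
    have [z [xz pxz _]] := sib_exists k x; by exists (z k).
  have [_ _ _ xyk] := xy; have ek : x k = y k by apply: xyk; exact/eqP.
  have [x' xx' x'k] := sib_make xc pc.
  have [y' yy' y'k] : exists2 y', sib k y y' & y' k = c.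
    by apply: sib_make; rewrite -ek.
  have fxy' : adj (f x') (f y').
    rewrite aut_adj; apply/adjP; exists i, j; have [_ yi yj _] := xy.
    have [_ _ ex] := xx'; have [_ _ ey] := yy'; split; first exact/eqP.
    - by rewrite -ey -1?ex 1?yi //; exact: not_eq_sym.
    - by rewrite -ey -1?ex 1?yj //; exact: not_eq_sym.
    - move=> l li lj; have [->|/eqP lk] := eqVneq l k; first by rewrite x'k y'k.
      by rewrite -ex // -ey // xyk.
  have sx := fs _ _ xx'; have sy := ft _ _ yy'.
  have sksi : s k <> s i by move/perm_inj.
  have tktj : t k <> t j by move/perm_inj.
  (* In coordinate [s k], [f x'] is a sibling of [f x] while [f y'] equals [f y]. *)
  have [sx1 sx2 _] := sx; have [_ _ sy3] := sy.
  have {}sy3 := sy3 _ st.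
  move/adjP: fxy' => [a [b fxy']].
  have [[? _]|[_ e]|[_ _ e]] := step_at fxy (s k); first by [].
  - have [[_ e']|[_ e']|[_ _ e']] := step_at fxy' (s k).
    + by apply: (@preN2 (s k) (f x (s k))); rewrite sx2 -e' -sy3 e.
    + by apply: sx1; rewrite -e' -sy3 e.
    + by apply: (@preN (s k) (f x (s k))); rewrite sx2 e' -sy3 e.
  - have [[_ e']|[_ e']|[_ _ e']] := step_at fxy' (s k).
    + by apply: (@preN (s k) (f x (s k))); rewrite sx2 -e' -sy3 -e.
    + by apply: (@preN (s k) (f x' (s k))); rewrite -sx2 e sy3 e'.
    + by apply: sx1; rewrite e' e sy3.
apply/permP.
have at2 (u v : {perm 'I_d}) : (forall k, k <> i -> k <> j -> u k = v k) ->
    u i <> v j -> u i = v i.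
  move=> uv uivj; pose k := (v^-1)%g (u i); have vk : v k = u i by rewrite permKV.
  have [ki|/eqP ki] := eqVneq k i; first by rewrite -vk ki.
  have [kj|/eqP kj] := eqVneq k j; first by case: uivj; rewrite -vk kj.
  by move: vk; rewrite -uv // => /perm_inj.
have si := at2 s t off sitj.
move=> k; have [->//|/eqP ki] := eqVneq k i; have [->|/eqP kj] := eqVneq k j; last exact: off.
pose l := (t^-1)%g (s j); have tl : t l = s j by rewrite permKV.
have [li|/eqP li] := eqVneq l i; first by move: tl; rewrite li -si => /perm_inj.
have [lj|/eqP lj] := eqVneq l j; first by rewrite -tl lj.
by move: tl; rewrite -off // => /perm_inj.
Qed.

(** * The automorphism group of DL *)

Lemma busemann_dl_origin : \sum_j busemann (origin (T (q j))) = 0.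
Proof. by rewrite big1 // => j _; exact: busemann_origin. Qed.

Definition dl_origin : X := DLVertex busemann_dl_origin.

Lemma vertex_at j (t : T (q j)) : exists x, x j = t.
Proof.
have [i ij] := other_index j.
have [c ct] := busemann_surj (hc i) (ltnW (q_ge2 i)) (- busemann t).
pose f := dfwith (dfwith (dl_coord dl_origin) i c) j t.
have fj : f j = t by rewrite /f dfwithin.
have fi : f i = c by rewrite /f dfwithout 1?eq_sym // dfwithin.
have f0 : \sum_k busemann (f k) = 0.
  rewrite (bigD1 j) //= (bigD1 i) //= fj fi ct addrA subrr add0r.
  rewrite big1 // => k /andP[kj ki].
  rewrite /f dfwithout 1?eq_sym // dfwithout 1?eq_sym //.
  exact: busemann_origin.
by exists (DLVertex f0).
Qed.

(** * Connectedness *)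

Definition reach x y := exists p, walk x y p.

Lemma reach_refl x : reach x x.
Proof. by exists [::]. Qed.

Lemma reach_trans x y z : reach x y -> reach y z -> reach x z.
Proof. by move=> [p xy] [p' yz]; exists (p ++ p'); exact: walk_cat xy yz. Qed.

Lemma step_reach i j x y : step i j x y -> reach x y.
Proof. by move=> /step_adj xy; exists [:: y]; split=> //; apply/andP; split. Qed.

Lemma reach_down i j n x (c : T (q i)) : i != j -> iter n (@pre _) c = x i ->
  exists2 y, reach x y & [/\ y i = c, y j = iter n (@pre _) (x j)
    & forall k, k != i -> k != j -> y k = x k].
Proof.
move=> ij; elim: n c => [|n IH] c cx.
  by exists x; [exact: reach_refl|].
have [y xy [yi yj yk]] := IH (pre c) (etrans (esym (iterSr n _ c)) cx).
have ji : j != i by rewrite eq_sym.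
have [z yz zi] := step_exists ji (esym yi).
exists z; first exact: reach_trans xy (step_reach yz).
have [_ zj _ zk] := yz; split=> //; first by rewrite zj yj.
by move=> k ki kj; rewrite -zk // yk.
Qed.

(** Coordinate [i] moves through a common ancestor of [x i] and [t], while [j] balances the
    heights. *)
Lemma reach_coord i j x (t : T (q i)) : i != j ->
  exists2 y, reach x y & [/\ y i = t,
    (forall k, k != i -> k != j -> y k = x k)
    & busemann t = busemann (x i) -> y j = x j].
Proof.
move=> ij; have ji : j != i by rewrite eq_sym.
have [m [n mn]] := hc_merge (hc i) (x i) t.
(* The balancing coordinate first goes to an [m]-th descendant, so that the [n] predecessor steps
   afterwards bring it back to [x j] if [m = n]. *)
have [c cx] := descendant (hc j) (ltnW (q_ge2 j)) m (x j).
have [y xy [yj yi yk]] := reach_down ji cx.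
rewrite mn in yi; have [z yz [zi zj zk]] := reach_down ij (esym yi).
exists z; first exact: reach_trans xy yz.
split=> // [k ki kj|tx]; first by rewrite zk // yk.
rewrite zj yj -cx; congr (iter _ _ _).
have := congr1 (@busemann _) mn; rewrite !(busemann_iter (hc i)); lia.
Qed.

(** All coordinates but [i0] are adjusted one by one with [i0] as the balance. Then [i0] is adjusted
    with [i1] as the balance, which returns to its place because the height at [i0] is already
    right. *)
Lemma DL_connected : connected_graph X.
Proof.
move=> x y; pose i0 : 'I_d := Ordinal (ltnW d_ge2).
have [i1 i10] := other_index i0.
have [x' xx' x'y] : exists2 x', reach x x' & forall k, k != i0 -> x' k = y k.
  suff [x' xx' x'y] : exists2 x', reach x x' &
      {in [seq k <- enum 'I_d | k != i0], forall k, x' k = y k}.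
    by exists x' => // k ki; apply: x'y; rewrite mem_filter mem_enum /= ki.
  elim: [seq k <- _ | _] (filter_all (fun k => k != i0) (enum 'I_d)) => [_|k s IH /= /andP[ki sP]].
    by exists x; [exact: reach_refl|].
  have [x' xx' x'y] := IH sP.
  have [x2 x'x2 [x2k x2l _]] := reach_coord x' (y k) ki.
  exists x2; first exact: reach_trans xx' x'x2.
  move=> l; rewrite inE; have [->//|lk /= ls] := eqVneq l k.
  have li0 : l != i0 by have := allP sP l ls.
  by rewrite x2l // x'y.
have i01 : i0 != i1 by rewrite eq_sym.
have [y' x'y' [y'0 y'k y'1]] := reach_coord x' (y i0) i01.
apply: reach_trans xx' (reach_trans x'y' _).
suff -> : y' = y by exact: reach_refl.
apply: dl_vertexP => k; have [->//|ki0] := eqVneq k i0.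
have [->|ki1] := eqVneq k i1; last by rewrite y'k // x'y.
rewrite y'1 ?(x'y _ i10) //.
have s1 := dl_sum y; have s2 := dl_sum x'; rewrite (bigD1 i0) //= in s1.
rewrite (bigD1 i0) //= in s2.
have : \sum_(i | i != i0) busemann (x' i) = \sum_(i | i != i0) busemann (y i).
  by apply: eq_bigr => l /x'y ->.
by move=> e; move: s2; rewrite e -[X in _ = X]s1 => /addIr ->.
Qed.

Lemma step_exists_any i j x : i != j -> exists y, step i j x y.
Proof.
move=> ij; have [c cx] := child_exists (x j).
by have [y xy _] := step_exists ij cx; exists y.
Qed.

(** * Type-preserving automorphisms *)

Definition type_preserving (f : graph_aut X) : Prop :=
  forall i j x y, step i j x y -> step i j (f x) (f y).

Lemma type_preservingM f g :
  type_preserving f -> type_preserving g -> type_preserving (f * g)%g.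
Proof. by move=> tf tg i j x y /tg/tf. Qed.

Lemma type_preservingV f : type_preserving f -> type_preserving (f^-1)%g.
Proof.
move=> tf i j x y xy.
have [a [b fxy]] : exists a b, step a b ((f^-1)%g x) ((f^-1)%g y).
  by apply/adjP; rewrite aut_adj; exact: step_adj xy.
have := tf _ _ _ _ fxy; rewrite /= !aut_invK => /(step_uniq xy)[-> ->].
exact: fxy.
Qed.

Lemma type_preserving1 : type_preserving 1%g.
Proof. by []. Qed.

(** Along a path of [N] edges from [z] to [y], each other coordinate [k] makes [m k] predecessor
    steps, every one paired with a step of [j] to a successor on the way to [b]. As [f] preserves
    types, [N] predecessor steps lead from [f y j] to [f z j]. *)
Lemma descend_all N j (m : 'I_d -> nat) z (b : T (q j)) :
  m j = 0%N -> (\sum_k m k = N)%N -> iter N (@pre _) b = z j ->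
  exists y, [/\ y j = b, forall k, k != j -> y k = iter (m k) (@pre _) (z k)
    & forall f, type_preserving f -> iter N (@pre _) (f y j) = f z j].
Proof.
elim: N m z => [|N IH] m z mj mN bz.
  exists z; split=> // k _.
  by move/eqP: mN; rewrite sum_nat_eq0 => /forallP/(_ k)/implyP/(_ isT)/eqP ->.
have [k mk] : exists k, (0 < m k)%N.
  have [/existsP//|/existsPn no] := boolP [exists k, 0 < m k]%N.
  by move: mN; rewrite big1 // => k _; apply/eqP; have := no k; rewrite lt0n negbK.
have kj : k != j by apply: contraTneq mk => ->; rewrite mj.
rewrite iterS in bz.
have [z' zz' z'j] := step_exists kj bz.
pose m' l := (m l - (l == k))%N.
have [|||y [yj yk yf]] := IH m' z'; rewrite ?z'j //.
- by rewrite /m' mj.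
- apply/eqP; rewrite -eqSS -mN /m' (bigD1 k) //= eqxx [X in _ == X](bigD1 k) //=.
  rewrite -addSn -subSn // subn1 /= eqn_add2l; apply/eqP; apply: eq_bigr => l lk.
  by rewrite (negPf lk) subn0.
have [_ z'k _ z'l] := zz'.
exists y; split=> // [l lj|f tf].
  rewrite yk // /m'; have [->|lk] := eqVneq l k.
    by rewrite z'k -iterSr subn1 prednK.
  by rewrite subn0 z'l.
rewrite iterS yf //; by have [_ _ fj _] := tf _ _ _ _ zz'.
Qed.

Lemma type_preserving_coord f j x z :
  type_preserving f -> x j = z j -> f x j = f z j.
Proof.
move=> tf xz.
(* The pairs count predecessor steps to a common ancestor of [x k] and [z k]; at [j] no step is
   allowed. *)
have : forall k, exists mn : nat * nat, iter mn.1 (@pre _) (x k) = iter mn.2 (@pre _) (z k)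
    /\ (k = j -> mn = (0, 0)%N).
  move=> k; have [->|/eqP kj] := eqVneq k j; first by exists (0, 0)%N.
  by have [m [n mn]] := hc_merge (hc k) (x k) (z k); exists (m, n).
move=> /boolp.choice[mn mnP].
have [xz0 zz0] : mn j = (0, 0)%N /\ True by split=> //; have [_ ->] := mnP j.
(* The heights of [x] and of [z] sum to zero, so the two descents below have equally many edges. *)
have sumE : (\sum_k (mn k).1 = \sum_k (mn k).2)%N.
  have : \sum_k (busemann (x k) - (mn k).1%:Z) = \sum_k (busemann (z k) - (mn k).2%:Z).
    apply: eq_bigr => k _; rewrite -!(busemann_iter (hc k)).
    by have [-> _] := mnP k.
  rewrite sumrB [X in _ = X]sumrB !dl_sum !add0r => /oppr_inj.
  by rewrite -!(big_morph _ PoszD (erefl 0%:Z)) => -[].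
have [b bx] := descendant (hc j) (ltnW (q_ge2 j)) (\sum_k (mn k).1)%N (x j).
have [|y [yj yk yf]] := @descend_all _ j (fun k => (mn k).1) x b _ (erefl _) bx.
  by rewrite xz0.
rewrite xz in bx; have [||y' [y'j y'k y'f]] := @descend_all _ j (fun k => (mn k).2) z b _ _ bx.
- by rewrite xz0.
- by rewrite sumE.
rewrite -yf // -y'f //; congr (iter _ _ (f _ j)); apply: dl_vertexP => k.
have [->|kj] := eqVneq k j; first by rewrite yj.
by rewrite yk // y'k //; have [-> _] := mnP k.
Qed.

(** Coordinate [j] of [f x] is a function [F j] of [x j], and [F j] commutes with [pre] because [f]
    respects edges along which [j] moves to its predecessor. *)
Lemma type_preserving_affine f : type_preserving f -> exists a, f = affine_aut a.
Proof.
move=> tf; have tV := type_preservingV tf.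
have coordf g : type_preserving g ->
    exists F : forall j, T (q j) -> T (q j), forall j x, g x j = F j (x j).
  move=> tg; exists (fun j t => g (projT1 (cid (vertex_at t))) j) => j x.
  by apply: type_preserving_coord => //; case: cid.
have [F fF] := coordf _ tf; have [F' f'F] := coordf _ tV.
have : forall j, exists g : graph_aut (T (q j)),
    (forall t, g (pre t) = pre (g t)) /\ aut_fun g = F j.
  move=> j.
  have FK : cancel (F j) (F' j).
    move=> t; have [x <-] := vertex_at t.
    by rewrite -fF -f'F /= aut_funK.
  have F'K : cancel (F' j) (F j).
    move=> t; have [x <-] := vertex_at t.
    by rewrite -f'F -fF /= aut_invK.
  have Fpre t : F j (pre t) = pre (F j t).
    have [x <-] := vertex_at t; have [k jk] := other_index j.
    rewrite eq_sym in jk; have [y xy] := step_exists_any x jk.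
    have [_ yj _ _] := xy; have [_ fyj _ _] := tf _ _ _ _ xy.
    by rewrite -yj -!fF fyj.
  by have [g gF] := pre_aut (hc j) FK F'K Fpre; exists g; split=> //; rewrite gF.
move=> H; pose g j := projT1 (cid (H j)).
have [gpre gF] : (forall j t, g j (pre t) = pre (g j t)) /\ (forall j, aut_fun (g j) = F j).
  by split=> j; rewrite /g; case: cid => ? [].
have gend j : fixes_end (g j) by apply/(hc_end (hc j)).
have gh : exists2 k : 'I_d -> int, forall j, has_height (g j) (k j) & \sum_j k j = 0.
  have : forall j, exists k : int, has_height (g j) k.
    by move=> j; exact: (pre_aut_height (hc j)).
  move=> /boolp.choice[k kP]; exists k => //.
  transitivity (\sum_j (busemann (f dl_origin j) - busemann (dl_origin j))).
    by apply: eq_bigr => j _; rewrite -(kP j (dl_origin j)) gF fF.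
  by rewrite sumrB !dl_sum subrr.
exists (AffineProd gend gh); apply: graph_autP => x; apply: dl_vertexP => j /=.
by rewrite gF fF.
Qed.

Lemma affine_pre (a : affine_prod q T) j (t : T (q j)) : a j (pre t) = pre (a j t).
Proof. by have /(hc_end (hc j)) := affine_end a j; apply. Qed.

Lemma affine_type_preserving (a : affine_prod q T) : type_preserving (affine_aut a).
Proof.
move=> i j x y [ij yi yj yk]; split=> //=.
- by rewrite yi affine_pre.
- by rewrite -affine_pre yj.
- by move=> k ki kj; rewrite yk.
Qed.

Lemma affine_aut_inj : injective (@affine_aut d q T).
Proof.
move=> a b ab; apply: affine_prodP => j; apply: graph_autP => t.
by have [x <-] := vertex_at t; have /(congr1 (fun f : graph_aut X => f x j)) := ab.
Qed.

(** * Permutations of coordinates and the semidirect product *)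

Lemma pre_transport (k l : nat) (e : k = l) (t : T k) : pre (transport e t) = transport e (pre t).
Proof. by case: l / e. Qed.

Lemma transport_at x i j (l : nat) (e : q i = l) (e' : q j = l) :
  i = j -> transport e (x i) = transport e' (x j).
Proof. by move=> ij; subst j; rewrite (eq_irrelevance e e'). Qed.

Lemma branch_act_at (s : branch_perm q) x k :
  branch_act s x (s k) = transport (esym (branch_eq s k)) (x k).
Proof. by rewrite /=; apply: transport_at; rewrite permK. Qed.

Lemma branch_step (s : branch_perm q) i j x y : step i j x y ->
  step (s i) (s j) (branch_aut T s x) (branch_aut T s y).
Proof.
move=> [ij yi yj yk]; split; rewrite ?(inj_eq perm_inj) //.
- by rewrite [LHS]branch_act_at [X in pre X]branch_act_at pre_transport yi.
- by rewrite [RHS]branch_act_at [X in pre X]branch_act_at pre_transport yj.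
move=> k; rewrite -(permKV s k) !(inj_eq perm_inj) => ki kj.
by rewrite [LHS]branch_act_at [RHS]branch_act_at yk.
Qed.

(** The permutations at the two ends of an edge agree, and the graph is connected. *)
Lemma aut_perm (f : graph_aut X) :
  exists s : {perm 'I_d}, forall y k z, sib k y z -> sib (s k) (f y) (f z).
Proof.
have [s sP] := boolp.choice (aut_sib_perm f).
suff sE x y : s y = s x by exists (s dl_origin) => y k z; rewrite -(sE _ y); exact: sP.
have [p [xp <-]] := DL_connected x y.
elim: p x xp => [//|z p IH] x /= /andP[/adjP[i [j xz]] zp].
by rewrite IH // (aut_perm_step (sP x) (sP z) xz).
Qed.

(** A vertex together with its siblings in coordinate [k] makes [q k] vertices, and [f] maps them
    injectively to such a family in coordinate [s k]. The resulting inequalities are equalities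
    because [s] permutes the summands of [\sum_k q k]. *)
Lemma aut_perm_branch (f : graph_aut X) (s : {perm 'I_d}) j :
  (forall y k z, sib k y z -> sib (s k) (f y) (f z)) -> q (s j) = q j.
Proof.
move=> sP.
have le k : (q k <= q (s k))%N.
  pose o := dl_origin.
  have : forall i : 'I_(q k), exists z, z k = ch (pre (o k)) i /\ (z = o \/ sib k o z).
    move=> i; have [e|ne] := pselect (o k = ch (pre (o k)) i).
      by exists o; split=> //; left.
    have [|z oz zk] := sib_make ne; first exact: (hc_child (hc k)).
    by exists z; split=> //; right.
  move=> /boolp.choice[z zP].
  have : forall i : 'I_(q k), exists l, ch (pre (f o (s k))) l = f (z i) (s k).
    move=> i; have [l li] := hc_child_surj (hc (s k)) (f (z i) (s k)); exists l.
    rewrite -li; congr (ch _ _); have [_ [->//|/sP[_ e _]]] := zP i.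
    exact: e.
  move=> /boolp.choice[l lP].
  have lI : injective l.
    move=> i i' ll; apply/eqP/negPn/negP => /eqP ii'.
    have fzz : f (z i) (s k) = f (z i') (s k) by rewrite -!lP ll.
    have zz : z i k <> z i' k.
      by have [-> _] := zP i; have [-> _] := zP i'; move/(hc_child_inj (hc k)).
    have [_ [zo|oz]] := zP i; have [_ [zo'|oz']] := zP i'.
    - by apply: zz; rewrite zo zo'.
    - by have [+ _ _] := sP _ _ _ oz'; rewrite -zo.
    - by have [+ _ _] := sP _ _ _ oz; rewrite -zo'; move=> /(_ (esym fzz)).
    - have [e|/sP[+ _ _]] := sib_trans oz oz'; last by [].
      by apply: zz; rewrite e.
  by have := leq_card _ lI; rewrite !card_ord.
apply/eqP; rewrite eqn_leq le andbT leqNgt; apply/negP => lt.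
have : (\sum_k q k < \sum_k q (s k))%N.
  rewrite (bigD1 j) //= [X in (_ < X)%N](bigD1 j) //= -addSn.
  by apply: leq_add => //; apply: leq_sum.
by rewrite [X in (X < _)%N](reindex_inj (@perm_inj _ s)) ltnn.
Qed.

Lemma aut_decomp (f : graph_aut X) :
  exists (s : branch_perm q) (a : affine_prod q T), (branch_aut T s * affine_aut a)%g = f.
Proof.
have [s sP] := aut_perm f.
pose b := BranchPerm (fun j => aut_perm_branch j sP).
have [a fa] : exists a, ((branch_aut T b)^-1 * f)%g = affine_aut a.
  apply: type_preserving_affine => i j x y xy.
  have fxy := aut_step (sP x) (sP y) xy.
  by have := branch_step (b^-1)%g fxy; rewrite /= !permK.
by exists b, a; rewrite -fa mulgA mulgV mul1g.
Qed.

Lemma branch_autM : {morph @branch_aut d q T : s t / (s * t)%g}.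
Proof.
move=> s t; apply: graph_autP => x; apply: dl_vertexP => j /=.
rewrite transport_trans; apply: transport_at.
by rewrite /= invgM permM.
Qed.

(** The image of an edge of type [(i, j)] has type [(s i, s j)], so [s] can be read off from the
    product. *)
Lemma branch_step_eq (s t : branch_perm q) (a b : graph_aut X) :
  type_preserving a -> type_preserving b ->
  (branch_aut T s * a = branch_aut T t * b)%g -> s = t.
Proof.
move=> ta tb st; apply: branch_permP; apply/permP => i.
have [j ij] := other_index i; rewrite eq_sym in ij.
have [y xy] := step_exists_any dl_origin ij.
have sy := branch_step s (ta _ _ _ _ xy); have ty := branch_step t (tb _ _ _ _ xy).
have e z : branch_aut T s (a z) = branch_aut T t (b z).
  exact: (congr1 (fun f : graph_aut X => f z) st).
by rewrite !e in sy; have [] := step_uniq sy ty.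
Qed.

(** With [f] written as a coordinate permutation times an affine element, the affine part preserves
    types, while the permutation changes types and restores them. *)
Lemma conj_type_preserving (f a : graph_aut X) :
  type_preserving a -> type_preserving (f * a * f^-1)%g.
Proof.
move=> ta; have [s [b <-]] := aut_decomp f.
have tb := affine_type_preserving b.
have tc : type_preserving (affine_aut b * a * (affine_aut b)^-1)%g.
  by apply: type_preservingM; [exact: type_preservingM|exact: type_preservingV].
rewrite invgM -!mulgA [(_ * (a * _))%g]mulgA [((_ * a) * _)%g]mulgA.
move: tc; set c := (_ * a * _)%g => tc i j x y xy.
have sxy := tc _ _ _ _ (branch_step (s^-1)%g xy).
by have := branch_step s sxy; rewrite /= !permKV.
Qed.

Lemma aut_semidirect_product :
  @semidirect_product (graph_aut X) (branch_perm q) (affine_prod q T)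
    (@branch_aut d q T) (@affine_aut d q T).
Proof.
have t1 := type_preserving1; split.
- split=> [|s t st]; first exact: branch_autM.
  by apply: (branch_step_eq t1 t1); rewrite st.
- split; last exact: affine_aut_inj.
  by move=> a b; apply: graph_autP => x; apply: dl_vertexP.
- move=> s a; have [b ->] := type_preserving_affine (conj_type_preserving
    (branch_aut T s) (affine_type_preserving a)).
  by exists b.
(* The two witnesses of [aut_decomp] are packed into a pair, so that choice yields the inverse
   map. *)
have [g gP] := boolp.choice (fun f => let: ex_intro s (ex_intro a e) := aut_decomp f in
  ex_intro (fun p : branch_perm q * affine_prod q T =>
    (branch_aut T p.1 * affine_aut p.2)%g = f) (s, a) e).
exists g => // [[s a]].
have e := gP (branch_aut T s * affine_aut a)%g.
move: (g _) e => [t b] /= e.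
have ts := branch_step_eq (affine_type_preserving b) (affine_type_preserving a) e.
by subst t; move/mulgI/affine_aut_inj: e => ->.
Qed.

(** * Unimodularity *)

(** Each vertex of the set is determined by the positions of its coordinates in finite
    enumerations. *)
Lemma finite_coords (A : forall j, set (T (q j))) :
  (forall j, finite_set (A j)) -> finite_set [set x : X | forall j, A j (x j)].
Proof.
move=> fA.
have : forall j, exists s : seq (T (q j)), forall t : T (q j), A j t -> t \in s.
  by move=> j; have /finite_seqP[s ->] := fA j; exists s.
move=> fs; pose s j := projT1 (cid (fs j)).
have sP j (t : T (q j)) : A j t -> t \in s j by rewrite /s; case: cid => ? /=; apply.
pose N := (\max_j size (s j)).+1.
pose F (k : {ffun 'I_d -> 'I_N}) : X :=
  xget dl_origin [set x | forall j, x j = nth (origin (T (q j))) (s j) (k j)].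
apply: (@sub_finite_set _ _ (F @` setT)); last exact/finite_image/finite_finset.
move=> x Ax.
have ltN j : (index (x j) (s j) < N)%N.
  rewrite ltnS; apply: leq_trans (@leq_bigmax _ (fun j => size (s j)) j).
  by rewrite ltnW // index_mem; exact: sP.
exists [ffun j => Ordinal (ltN j)] => //; rewrite /F.
have nthx j : nth (origin (T (q j))) (s j) ([ffun j => Ordinal (ltN j)] j) = x j.
  by rewrite ffunE /= nth_index // sP.
case: xgetP => [y _ yP|/(_ x) no]; last by exfalso; apply: no => j; rewrite /= nthx.
by apply: dl_vertexP => j; rewrite yP nthx.
Qed.

Lemma fibre_finite j (c : T (q j)) : finite_set [set z : T (q j) | pre z = c].
Proof.
apply: (@sub_finite_set _ _ (ch c @` setT)); last exact/finite_image/finite_finset.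
by move=> z <-; have [i iz] := hc_child_surj (hc j) z; exists i.
Qed.

Lemma iter_fibre_finite n j (c : T (q j)) :
  finite_set [set z : T (q j) | iter n (@pre _) z = c].
Proof.
elim: n c => [|n IH] c; first exact: finite_set1.
apply: (@sub_finite_set _ _ (\bigcup_(w in [set w | iter n (@pre _) w = c])
    [set z : T (q j) | pre z = w])).
  by move=> z /= zc; exists (pre z) => //=; rewrite -iterSr.
by apply: bigcup_finite => [|w _]; [exact: IH|exact: fibre_finite].
Qed.

Lemma DL_locally_finite x : finite_set [set y : X | adj x y].
Proof.
pose A j := [set x j; pre (x j)] `|` [set t | pre t = x j].
apply: (@sub_finite_set _ _ [set y : X | forall j, A j (y j)]).
  move=> y /adjP[i [k xy]] j.
  have [[_ e]|[_ e]|[_ _ e]] := step_at xy j;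
    [left; right; exact: e|right; exact: e|left; left; exact: esym e].
apply: finite_coords => j; rewrite /A finite_setU; split; first exact: finite_set2.
exact: fibre_finite.
Qed.

Lemma aut_perm_steps (f : graph_aut X) : exists s : {perm 'I_d},
  forall i j x y, step i j x y -> step (s i) (s j) (f x) (f y).
Proof.
have [s sP] := aut_perm f; exists s => i j x y.
exact: aut_step (sP x) (sP y).
Qed.

(** An automorphism permutes types uniformly, so its values at the origin and at one neighbour of
    each type decide whether it preserves them. *)
Lemma type_preserving_saturated : exists t : seq X,
  saturated t [set f : graph_aut X | type_preserving f].
Proof.
have : forall ij : 'I_d * 'I_d, exists y, ij.1 != ij.2 -> step ij.1 ij.2 dl_origin y.
  move=> [i j] /=; have [->|ij] := eqVneq i j; first by exists dl_origin.
  by have [y oy] := step_exists_any dl_origin ij; exists y.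
move=> /boolp.choice[y yP].
exists (dl_origin :: [seq y ij | ij <- enum {: 'I_d * 'I_d}]) => f g tf [go].
rewrite -!map_comp => /eq_in_map gy.
have {}gy ij : g (y ij) = f (y ij) by apply: gy; rewrite -enumT mem_enum.
have [s sP] := aut_perm_steps g.
suff s1 i : s i = i by move=> i j x z /sP; rewrite !s1.
have [j ji] := other_index i; rewrite eq_sym in ji.
have oy := yP (i, j) ji; have fs := tf _ _ _ _ oy.
have := sP _ _ _ _ oy; rewrite go gy => gs.
by have [] := step_uniq gs fs.
Qed.

Lemma affine_transitive (z w : forall k, T (q k)) :
  \sum_k (busemann (w k) - busemann (z k)) = 0 ->
  exists a : affine_prod q T, forall k, a k (z k) = w k.
Proof.
move=> zw0; pose g k := projT1 (cid (pre_aut_transitive (hc k) (z k) (w k))).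
have [gpre gz] : (forall k t, g k (pre t) = pre (g k t)) /\ (forall k, g k (z k) = w k).
  by split=> k; rewrite /g; case: cid => ? [].
have gend k : fixes_end (g k) by apply/(hc_end (hc k)).
have gh : exists2 h : 'I_d -> int, forall k, has_height (g k) (h k) & \sum_k h k = 0.
  have : forall k, exists h : int, has_height (g k) h.
    by move=> k; exact: (pre_aut_height (hc k)).
  move=> /boolp.choice[h hP]; exists h => //; rewrite -[RHS]zw0.
  by apply: eq_bigr => k _; rewrite -(hP k (z k)) gz.
by exists (AffineProd gend gh).
Qed.

Definition affine_stab x : set (graph_aut X) :=
  [set f | type_preserving f /\ f x = x].

Lemma copen_type_preserving_at x (P : set X) y :
  (forall f : graph_aut X, type_preserving f -> P (f y) -> f x = x) ->
  copen dl_origin [set f : graph_aut X | type_preserving f /\ P (f y)].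
Proof.
move=> fx; have [t tP] := type_preserving_saturated; split.
  exists (y :: t) => f g [tf Pf] [gy gt]; split; first exact: tP tf gt.
  by rewrite gy.
apply: (copen_stab_finite DL_connected DL_locally_finite (o := x)).
by apply: sub_finite_set (finite_set1 x) => _ [f [tf Pf] <-]; exact: fx Pf.
Qed.

Lemma copen_affine_stab x : copen dl_origin (affine_stab x).
Proof. exact: (@copen_type_preserving_at x [set y | y = x] x). Qed.

Lemma affine_stab_rmul (g : graph_aut X) x :
  [set (f * g)%g | f in affine_stab x] =
  [set (g * f)%g | f in affine_stab ((g^-1)%g x)].
Proof.
apply/seteqP; split=> _ [f [tf fx] <-].
  exists (g^-1 * f * g)%g; last by rewrite !mulgA mulgV mul1g.
  split; last by rewrite /= aut_invK fx.
  by have := conj_type_preserving (g^-1)%g tf; rewrite invgK.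
exists (g * f * g^-1)%g; last by rewrite -!mulgA mulVg mulg1.
split; first exact: conj_type_preserving.
by rewrite /= fx /= aut_invK.
Qed.

Lemma step_eq i j x y y' : step i j x y -> step i j x y' -> y j = y' j -> y = y'.
Proof.
move=> [ij yi yj yk] [_ yi' yj' yk'] e; apply: dl_vertexP => k.
have [->//|kj] := eqVneq k j; have [->|ki] := eqVneq k i; first by rewrite yi yi'.
by rewrite -yk // -yk'.
Qed.

Section Ratio.
Variable R : realType.
Local Notation r := (haar_ratio dl_origin R).

(** The stabilizer of [x] splits according to the value of [f y j], one of the [q j] successors of
    [x j]; each piece is a left translate of the stabilizer of both vertices. *)
Lemma ratio_affine_stab_step_half i j x y : step i j x y ->
  r (affine_stab x) = (q j)%:R * r (affine_stab x `&` affine_stab y).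
Proof.
move=> xy; have [ij yi yj yk] := xy.
pose D (s : seq 'I_(q j)) :=
  [set f | type_preserving f /\ (f x = x /\ exists2 l, l \in s & f y j = ch (x j) l)].
have cD s : copen dl_origin (D s).
  have [t tP] := type_preserving_saturated; split.
    exists [:: x, y & t] => f g [tf [fx [l ls fy]]] [gx gy gt].
    by split; [exact: tP tf gt|split; [rewrite gx|exists l; rewrite // gy]].
  by apply: bounded_sub (copen_affine_stab x).2 => f [tf [fx _]].
have cxy : copen dl_origin (affine_stab x `&` affine_stab y).
  by apply: copenI; exact: copen_affine_stab.
have D1 l : r (D [:: l]) = r (affine_stab x `&` affine_stab y).
  pose c := ch (x j) l; have pc : pre c = x j by exact: (hc_child (hc j)).
  (* [z] and [w] differ from [x] only at [j], with values [y j] and [c] there; an affine element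
     carrying [z] to [w] fixes [x] because it commutes with [pre]. *)
  pose z k := dfwith (dl_coord x) j (y j) k; pose w k := dfwith (dl_coord x) j c k.
  have zj : z j = y j by rewrite /z dfwithin.
  have wj : w j = c by rewrite /w dfwithin.
  have zk k : k != j -> z k = x k by move=> kj; rewrite /z dfwithout // eq_sym.
  have wk k : k != j -> w k = x k by move=> kj; rewrite /w dfwithout // eq_sym.
  have [|a azw] := @affine_transitive z w.
    rewrite big1 // => k _; have [->|kj] := eqVneq k j; last by rewrite zk // wk // subrr.
    have := hc_height (hc j) c; have := hc_height (hc j) (y j).
    by rewrite zj wj pc yj => -> /addIr ->; rewrite subrr.
  pose g := affine_aut a; have tg : type_preserving g := affine_type_preserving a.
  have gx : g x = x.
    apply: dl_vertexP => k; have [->|kj] := eqVneq k j; last first.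
      by have := azw k; rewrite zk // wk.
    transitivity (a j (pre (y j))); first by rewrite yj.
    by rewrite affine_pre -zj azw wj.
  have gy : g y j = c by rewrite /= -zj azw wj.
  rewrite -(haar_ratioM DL_connected DL_locally_finite R g cxy).
  congr (haar_ratio _ _ _); apply/seteqP; split.
    move=> f [tf [fx [l']]]; rewrite inE => /eqP -> fy.
    have fgy : f y = g y.
      apply: (@step_eq i j x); rewrite ?fy ?gy //.
        by have := tf _ _ _ _ xy; rewrite fx.
      by have := tg _ _ _ _ xy; rewrite gx.
    have tgf : type_preserving (g^-1 * f)%g.
      by apply: type_preservingM => //; exact: type_preservingV.
    exists (g^-1 * f)%g; last by rewrite mulgA mulgV mul1g.
    split; split=> //.
      by change (aut_inv g (f x) = x); rewrite fx -{1}gx aut_funK.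
    by change (aut_inv g (f y) = y); rewrite fgy aut_funK.
  move=> _ [f [[tf fx] [_ fy]] <-]; split; first exact: type_preservingM.
  by rewrite /= fx fy; split=> //; exists l; rewrite ?mem_head.
have Ds s : uniq s -> r (D s) = (size s)%:R * r (affine_stab x `&` affine_stab y).
  elim: s => [_|l s IH /= /andP[ls us]].
    rewrite mul0r -(haar_ratio0 DL_connected DL_locally_finite dl_origin R).
    by congr (haar_ratio _ _ _); rewrite -subset0 => f [_ [_ []]].
  have -> : D (l :: s) = D [:: l] `|` D s.
    apply/seteqP; split=> f.
      move=> [tf [fx [l']]]; rewrite inE => /orP[/eqP->|l's] fy; [left|right].
        by split=> //; split=> //; exists l; rewrite ?mem_head.
      by split=> //; split=> //; exists l'.
    move=> [[tf [fx [l']]]|[tf [fx [l']]]].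
      rewrite inE => /eqP -> fy.
      by split=> //; split=> //; exists l; rewrite ?mem_head.
    by move=> l's fy; split=> //; split=> //; exists l'; rewrite // inE l's orbT.
  rewrite (haar_ratioU DL_connected DL_locally_finite) //.
    by rewrite D1 IH // -natr1 mulrDl mul1r addrC.
  rewrite -subset0 => f [[_ [_ [l1]]]]; rewrite inE => /eqP -> fy [_ [_ [l2 l2s]]].
  by rewrite fy => /(hc_child_inj (hc j)) e; move: ls; rewrite e l2s.
have := Ds (enum 'I_(q j)) (enum_uniq _); rewrite size_enum_ord => <-.
congr (haar_ratio _ _ _); apply/seteqP; split=> f [tf]; last by case.
move=> fx; split=> //; split=> //.
have [l fl] := hc_child_surj (hc j) (f y j); exists l; first by rewrite mem_enum.
by have [_ _ e _] := tf _ _ _ _ xy; rewrite -fl e fx.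
Qed.

Lemma ratio_affine_stab_step i j x y : step i j x y ->
  (q i)%:R * r (affine_stab x) = (q j)%:R * r (affine_stab y).
Proof.
move=> xy; rewrite (ratio_affine_stab_step_half xy).
by rewrite (ratio_affine_stab_step_half (step_sym xy)) setIC mulrCA.
Qed.

Lemma ratio_affine_stab_gt0 x : 0 < r (affine_stab x).
Proof.
apply: (haar_ratio_gt0 DL_connected DL_locally_finite R (copen_affine_stab x) (g := 1%g)).
by split=> //; exact: type_preserving1.
Qed.

(** Right translation by [g] carries the stabilizer of [x] to a left translate of that of [g^-1 x].
    So unimodularity makes the stabilizers along an orbit equally large, and an edge of type
    [(i, j)] gives [q i = q j]. If all [q i] agree, connectedness makes all stabilizers equally
    large, and testing one of them shows that the modular function is trivial. *)
Lemma DL_unimodular : unimodular R (graph_aut X) <-> forall i j, q i = q j.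
Proof.
rewrite (unimodularP R DL_connected DL_locally_finite dl_origin); split=> [inv i j|qE g C cC].
  have [->//|ij] := eqVneq i j.
  have [y oy] := step_exists_any dl_origin ij.
  have [|a ay] := @affine_transitive dl_origin y.
    by rewrite sumrB !dl_sum subrr.
  have e : r (affine_stab y) = r (affine_stab dl_origin).
    rewrite -(inv (affine_aut a) _ (copen_affine_stab y)) affine_stab_rmul.
    rewrite (haar_ratioM DL_connected DL_locally_finite); last exact: copen_affine_stab.
    congr (r (affine_stab _)); apply: (can_inj (aut_funK (affine_aut a))).
    by rewrite [LHS]aut_invK; apply: dl_vertexP => k; rewrite /= ay.
  have := ratio_affine_stab_step oy; rewrite e.
  move/(mulIf (lt0r_neq0 (ratio_affine_stab_gt0 _))) => /eqP; rewrite eqr_nat.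
  by move/eqP.
have const x y : r (affine_stab x) = r (affine_stab y).
  have [p [+ <-]] := DL_connected x y; elim: p x => [//|z p IH] x /= /andP[/adjP[i [j xz]] zp].
  rewrite -IH //; have := ratio_affine_stab_step xz; rewrite (qE i j).
  by apply: mulfI; rewrite pnatr_eq0 -lt0n ltnW.
have cB := copen_affine_stab dl_origin.
have := haar_ratio_rmul R DL_connected DL_locally_finite g cB.
rewrite affine_stab_rmul (haar_ratioM DL_connected DL_locally_finite); last first.
  exact: copen_affine_stab.
rewrite (const _ dl_origin) -{1}[r (affine_stab _)]mul1r.
move=> /(mulIf (lt0r_neq0 (ratio_affine_stab_gt0 _))) e.
by rewrite (haar_ratio_rmul R DL_connected DL_locally_finite) // -e mul1r.
Qed.

End Ratio.

(** * Amenability *)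

Definition height (f : graph_aut X) j : int :=
  busemann (f dl_origin j) - busemann (dl_origin j).

Lemma type_preserving_height f x j : type_preserving f ->
  busemann (f x j) - busemann (x j) = height f j.
Proof.
move=> /type_preserving_affine[a ->]; have [k ak _] := affine_height a.
by rewrite /height /= !ak.
Qed.

Lemma heightM f g j : type_preserving f -> height (f * g)%g j = height f j + height g j.
Proof. by move=> tf; rewrite -(type_preserving_height (g dl_origin) j tf) addrA subrK. Qed.

Lemma heightV f j : type_preserving f -> height (f^-1)%g j = - height f j.
Proof.
move=> tf; rewrite -(type_preserving_height ((f^-1)%g dl_origin) j tf) /= aut_invK.
by rewrite opprB.
Qed.

(** As [f] commutes with predecessors, this is the group fixing the [n]-th ancestor of every
    coordinate of the origin; these groups increase to the kernel of all heights. *)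
Definition horo_stab n : set (graph_aut X) :=
  [set f | type_preserving f /\
    forall j, iter n (@pre _) (f dl_origin j) = iter n (@pre _) (dl_origin j)].

Lemma type_preserving_iter f x y j n : type_preserving f ->
  iter n (@pre _) (x j) = iter n (@pre _) (y j) ->
  iter n (@pre _) (f x j) = iter n (@pre _) (f y j).
Proof.
move=> /type_preserving_affine[a ->] e /=.
have ai m (t : T (q j)) : iter m (@pre _) (a j t) = a j (iter m (@pre _) t).
  by elim: m => //= m ->; rewrite affine_pre.
by rewrite !ai e.
Qed.

Lemma horo_stabM n f g : horo_stab n f -> horo_stab n g -> horo_stab n (f * g)%g.
Proof.
move=> [tf fo] [tg go]; split=> [|j]; first exact: type_preservingM.
by rewrite -fo; exact: (type_preserving_iter (x := g dl_origin) tf (go j)).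
Qed.

Lemma horo_stabV n f : horo_stab n f -> horo_stab n (f^-1)%g.
Proof.
move=> [tf fo]; split=> [|j]; first exact: type_preservingV.
have := type_preserving_iter (type_preservingV tf) (esym (fo j)).
by rewrite [(f^-1)%g (f _)]aut_funK.
Qed.

Lemma horo_stab1 n : horo_stab n 1%g.
Proof. by split=> //; exact: type_preserving1. Qed.

Lemma copen_horo_stab n : copen dl_origin (horo_stab n).
Proof.
have [t tP] := type_preserving_saturated; split.
  exists (dl_origin :: t) => f g [tf fo] [go gt].
  by split=> [|j]; [exact: tP tf gt|rewrite go].
pose A j := [set t : T (q j) | iter n (@pre _) t = iter n (@pre _) (dl_origin j)].
apply: (@sub_finite_set _ _ [set x : X | forall j, A j (x j)]).
  by move=> _ [f [tf fo] <-].
by apply: finite_coords => j; exact: iter_fibre_finite.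
Qed.

(** Equal heights make [f dl_origin j] and [dl_origin j] meet after equally many predecessor
    steps. *)
Lemma height0_horo_stab f : type_preserving f -> (forall j, height f j = 0) ->
  exists N, forall n, (N <= n)%N -> horo_stab n f.
Proof.
move=> tf f0.
have : forall j, exists N, forall n, (N <= n)%N ->
    iter n (@pre _) (f dl_origin j) = iter n (@pre _) (dl_origin j).
  move=> j; have [m [m' e]] := hc_merge (hc j) (f dl_origin j) (dl_origin j).
  have mm' : m = m'.
    have := congr1 (@busemann _) e; rewrite !(busemann_iter (hc j)).
    have := f0 j; rewrite /height; lia.
  by subst m'; exists m => n mn; rewrite -(subnK mn) !iterD e.
move=> /boolp.choice[N NP]; exists (\max_j N j)%N => n Nn; split=> // j.
by apply: NP; apply: leq_trans Nn; exact: leq_bigmax.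
Qed.

(* The subgroups [height_below n] grow from the kernel of all heights ([n = 0]) to
   [type_preserving] ([n = d]). *)
Definition height_below (n : nat) : set (graph_aut X) :=
  [set f | type_preserving f /\ forall j : 'I_d, (n <= j)%N -> height f j = 0].

Section Amenable.
Variable R : realType.
Local Notation borelType := (g_sigma_algebraType (@open (graph_aut X))).

(** On [height_below i.+1], the [i]-th height is a homomorphism to the integers with kernel
    [height_below i]. The mean is averaged over the powers of an element [t] of least nonzero
    absolute height, which generates the group together with that kernel. *)
Lemma DL_mean_step (null : set borelType -> Prop) (i : 'I_d) (p : set borelType -> R) :
  (forall (g : graph_aut X) A, null A -> null [set (g * h)%g | h in A]) ->
  is_mean null p -> (forall f, height_below i f -> mean_inv p f) ->
  exists2 p' : set borelType -> R, is_mean null p' &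
    forall f, height_below i.+1 f -> mean_inv p' f.
Proof.
move=> nullM mp pN.
have belowS f : height_below i.+1 f -> height f i = 0 -> height_below i f.
  move=> [tf f0] fi; split=> // j; rewrite leq_eqVlt => /orP[/eqP e|]; last exact: f0.
  by have -> : j = i by exact/val_inj/esym.
have [ex|no] := pselect (exists f, height_below i.+1 f /\ height f i != 0); last first.
  exists p => // f Nf; apply: pN; apply: belowS => //.
  by apply/eqP/negPn/negP => fi; apply: no; exists f.
have exn : exists n, `[< exists f, [/\ height_below i.+1 f, height f i != 0
    & `|height f i|%N = n] >].
  by have [f [Nf fi]] := ex; exists `|height f i|%N; apply/asboolP; exists f.
case: (ex_minnP exn) => c /asboolP[t [Nt ti tc]] cmin.
have [tt t0] := Nt.
have [p' mp' [pt pN']] : exists2 p' : set borelType -> R, is_mean null p' &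
    mean_inv p' t /\ forall f, height_below i f -> mean_inv p' f.
  apply: (mean_step nullM (N := height_below i) (t := t) mp pN) => f [tf f0]; split.
    exact: conj_type_preserving.
  move=> j ij; rewrite heightM; last exact: type_preservingM.
  by rewrite heightM // heightV // f0 // addr0 subrr.
(* Euclidean descent: multiplying [f] by [t] or its inverse decreases the absolute height. *)
exists p' => // f; have [n] := ubnP `|height f i|%N; elim: n f => // n IH f fn Nf.
have [fi|fi] := eqVneq (height f i) 0; first by apply: pN'; exact: belowS.
have [tf f0] := Nf; have cf : (c <= `|height f i|)%N by apply: cmin; apply/asboolP; exists f.
have red s : height_below i.+1 s -> mean_inv p' s ->
    (absz (height f i + height s i)%R < absz (height f i))%N -> mean_inv p' f.
  move=> [ts s0] ps lt; have -> : f = ((f * s) * s^-1)%g by rewrite -mulgA mulgV mulg1.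
  apply: mean_invM; last exact: mean_invV.
  apply: IH; first by rewrite heightM //; apply: leq_trans lt _; rewrite -ltnS.
  split=> [|j ij]; first exact: type_preservingM.
  by rewrite heightM // f0 // s0.
have NtV : height_below i.+1 (t^-1)%g.
  split=> [|j ij]; first exact: type_preservingV.
  by rewrite heightV // t0 // oppr0.
have ptV := mean_invV pt; have hV := heightV i tt.
have [lt|lt] : (absz (height f i + height t i)%R < absz (height f i))%N \/
    (absz (height f i + height (t^-1)%g i)%R < absz (height f i))%N.
- by move: (height t i) ti tc hV cf fi => a a0 ac -> cf fi; lia.
- exact: red Nt pt lt.
- exact: red NtV ptV lt.
Qed.

Lemma DL_amenable : amenable R (graph_aut X).
Proof.
have lf := DL_locally_finite; have cn := DL_connected.
split; first exact: (aut_locally_compact cn lf dl_origin).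
have [mu [hmu mono inv muC]] := aut_haar_exists R cn lf dl_origin.
exists mu => //.
have muH n : mu (horo_stab n) = (haar_ratio dl_origin R (horo_stab n))%:E.
  by apply: muC; exact: copen_horo_stab.
have H0 n : 0 < fine (mu (horo_stab n)).
  rewrite muH; apply: (haar_ratio_gt0 cn lf R (copen_horo_stab n) (g := 1%g)).
  exact: horo_stab1.
have Hfin (n : nat) (A : set borelType) : mu (A `&` horo_stab n) \is a fin_num.
  rewrite ge0_fin_numE //; apply: le_lt_trans (mono _ (horo_stab n) _) _ => //.
  by rewrite muH ltry.
(* A compact set is enlarged to a compact open one, whose translate is again compact. *)
have nullM (g : graph_aut X) (A : set borelType) : locally_null mu A ->
    locally_null mu [set (g * h)%g | h in A].
  move=> nA K /(compact_copen dl_origin)[C cC KC].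
  apply/eqP; rewrite eq_le measure_ge0 andbT.
  pose C' : set (graph_aut X) := [set (g^-1 * h)%g | h in C].
  have nC' : mu (A `&` C') = 0%E.
    by apply: nA; apply: (copen_compact cn lf); exact: copen_lmul cC.
  rewrite -nC' -(inv g (A `&` C')); apply: mono => _ [[h Ah <-] /KC Ch]; exists h => //.
  by split=> //; exists (g * h)%g => //; rewrite mulgA mulVg mul1g.
pose p0 (n : nat) (A : set borelType) :=
  fine (mu (A `&` horo_stab n)) / fine (mu (horo_stab n)).
have mp0 n : is_mean (locally_null mu) (p0 n).
  split.
  - by move=> A; rewrite divr_ge0 // fine_ge0.
  - move=> A; rewrite ler_pdivrMr // mul1r.
    by apply: fine_le; [exact: Hfin|rewrite muH|exact: mono].
  - by rewrite /p0 setTI divff // gt_eqF.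
  - move=> A B mA mB AB; rewrite /p0 setIUl -mulrDl; congr (_ / _).
    have mH : measurable (horo_stab n : set borelType).
      by apply: borel_copen; exact: copen_horo_stab.
    rewrite measureU //; try exact: measurableI; first by rewrite fineD // Hfin.
    by rewrite setIACA AB set0I.
  - move=> A mA nA; rewrite /p0 nA ?mul0r //.
    by apply: (copen_compact cn lf); exact: copen_horo_stab.
have [p mp pP] := mean_limit mp0.
(* From some [n] on, [f] belongs to [horo_stab n], and translating by [f] leaves [p0 n]
   unchanged. *)
have pH f : height_below 0 f -> mean_inv p f.
  move=> [tf f0] A mA; apply: pP.
  have [N NP] := height0_horo_stab tf (fun j => f0 j (leq0n j)).
  apply: (@cvg_near_cst _ _ _ _ _) => //=.
  exists N => // n /NP Hf; rewrite /= /p0 -(inv f (A `&` horo_stab n)).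
  suff -> : [set (f * h)%g | h in A `&` horo_stab n] =
      [set (f * h)%g | h in A] `&` horo_stab n by rewrite subrr.
  apply/seteqP; split=> [_ [h [Ah Hh] <-]|_ [[h Ah <-] Hh]].
    by split; [exists h|exact: horo_stabM].
  exists h => //; split=> //; have := horo_stabM (horo_stabV Hf) Hh.
  by rewrite mulgA mulVg mul1g.
have [p1 mp1 p1N] : exists2 p1 : set borelType -> R, is_mean (locally_null mu) p1 &
    forall f, type_preserving f -> mean_inv p1 f.
  suff [p1 mp1 p1N] : exists2 p1 : set borelType -> R, is_mean (locally_null mu) p1 &
      forall f, height_below d f -> mean_inv p1 f.
    exists p1 => // f tf; apply: p1N; split=> // j; by rewrite leqNgt ltn_ord.
  suff : forall n : nat, (n <= d)%N ->
      exists2 p1 : set borelType -> R, is_mean (locally_null mu) p1 &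
      forall f, height_below n f -> mean_inv p1 f by apply.
  elim=> [_|i IH id]; first by exists p.
  have [p2 mp2 p2N] := IH (ltnW id).
  exact: (DL_mean_step (i := Ordinal id) nullM mp2 p2N).
(* A finite type in bijection with [branch_perm q], as [mean_finite] averages over a finite type. *)
pose I := {s : {perm 'I_d} | [forall j, q (s j) == q j]}.
pose bp (s : I) := BranchPerm (fun j => eqP (forallP (valP s) j)).
have q1 : [forall j, q ((1%g : {perm 'I_d}) j) == q j] by apply/forallP => j; rewrite perm1.
have [p2 mp2 p2N] : exists2 p2 : set borelType -> R,
    is_mean (locally_null mu) p2 & forall g, mean_inv p2 g.
  apply: (@mean_finite _ _ _ nullM p1 type_preserving I (exist _ (1%g : {perm 'I_d}) q1)
    (fun s => branch_aut T (bp s)) mp1 p1N).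
  move=> g; have [u [a <-]] := aut_decomp g.
  have qu (s : I) : [forall j, q ((branch_fun u * val s)%g j) == q j].
    apply/forallP => j; rewrite permM; apply/eqP.
    by rewrite (eqP (forallP (valP s) _)) branch_eq.
  (* This is [s] after [u] as functions; products of permutations are written in the opposite
     order. *)
  pose f (s : I) : I := exist _ (branch_fun u * val s)%g (qu s).
  exists f; first by move=> s t /(congr1 val) /= /mulgI/val_inj.
  move=> s; have -> : branch_aut T (bp (f s)) = (branch_aut T (bp s) * branch_aut T u)%g.
    by rewrite -branch_autM; congr branch_aut; apply: branch_permP.
  rewrite mulgA; apply: conj_type_preserving; exact: affine_type_preserving.
pose m : set borelType -> \bar R := fun A => (p2 A)%:E.
have m0 A : (0 <= m A)%E by rewrite lee_fin; exact: mean_ge0 mp2 _.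
have p20 : p2 set0 = 0.
  have := meanU mp2 measurable0 measurable0 (setI0 set0); rewrite setU0.
  by move/eqP; rewrite addrC -subr_eq subrr => /eqP/esym.
have madd : measure_function.semi_additive m.
  apply/additive2P; first by rewrite /m p20.
  by move=> A B mA mB AB; rewrite /m (meanU mp2).
pose c : {content set borelType -> \bar R} := HB.pack m (isContent.Build _ _ _ m m0 madd).
exists c; split.
- by rewrite /= /m (meanT mp2).
- by move=> g A mA; rewrite /= /m p2N.
- by move=> A mA nA; rewrite /= /m (mean_null mp2).
Qed.

End Amenable.

End DLSteps.

Theorem mainTheorem1 (R : realType) (d : nat) (q : 'I_d -> nat)
    (T : nat -> ended_graph)
    (hd : (2 <= d)%N) (hq : forall j, (2 <= q j)%N)
    (hT : forall j, homogeneous_tree (q j) (T (q j))) :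
  [/\ @semidirect_product (graph_aut (DL q T)) (branch_perm q) (affine_prod q T)
        (@branch_aut d q T) (@affine_aut d q T),
      amenable R (graph_aut (DL q T))
    & unimodular R (graph_aut (DL q T)) <-> (forall i j, q i = q j)].
Proof.
(* The trees [T n] are known to be homogeneous only when [n] is a value of [q]; for other [n],
   arbitrary maps serve as defaults. *)
have H n : exists pc : (T n -> T n) * (T n -> 'I_n -> T n),
    forall j, q j = n -> horocyclic pc.1 pc.2.
  have [[j <-]|no] := pselect (exists j, q j = n).
    by have [pre [ch hc]] := homogeneous_tree_horocyclic (hT j); exists (pre, ch).
  by exists (id, fun x _ => x) => j jn; case: no; exists j.
pose pre n := (projT1 (cid (H n))).1; pose ch n := (projT1 (cid (H n))).2.
have hc j : horocyclic (pre (q j)) (ch (q j)).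
  by rewrite /pre /ch; case: cid => pc /= /(_ j erefl).
split.
- exact: (aut_semidirect_product hc hd hq).
- exact: (DL_amenable hc hd hq).
- exact: (DL_unimodular hc hd hq).
Qed.
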